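(* Let $k\ge 2$, and let $A_k,B_k\subseteq UT_k(F)$ be the subalgebras $A_k=\mathrm{span}\{e_{11},E,E^2,\dots,E^{k-2},e_{12},e_{13},\dots,e_{1k}\}$ and $B_k=\mathrm{span}\{e_{kk},E,E^2,\dots,E^{k-2},e_{1k},e_{2k},\dots,e_{k-1,k}\}$, where $E=\sum_{i=1}^{k-1}e_{i,i+1}$, both regarded as superalgebras with the trivial grading. Then: (1) $C^{gr}(A_k)=\mathrm{Id}^{gr}(A_k)=\langle [y_1,y_2][y_3,y_4],\ [y_1,y_2]y_3y_4\cdots y_{k+1},\ z\rangle_{T_2}$; (2) $C^{gr}(B_k)=\mathrm{Id}^{gr}(B_k)=\langle [y_1,y_2][y_3,y_4],\ y_3y_4\cdots y_{k+1}[y_1,y_2],\ z\rangle_{T_2}$; (3) for $A\in\{A_k,B_k\}$, $c_n^{gr,z}(A)=c_n^{gr}(A)=1+\sum_{i=0}^{k-2}\binom{n}{i}(n-i-1)$; (4) for $A\in\{A_k,B_k\}$, $\chi_n^{gr,z}(A)=\chi_n^{gr}(A)=\chi_{(n),\emptyset}+\sum_{i=1}^{k-1}(k-i)\chi_{(n-i,i),\emptyset}+\sum_{i=1}^{k-2}(k-i-1)\chi_{(n-i-1,i,1),\emptyset}$; (5) for $A\in\{A_k,B_k\}$, $\delta_n^{gr}(A)=0$ and $\chi_n(\Delta^{gr}(A))=0$.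
   Context: $F$ is a field of characteristic zero; $UT_k(F)$ is the algebra of $k\times k$ upper triangular matrices, $e_{ij}$ the matrix units. A superalgebra is an algebra $A=A_0\oplus A_1$ with $A_iA_j\subseteq A_{i+j\bmod 2}$; the trivial grading is $(A,0)$; $Z(A)$ is the center. $F\langle Y,Z\rangle$ is the free associative algebra on disjoint countable sets $Y=\{y_1,y_2,\dots\}$ (even variables) and $Z=\{z_1,z_2,\dots\}$ (odd variables); $y$, $z$ denote an even and an odd variable. $\mathrm{Id}^{gr}(A)$ is the set of graded identities (polynomials vanishing under all substitutions of even variables by elements of $A_0$ and odd variables by elements of $A_1$); $C^{gr}(A)$ is the set of central graded polynomials (zero constant term, all such evaluations lie in $Z(A)$). $\langle S\rangle_{T_2}$ is the ideal of $F\langle Y,Z\rangle$ generated by $S$ and invariant under grading-preserving endomorphisms. $[a,b]=ab-ba$. $P_n^{gr}$ is the span of monomials $w_{\sigma(1)}\cdots w_{\sigma(n)}$, $\sigma\in S_n$, $w_i\in\{y_i,z_i\}$. $c_n^{gr}(A)=\dim P_n^{gr}/(P_n^{gr}\cap\mathrm{Id}^{gr}(A))$, $c_n^{gr,z}(A)=\dim P_n^{gr}/(P_n^{gr}\cap C^{gr}(A))$, $\delta_n^{gr}(A)=\dim (P_n^{gr}\cap C^{gr}(A))/(P_n^{gr}\cap \mathrm{Id}^{gr}(A))$. The hyperoctahedral group $\mathbb{Z}_2\wr S_n$ acts on $P_n^{gr}$ by $(a_1,\dots,a_n;\sigma)y_i=y_{\sigma(i)}$, $(a_1,\dots,a_n;\sigma)z_i=a_{\sigma(i)}z_{\sigma(i)}$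 ($a_j\in\{\pm1\}$); the three quotients above are $\mathbb{Z}_2\wr S_n$-modules whose characters are denoted $\chi_n^{gr}(A)$, $\chi_n^{gr,z}(A)$, $\chi_n(\Delta^{gr}(A))$. $\chi_{\lambda,\mu}$ denotes the irreducible $\mathbb{Z}_2\wr S_n$-character indexed by a pair of partitions $\lambda\vdash n-r$, $\mu\vdash r$ ($\lambda$ corresponding to the even variables, $\mu$ to the odd ones); $\emptyset$ is the empty partition.
   Formalization: The formula in (3) is proved for n ≥ k−1 (it fails for 1 ≤ n ≤ k−2: k=3, n=1 gives 0 but c_1=1), and the character formula in (4) for n ≥ 2(k−1), where every (n−i,i) and (n−i−1,i,1) is a partition. *)

(* Defs.v *)
From HB Require Import structures.
From mathcomp Require Import all_boot all_order all_algebra all_fingroup.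
From mathcomp Require Import finmap.
From mathcomp.multinomials Require Import monalg.
From Stdlib Require Import ClassicalEpsilon.

Set Implicit Arguments.
Unset Strict Implicit.
Unset Printing Implicit Defensive.

Import GRing.Theory.
Local Open Scope ring_scope.

(* A variable is a pair (b, i) : bool * nat ; (false, i) is the even      *)
(* variable y_i and (true, i) is the odd variable z_i.                    *)

Definition Var := (bool * nat)%type.
Notation FA F := {malg F[{fmonom Var}]}.

Definition var (F : fieldType) (v : Var) : FA F := << FMonom [:: v] >>.
Definition yv (F : fieldType) (i : nat) : FA F := var F (false, i).
Definition zv (F : fieldType) (i : nat) : FA F := var F (true, i).
Definition comm (F : fieldType) (a b : FA F) : FA F := a * b - b * a.

(* zero constant term, i.e. f lies in the non-unital free algebra *)
Definition no_const (F : fieldType) (f : FA F) : Prop := f@_(mone : {fmonom Var}) = 0.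

Definition odd_count (m : {fmonom Var}) : nat := count (fun v : Var => v.1) m.

Definition FA_even (F : fieldType) (f : FA F) : Prop :=
  forall m, m \in msupp f -> ~~ odd (odd_count m).
Definition FA_odd (F : fieldType) (f : FA F) : Prop :=
  forall m, m \in msupp f -> odd (odd_count m).

Definition subst (F : fieldType) (psi : Var -> FA F) (f : FA F) : FA F :=
  \sum_(m <- msupp f) f@_m *: \prod_(v <- fmonom_val m) psi v.

(* grading preserving endomorphisms of the (non-unital) free algebra *)
Definition graded_endo (F : fieldType) (psi : Var -> FA F) : Prop :=
  (forall i, FA_even (psi (false, i)) /\ no_const (psi (false, i))) /\
  (forall i, FA_odd (psi (true, i))).

Definition is_T2ideal (F : fieldType) (I : FA F -> Prop) : Prop :=
  [/\ forall f g, I f -> I g -> I (f + g),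
      forall (c : F) f, I f -> I (c *: f),
      forall f g, I f -> I (g * f) /\ I (f * g) &
      forall psi, graded_endo psi -> forall f, I f -> I (subst psi f)].

Definition T2gen (F : fieldType) (S : FA F -> Prop) (f : FA F) : Prop :=
  forall I, is_T2ideal I -> (forall g, S g -> I g) -> I f.

Definition evalw (F : fieldType) (k : nat) (phi : Var -> 'M[F]_k)
  (m : seq Var) : 'M[F]_k := foldr (fun v M => phi v *m M) 1%:M m.

Definition evalp (F : fieldType) (k : nat) (phi : Var -> 'M[F]_k) (f : FA F)
  : 'M[F]_k := \sum_(m <- msupp f) f@_m *: evalw phi (fmonom_val m).

Definition graded_eval (F : fieldType) (k : nat) (A0 A1 : 'M[F]_k -> Prop)
  (phi : Var -> 'M[F]_k) : Prop :=
  (forall i, A0 (phi (false, i))) /\ (forall i, A1 (phi (true, i))).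

Definition in_super (F : fieldType) (k : nat) (A0 A1 : 'M[F]_k -> Prop)
  (x : 'M[F]_k) : Prop := exists a0 a1, [/\ A0 a0, A1 a1 & x = a0 + a1].

Definition center (F : fieldType) (k : nat) (A0 A1 : 'M[F]_k -> Prop)
  (x : 'M[F]_k) : Prop :=
  in_super A0 A1 x /\ forall b, in_super A0 A1 b -> x *m b = b *m x.

Definition Idgr (F : fieldType) (k : nat) (A0 A1 : 'M[F]_k -> Prop)
  (f : FA F) : Prop :=
  no_const f /\ forall phi, graded_eval A0 A1 phi -> evalp phi f = 0.

Definition Cgr (F : fieldType) (k : nat) (A0 A1 : 'M[F]_k -> Prop)
  (f : FA F) : Prop :=
  no_const f /\ forall phi, graded_eval A0 A1 phi -> center A0 A1 (evalp phi f).

(* the zero subspace, odd part of the trivial grading *)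
Definition zero_part (F : fieldType) (k : nat) (x : 'M[F]_k) : Prop := x = 0.

(* The algebras A_k and B_k (matrix units are 1-based as in the paper).   *)

Definition eu (F : fieldType) (k i j : nat) : 'M[F]_k :=
  \matrix_(r, s) (((r : nat).+1 == i) && ((s : nat).+1 == j))%:R.

Definition Emx (F : fieldType) (k : nat) : 'M[F]_k :=
  \sum_(1 <= i < k) eu F k i i.+1.

Definition mxpow (F : fieldType) (k : nat) (M : 'M[F]_k) (j : nat) : 'M[F]_k :=
  iter j (mulmx M) 1%:M.

Definition Ak (F : fieldType) (k : nat) (x : 'M[F]_k) : Prop :=
  exists (a : F) (b c : nat -> F),
    x = a *: eu F k 1 1 + \sum_(1 <= j < k.-1) b j *: mxpow (Emx F k) j
        + \sum_(2 <= j < k.+1) c j *: eu F k 1 j.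

Definition Bk (F : fieldType) (k : nat) (x : 'M[F]_k) : Prop :=
  exists (a : F) (b c : nat -> F),
    x = a *: eu F k k k + \sum_(1 <= j < k.-1) b j *: mxpow (Emx F k) j
        + \sum_(1 <= i < k) c i *: eu F k i k.

Definition gensA (F : fieldType) (k : nat) (f : FA F) : Prop :=
  [\/ f = comm (yv F 1) (yv F 2) * comm (yv F 3) (yv F 4),
      f = comm (yv F 1) (yv F 2) * \prod_(3 <= i < k.+2) yv F i
    | f = zv F 1].

Definition gensB (F : fieldType) (k : nat) (f : FA F) : Prop :=
  [\/ f = comm (yv F 1) (yv F 2) * comm (yv F 3) (yv F 4),
      f = (\prod_(3 <= i < k.+2) yv F i) * comm (yv F 1) (yv F 2)
    | f = zv F 1].

(* A multilinear monomial w_{s(1)} ... w_{s(n)} is given by (s, b) with   *)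
(* s a permutation and b i = true iff w_(i+1) = z_(i+1) (0-based i).      *)

Definition Mon (n : nat) := ({perm 'I_n} * {ffun 'I_n -> bool})%type.
Definition Nmon (n : nat) : nat := #|{: Mon n}|.

Definition mword (n : nat) (p : Mon n) : {fmonom Var} :=
  FMonom [seq (p.2 (p.1 j), (p.1 j : nat).+1) | j <- enum 'I_n].

Definition mono (F : fieldType) (n : nat) (p : Mon n) : FA F := << mword p >>.

Definition embed (F : fieldType) (n : nat) (c : 'rV[F]_(Nmon n)) : FA F :=
  \sum_(r < Nmon n) c 0 r *: mono F (enum_val r).

(* coordinates (meaningful for f in P_n^gr) *)
Definition coords (F : fieldType) (n : nat) (f : FA F) : 'rV[F]_(Nmon n) :=
  \row_(r < Nmon n) f@_(mword (enum_val r)).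

(* a matrix whose row space is the subspace {c | P c} of F^N (exists when *)
(* P is a linear subspace, which is the only case used)                    *)
Definition mxspan_of (F : fieldType) (N : nat) (P : 'rV[F]_N -> Prop) : 'M[F]_N :=
  epsilon (inhabits 0) (fun U : 'M[F]_N => forall v, (v <= U)%MS <-> P v).

(* trace of the endomorphism v |-> v *m R restricted to the (R-invariant) *)
(* row space of U                                                          *)
Definition trace_on (F : fieldType) (m N : nat) (U : 'M[F]_(m, N)) (R : 'M[F]_N) : F :=
  \tr (row_base U *m R *m pinvmx (row_base U)).

Definition IdP (F : fieldType) (k : nat) (A0 A1 : 'M[F]_k -> Prop) (n : nat)
  (c : 'rV[F]_(Nmon n)) : Prop := Idgr A0 A1 (embed c).
Definition CP (F : fieldType) (k : nat) (A0 A1 : 'M[F]_k -> Prop) (n : nat)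
  (c : 'rV[F]_(Nmon n)) : Prop := Cgr A0 A1 (embed c).

Definition codim_gr (F : fieldType) (k : nat) (A0 A1 : 'M[F]_k -> Prop) (n : nat) : nat :=
  (Nmon n - \rank (mxspan_of (IdP A0 A1 (n:=n))))%N.
Definition codim_grz (F : fieldType) (k : nat) (A0 A1 : 'M[F]_k -> Prop) (n : nat) : nat :=
  (Nmon n - \rank (mxspan_of (CP A0 A1 (n:=n))))%N.
Definition delta_gr (F : fieldType) (k : nat) (A0 A1 : 'M[F]_k -> Prop) (n : nat) : nat :=
  (\rank (mxspan_of (CP A0 A1 (n:=n))) - \rank (mxspan_of (IdP A0 A1 (n:=n))))%N.

(* The action of the hyperoctahedral group Z_2 wr S_n on P_n^gr.          *)
(* An element (a_1,...,a_n; s) is a pair (a, s) with a : 'I_n -> bool     *)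
(* (a j = true encodes a_(j+1) = -1) and s : 'S_n; (a;s) y_i = y_{s(i)},  *)
(* (a;s) z_i = a_{s(i)} z_{s(i)} for 1 <= i <= n.                         *)

Definition hyp_var (F : fieldType) (n : nat) (a : {ffun 'I_n -> bool})
  (s : {perm 'I_n}) (v : Var) : FA F :=
  if v.2 is i.+1 then
    if (insub i : option 'I_n) is Some j then
      (if v.1 then (-1) ^+ a (s j) *: zv F (s j).+1 else yv F (s j).+1)
    else var F v
  else var F v.

Definition hyp_act (F : fieldType) (n : nat) (a : {ffun 'I_n -> bool})
  (s : {perm 'I_n}) (f : FA F) : FA F := subst (hyp_var F a s) f.

Definition hyp_mx (F : fieldType) (n : nat) (a : {ffun 'I_n -> bool})
  (s : {perm 'I_n}) : 'M[F]_(Nmon n) :=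
  \matrix_(r < Nmon n) coords n (hyp_act a s (mono F (enum_val r))).

(* characters chi_n^gr(A), chi_n^{gr,z}(A), chi_n(Delta^gr(A)) : traces on *)
(* the quotient modules P/(P /\ Id), P/(P /\ C), (P /\ C)/(P /\ Id)       *)
Definition chi_gr (F : fieldType) (k : nat) (A0 A1 : 'M[F]_k -> Prop) (n : nat)
  (a : {ffun 'I_n -> bool}) (s : {perm 'I_n}) : F :=
  \tr (hyp_mx F a s) - trace_on (mxspan_of (IdP A0 A1 (n:=n))) (hyp_mx F a s).
Definition chi_grz (F : fieldType) (k : nat) (A0 A1 : 'M[F]_k -> Prop) (n : nat)
  (a : {ffun 'I_n -> bool}) (s : {perm 'I_n}) : F :=
  \tr (hyp_mx F a s) - trace_on (mxspan_of (CP A0 A1 (n:=n))) (hyp_mx F a s).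
Definition chi_Delta (F : fieldType) (k : nat) (A0 A1 : 'M[F]_k -> Prop) (n : nat)
  (a : {ffun 'I_n -> bool}) (s : {perm 'I_n}) : F :=
  trace_on (mxspan_of (CP A0 A1 (n:=n))) (hyp_mx F a s)
  - trace_on (mxspan_of (IdP A0 A1 (n:=n))) (hyp_mx F a s).

(* A partition lam = [:: lam_1; lam_2; ...].  The cells of its diagram    *)
(* are enumerated in reading order j = 0, ..., n-1; the tableau attached  *)
(* to p : 'S_n has entry p j in cell j.  Tabloids are row functions        *)
(* 'I_n -> 'I_n.+1 (entry |-> row index).                                 *)

Definition rowof (lam : seq nat) (j : nat) : nat :=
  count (fun r => \sum_(t <- take r.+1 lam) t <= j)%N (iota 0 (size lam)).
Definition colof (lam : seq nat) (j : nat) : nat :=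
  (j - \sum_(t <- take (rowof lam j) lam) t)%N.

Definition Tabloid (n : nat) := {ffun 'I_n -> 'I_n.+1}.
Definition Ntab (n : nat) : nat := #|{: Tabloid n}|.

Definition tabl (lam : seq nat) (n : nat) (p : {perm 'I_n}) : Tabloid n :=
  [ffun x => inord (rowof lam (p^-1 x)%g)].

Definition colstab (lam : seq nat) (n : nat) (p : {perm 'I_n}) : {set {perm 'I_n}} :=
  [set q : {perm 'I_n} | [forall x : 'I_n, colof lam (p^-1 (q x))%g == colof lam (p^-1 x)%g]].

Definition tabvec (F : fieldType) (n : nat) (T : Tabloid n) : 'rV[F]_(Ntab n) :=
  \row_(r < Ntab n) (enum_val r == T)%:R.

(* polytabloid e_{t_p} = sum_{q in C_{t_p}} sgn(q) {q t_p};                *)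
(* q t_p is the tableau of (p * q)%g (i.e. x |-> q (p x))                  *)
Definition polytab (F : fieldType) (lam : seq nat) (n : nat) (p : {perm 'I_n})
  : 'rV[F]_(Ntab n) :=
  \sum_(q in colstab lam p) (-1) ^+ (odd_perm q) *: tabvec F (tabl lam (p * q)%g).

Definition specht (F : fieldType) (lam : seq nat) (n : nat)
  : 'M[F]_(#|{: {perm 'I_n}}|, Ntab n) :=
  \matrix_(r < #|{: {perm 'I_n}}|) polytab F lam (enum_val r).

Definition tab_mx (F : fieldType) (n : nat) (s : {perm 'I_n}) : 'M[F]_(Ntab n) :=
  \matrix_(r < Ntab n, r' < Ntab n)
    ([ffun x => enum_val r (s^-1 x)%g] == enum_val r')%:R.

Definition chiS (F : fieldType) (lam : seq nat) (n : nat) (s : {perm 'I_n}) : F :=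
  trace_on (specht F lam n) (tab_mx F s).

(* chi_{lam, emptyset} : the irreducible Z_2 wr S_n-character indexed by  *)
(* (lam, emptyset), i.e. chi_lam inflated along (a; s) |-> s              *)
Definition chiHO0 (F : fieldType) (lam : seq nat) (n : nat)
  (a : {ffun 'I_n -> bool}) (s : {perm 'I_n}) : F := chiS F lam s.

(* Main.v *)
Require Import Defs.
From HB Require Import structures.
From mathcomp Require Import all_boot all_order all_algebra all_fingroup.
From mathcomp Require Import finmap.
From mathcomp.multinomials Require Import monalg.
From mathcomp Require Import ring zify.
From Stdlib Require Import ClassicalEpsilon FunctionalExtensionality PropExtensionality.

(* Modulo the T-ideal of A_k, a word in even variables is determined by its
   content and by its keys (content of the prefix, letter, content of the
   suffix of length d) for d < k - 1.  Conversely, the evaluation of y_i at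
   a_i e_11 + h_i e_12 + b_i (E - e_12) gives a matrix whose first row is a sum
   over the keys of products of distinct multiplicative characters of (a, b), so
   for an identity the coefficients of the words with a given key add up to 0
   (Dedekind).  This gives (1); the center of A_k is 0, whence C = Id, and the
   reflection in the antidiagonal exchanges A_k and B_k and reverses words.

   On multilinear words the key with suffix length d is the filling
   {ffun 'I_n -> R} marking the prefix by r0, the letter by r2 and the suffix by
   r1, so that Id is the intersection of the kernels of the maps [Psi d] to the
   functions on fillings, on which S_n and gl(R) have commuting actions.  The image under [Psi d] of
   the intersection of the previous kernels is the kernel of E_02 on the weight
   space (n - d - 1, d, 1), and E_02 maps the latter onto the weight space
   (n - d, d, 0).  Hence the character is an alternating sum of permutation
   characters on weight spaces.  Finally the Specht module of a partition
   (a, b) or (a, b, 1) is the space of highest weight vectors, and sl_2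
   arguments express its character by weight spaces as well. *)

Set Implicit Arguments.
Unset Strict Implicit.
Unset Printing Implicit Defensive.

Import GRing.Theory.
Local Open Scope ring_scope.

(** * Traces on invariant subspaces *)

(** The bound k - 1 on d is the number of letters after the commutator in [y_1, y_2] y_3 ...
    y_{k+1}: in front of longer suffixes letters commute for free, and on the matrix side the keys
    with d < k - 1 are read off the k - 1 entries of the first row outside the corner. Identities
    and elements of the T-ideal are thus compared with one numerical condition, [crit]. Characters
    are traces in F, additive along exact sequences, so only kernels and images of the E_ab enter.
    With x_j and y_j the traces on the weights (n - j - 1, j, 1) and (n - j, j, 0), the keys with
    suffix length j contribute x_j - y_j, while the Specht characters are y_i - y_{i-1} and x_i -
    x_{i-1} - y_{i+1} + y_{i-1}, the Jacobi-Trudi expansions. Summing twice produces the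
    multiplicities k - i and k - i - 1; the bound 2(k - 1) <= n makes every shape that occurs a
    partition. The delicate point is that polytabloids span all highest weight vectors: by duality
    it suffices that a highest weight vector orthogonal to all polytabloids is zero, which is shown
    by peeling off columns. *)

Section Traces.
Variable F : fieldType.

(** Any basis computes the trace: two bases of the same space are related by matrices C and D with D
    C = 1, and the trace is invariant under cyclic permutation. *)
Lemma trace_onE (m r N : nat) (U : 'M[F]_(m, N)) (B : 'M[F]_(r, N))
    (R : 'M[F]_N) (G : 'M[F]_r) :
  row_free B -> (B :=: U)%MS -> B *m R = G *m B -> trace_on U R = \tr G.
Proof.
move=> freeB eqBU BR; rewrite /trace_on; set B0 := row_base U.
have freeB0 : row_free B0 by apply: row_base_free.
have sB0 : (B0 <= B)%MS by rewrite eqBU eq_row_base.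
have sB : (B <= B0)%MS by rewrite eqBU eq_row_base.
have [C eqC] := submxP sB0; have [D eqD] := submxP sB.
have DC : D *m C = 1%:M.
  by apply: (row_free_inj freeB); rewrite -mulmxA -eqC -eqD mul1mx.
rewrite {1}eqC -mulmxA -mulmxA mulmxA.
have -> : C *m B *m (R *m pinvmx B0) = C *m G *m D *m (B0 *m pinvmx B0).
  by rewrite -!mulmxA (mulmxA B R) BR {1}eqD !mulmxA.
by rewrite mulmxVp // mulmx1 mxtrace_mulC mulmxA DC mul1mx.
Qed.

Definition stable_mx (m N : nat) (U : 'M[F]_(m, N)) (R : 'M[F]_N) :=
  (U *m R <= U)%MS.

Lemma trace_on_eqmx (m1 m2 N : nat) (U : 'M[F]_(m1, N)) (V : 'M[F]_(m2, N))
    (R : 'M[F]_N) :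
  (U :=: V)%MS -> stable_mx V R -> trace_on U R = trace_on V R.
Proof.
move=> eqUV stV.
have : (row_base V *m R <= row_base V)%MS.
  by rewrite eq_row_base (eqmxMr R (eq_row_base V)).
case/submxP=> G eqG.
rewrite (trace_onE (row_base_free V) (eq_row_base V) eqG).
apply: (trace_onE (row_base_free V) _ eqG).
by apply: eqmx_trans (eq_row_base V) (eqmx_sym eqUV).
Qed.

Lemma trace_on_full (N : nat) (R : 'M[F]_N) : trace_on 1%:M R = \tr R.
Proof.
apply: (trace_onE (B := 1%:M)) => //; first by rewrite row_free_unit unitmx1.
by rewrite mulmx1 mul1mx.
Qed.

Lemma trace_on_id (m N : nat) (U : 'M[F]_(m, N)) :
  trace_on U 1%:M = (\rank U)%:R.
Proof.
rewrite (trace_onE (B := row_base U) (G := 1%:M)).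
- by rewrite mxtrace1.
- exact: row_base_free.
- exact: eq_row_base.
by rewrite mulmx1 mul1mx.
Qed.

Lemma stable_capmx (m1 m2 N : nat) (U : 'M[F]_(m1, N)) (V : 'M[F]_(m2, N)) R :
  stable_mx U R -> stable_mx V R -> stable_mx (U :&: V)%MS R.
Proof.
move=> stU stV; rewrite /stable_mx sub_capmx.
rewrite (submx_trans _ stU) ?submxMr ?capmxSl //.
by rewrite (submx_trans _ stV) ?submxMr ?capmxSr.
Qed.

Lemma stable_kermx (N N' : nat) (f : 'M[F]_(N, N')) R R' :
  R *m f = f *m R' -> stable_mx (kermx f) R.
Proof.
by move=> Rf; apply/sub_kermxP; rewrite -mulmxA Rf mulmxA mulmx_ker mul0mx.
Qed.

(** Trace version of the rank-nullity theorem: in a basis of U adapted to the kernel of f on U, the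
    matrix of R is block triangular, and its second diagonal block is the matrix of R' on the
    image. *)
Lemma trace_on_exact (m N N' : nat) (U : 'M[F]_(m, N)) (f : 'M[F]_(N, N')) R R' :
  R *m f = f *m R' -> stable_mx U R ->
  trace_on U R = trace_on (U :&: kermx f)%MS R + trace_on (U *m f) R'.
Proof.
move=> Rf stU; set K := (U :&: kermx f)%MS.
have stK : stable_mx K R by apply: stable_capmx => //; apply: stable_kermx Rf.
pose B1 := row_base K; pose B2 := row_base (U :\: K)%MS.
have eqB1 : (B1 :=: K)%MS := eq_row_base K.
have sKU : (K <= U)%MS := capmxSl _ _.
have eqB2 : (B2 :=: (U :\: K)%MS)%MS := eq_row_base _.
have eqB : (B1 + B2 :=: U)%MS.
  apply: eqmx_trans (adds_eqmx eqB1 eqB2) _.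
  rewrite addsmxC; have := addsmx_diff_cap_eq U K.
  by move=> H; apply: eqmx_trans H; apply: adds_eqmx => //; apply/eqmxP;
     rewrite sub_capmx sKU capmxSr submx_refl.
have dxB : (B1 :&: B2 = 0)%MS.
  apply/eqP; rewrite -submx0 (cap_eqmx eqB1 eqB2).
  by rewrite capmxC capmx_diff.
have eqC : (col_mx B1 B2 :=: U)%MS by apply: eqmx_trans (eqmx_sym (addsmxE B1 B2)) _.
have freeC : row_free (col_mx B1 B2).
  rewrite /row_free -addsmxE mxrank_disjoint_sum //.
  by rewrite (eqP (row_base_free _)) (eqP (row_base_free _)).
have /submxP[G1 eqG1] : (B1 *m R <= B1)%MS.
  by rewrite eqB1 (eqmxMr R eqB1).
have /submxP[G eqG] : (B2 *m R <= col_mx B1 B2)%MS.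
  rewrite eqC (submx_trans _ stU) ?submxMr // eqB2.
  exact: diffmxSl.
rewrite -[G]hsubmxK mul_row_col in eqG.
rewrite (trace_onE (G := block_mx G1 0 (lsubmx G) (rsubmx G)) freeC eqC); last first.
  by rewrite mul_block_col mul_col_mx eqG1 eqG mul0mx addr0.
rewrite mxtrace_block (trace_onE (row_base_free K) eqB1 eqG1); congr (_ + _).
have B1f : B1 *m f = 0.
  by apply/sub_kermxP; rewrite eqB1 capmxSr.
symmetry; apply: (trace_onE (B := B2 *m f)).
- rewrite -kermx_eq0; apply/eqP/row_matrixP => i; rewrite row0.
  set v := row i _; have vf : v *m (B2 *m f) = 0.
    by apply/sub_kermxP; rewrite row_sub.
  apply: (row_free_inj (row_base_free (U :\: K)%MS)); rewrite mul0mx -/B2.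
  apply/eqP; rewrite -submx0 -dxB sub_capmx submxMl andbT eqB1 sub_capmx.
  apply/andP; split; last by apply/sub_kermxP; rewrite -mulmxA.
  by rewrite (submx_trans (submxMl _ _)) // eqB2 diffmxSl.
- apply: eqmx_trans (eqmxMr f eqC).
  rewrite mul_col_mx B1f; apply: eqmx_trans (addsmxE _ _).
  by apply: eqmx_sym; apply: adds0mx.
- by rewrite -mulmxA -Rf mulmxA eqG mulmxDl -(mulmxA _ B1) B1f mulmx0 add0r mulmxA.
Qed.

Lemma trace_on_inj (m N N' : nat) (U : 'M[F]_(m, N)) (f : 'M[F]_(N, N')) R R' :
  R *m f = f *m R' -> stable_mx U R -> (U :&: kermx f = 0)%MS ->
  trace_on U R = trace_on (U *m f) R'.
Proof.
move=> Rf stU U0; rewrite (trace_on_exact Rf stU) U0.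
rewrite (trace_onE (U := 0 : 'M_N) (B := 0 : 'M_(0, N)) (G := 0)).
- by rewrite mxtrace0 add0r.
- by rewrite /row_free mxrank0.
- by apply/eqmxP; rewrite !sub0mx.
by rewrite !mul0mx.
Qed.

(** If no nonzero vector of K is orthogonal to S, then multiplication by the transpose of S is
    injective on K, so the rank of K is at most that of S. Spanning by polytabloids is proved in
    this form. *)
Lemma eqmx_dual (m N : nat) (S : 'M[F]_(m, N)) (K : 'M[F]_N) :
  (S <= K)%MS ->
  (forall v : 'rV_N, (v <= K)%MS -> v *m S^T = 0 -> v = 0) -> (S :=: K)%MS.
Proof.
move=> sSK SK0; apply/eqmxP; rewrite -mxrank_leqif_eq //.
rewrite eqn_leq mxrankS //=.
have : (K :&: kermx S^T)%MS = 0.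
  apply/eqP; rewrite -submx0; apply/row_subP => i; set v := row i _.
  have : (v <= K :&: kermx S^T)%MS by apply: row_sub.
  by rewrite sub_capmx => /andP[vK /sub_kermxP vS]; rewrite (SK0 v vK vS) sub0mx.
have := mxrank_mul_ker K S^T => rK eK; move: rK; rewrite eK mxrank0 addn0 => <-.
by rewrite -[\rank S]mxrank_tr mxrankM_maxr.
Qed.

End Traces.

(** * Functions on fillings and the action of gl(R) *)

Section FinFun.
Variables (F : fieldType) (X : finType).
Implicit Types v : 'rV[F]_#|{: X}|.

Definition vat v (T : X) : F := v 0 (enum_rank T).
Definition vof (f : X -> F) : 'rV[F]_#|{: X}| := \row_i f (enum_val i).

Lemma vofE f T : vat (vof f) T = f T.
Proof. by rewrite /vat mxE enum_rankK. Qed.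

Lemma vatP v w : (forall T, vat v T = vat w T) -> v = w.
Proof.
by move=> vw; apply/rowP => i; have := vw (enum_val i); rewrite /vat enum_valK.
Qed.

Lemma vatD v w T : vat (v + w) T = vat v T + vat w T.
Proof. by rewrite /vat mxE. Qed.
Lemma vatZ a v T : vat (a *: v) T = a * vat v T.
Proof. by rewrite /vat mxE. Qed.
Lemma vatN v T : vat (- v) T = - vat v T.
Proof. by rewrite /vat mxE. Qed.
Lemma vat0 T : vat 0 T = 0.
Proof. by rewrite /vat mxE. Qed.
Lemma vat_sum (I : Type) (r : seq I) (P : pred I) (f : I -> 'rV_#|{: X}|) T :
  vat (\sum_(i <- r | P i) f i) T = \sum_(i <- r | P i) vat (f i) T.
Proof. by rewrite /vat summxE. Qed.
Definition vatE := (vatD, vatZ, vatN, vat0).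

Definition vdelta (T : X) : 'rV[F]_#|{: X}| := vof (fun S => (S == T)%:R).

Lemma vdeltaE T S : vat (vdelta T) S = (S == T)%:R.
Proof. exact: vofE. Qed.

Lemma vat_basis v : v = \sum_T vat v T *: vdelta T.
Proof.
apply: vatP => S; rewrite vat_sum (bigD1 S) //= vatZ vdeltaE eqxx mulr1.
rewrite big1 ?addr0 // => T TS.
by rewrite vatZ vdeltaE eq_sym (negPf TS) mulr0.
Qed.

(** Its row space consists of the functions supported on P; weight spaces become matrix subspaces in
    this way. *)
Definition coordmx (P : pred X) : 'M[F]_#|{: X}| :=
  diag_mx (vof (fun T => (P T)%:R)).

Lemma coordmx_mul (P : pred X) v T :
  vat (v *m coordmx P) T = vat v T * (P T)%:R.
Proof. by rewrite /vat mul_mx_diag mxE mxE enum_rankK. Qed.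

Lemma sub_coordmx (P : pred X) v :
  reflect (forall T, vat v T != 0 -> P T) (v <= coordmx P)%MS.
Proof.
apply: (iffP idP) => [/submxP[w ->] T | vP].
  by rewrite coordmx_mul; case: (P T) => //; rewrite mulr0 eqxx.
apply/submxP; exists v; apply: vatP => T; rewrite coordmx_mul.
have := vP T; case: (eqVneq (vat v T) 0) => [->|_ ->] //; first by rewrite mul0r.
by rewrite mulr1.
Qed.

Lemma vdelta_coordmx (P : pred X) T : P T -> (vdelta T <= coordmx P)%MS.
Proof.
move=> PT; apply/sub_coordmx => S; rewrite vdeltaE.
by case: (S =P T) => [-> //|]; rewrite eqxx.
Qed.

Lemma rank_coordmx (P : pred X) : \rank (coordmx P) = #|P|.
Proof.
pose f (i : 'I_#|P|) : X := enum_val i.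
pose B : 'M[F]_(#|P|, #|{: X}|) := \matrix_i vdelta (f i).
have finj : injective f by apply: enum_val_inj.
have freeB : row_free B.
  apply/row_freeP; exists B^T; apply/matrixP => i j; rewrite !mxE.
  transitivity (\sum_T vat (vdelta (f i)) T * vat (vdelta (f j)) T).
    rewrite (reindex (fun k : 'I_#|{: X}| => enum_val k)) /=; last first.
      by exists (@enum_rank _) => k _; rewrite ?enum_valK ?enum_rankK.
    apply: eq_bigr => k _.
    by rewrite !mxE /vat !enum_valK !mxE.
  rewrite (bigD1 (f i)) //= big1 ?addr0 => [|T Ti].
    by rewrite !vdeltaE eqxx mul1r (inj_eq finj).
  by rewrite !vdeltaE (negPf Ti) mul0r.
have eqB : (B :=: coordmx P)%MS.
  apply/eqmxP/andP; split.
    apply/row_subP => i; rewrite rowK; apply: vdelta_coordmx.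
    by rewrite /f; have := enum_valP i.
  apply/row_subP => i; set v := row i _.
  have vP : (v <= coordmx P)%MS by apply: row_sub.
  rewrite [v]vat_basis; apply: summx_sub => T _.
  have [->|/(sub_coordmx _ _ vP) PT] := eqVneq (vat v T) 0.
    by rewrite scale0r sub0mx.
  have -> : vdelta T = row (enum_rank_in PT T) B by rewrite rowK /f enum_rankK_in.
  by rewrite scalemx_sub ?row_sub.
by rewrite -eqB (eqP freeB).
Qed.

Definition kerop (Y : finType) (a : X -> Y -> F) : 'M[F]_(#|{: X}|, #|{: Y}|) :=
  \matrix_(i, j) a (enum_val i) (enum_val j).

End FinFun.

Lemma kerop_mul (F : fieldType) (X Y : finType) (a : X -> Y -> F) v S :
  vat (v *m kerop a) S = \sum_T vat v T * a T S.
Proof.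
rewrite /vat mxE (reindex (fun k : 'I_#|{: X}| => enum_val k)) /=; last first.
  by exists (@enum_rank _) => k _; rewrite ?enum_valK ?enum_rankK.
by apply: eq_bigr => k _; rewrite !mxE enum_rankK enum_valK.
Qed.

Lemma vdelta_kerop (F : fieldType) (X Y : finType) (a : X -> Y -> F) T S :
  vat (vdelta F T *m kerop a) S = a T S.
Proof.
rewrite kerop_mul (bigD1 T) //= vdeltaE eqxx mul1r big1 ?addr0 // => U UT.
by rewrite vdeltaE (negPf UT) mul0r.
Qed.

Section Gl.
Variables (F : fieldType) (n : nat) (R : finType).
Local Notation X := {ffun 'I_n -> R}.
Local Notation V := 'rV[F]_#|{: X}|.
Implicit Types (v : V) (a b c d : R) (T : X) (x y : 'I_n).

Definition upd T x b : X := [ffun y => if y == x then b else T y].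

Lemma updE T x b y : upd T x b y = if y == x then b else T y.
Proof. by rewrite ffunE. Qed.
Lemma updK T x b c : upd (upd T x b) x c = upd T x c.
Proof. by apply/ffunP => y; rewrite !updE; case: eqP. Qed.
Lemma upd_id T x : upd T x (T x) = T.
Proof. by apply/ffunP => y; rewrite !updE; case: eqP => [->|]. Qed.
Lemma updC T x y b c : x != y -> upd (upd T x b) y c = upd (upd T y c) x b.
Proof.
move=> xy; apply/ffunP => z; rewrite !updE.
by case: eqP => // ->; rewrite eq_sym (negPf xy).
Qed.

(* [gl a b] is the image of the matrix unit e_ab of gl(R) in its action on
   the n-th tensor power of F^R, seen as functions on tabloids. *)
Definition gl a b : 'M[F]_#|{: X}| :=
  kerop (fun (T S : X) => \sum_(x | S x == a) (T == upd S x b)%:R).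

Lemma vat_gl a b v T : vat (v *m gl a b) T = \sum_(x | T x == a) vat v (upd T x b).
Proof.
rewrite kerop_mul; under eq_bigr => S _ do rewrite big_distrr /=.
rewrite exchange_big /=; apply: eq_bigr => x _.
rewrite (bigD1 (upd T x b)) //= eqxx mulr1 big1 ?addr0 // => S neS.
by rewrite (negPf neS) mulr0.
Qed.

(** Terms that change two distinct positions are symmetric in the two operators and cancel; those
    that change one position twice remain. Vectors being rows, [v *m gl c d *m gl a b] applies E_cd
    before E_ab. *)
Lemma gl_comm v a b c d :
  v *m gl c d *m gl a b - v *m gl a b *m gl c d =
  (b == c)%:R *: (v *m gl a d) - (d == a)%:R *: (v *m gl c b).
Proof.
pose s a b c d T := \sum_(x | T x == a) \sum_(y | (y != x) && (T y == c))
  vat v (upd (upd T x b) y d).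
have E a' b' c' d' T : vat (v *m gl c' d' *m gl a' b') T =
    (b' == c')%:R * vat (v *m gl a' d') T + s a' b' c' d' T.
  rewrite !vat_gl mulr_sumr -big_split /=; apply: eq_bigr => x Tx.
  rewrite vat_gl [LHS]big_mkcond (bigD1 x) //= updE eqxx updK.
  congr (_ + _); first by case: (b' == c'); rewrite ?mul1r ?mul0r.
  rewrite [RHS]big_mkcondr; apply: eq_big => // y yx.
  by rewrite updE (negPf yx).
have sC T : s a b c d T = s c d a b T.
  rewrite /s; under eq_bigr => x _ do rewrite big_mkcondr.
  rewrite (exchange_big_dep xpredT) //= [RHS]big_mkcond; apply: eq_bigr => y _ /=.
  rewrite -big_mkcondr /=; case: (boolP (T y == c)) => Ty; last first.
    by rewrite big1 // => x /andP[].
  rewrite big_mkcond [RHS]big_mkcond; apply: eq_bigr => x _.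
  rewrite ?andbT andbC (eq_sym y x); case: ifP => // /andP[xy _].
  by rewrite updC.
apply: vatP => T; rewrite !vatE !E sC.
by rewrite opprD addrACA subrr addr0.
Qed.

Definition cnt T a := #|[pred x | T x == a]|.

Lemma gl_diag v a T : vat (v *m gl a a) T = (cnt T a)%:R * vat v T.
Proof.
rewrite vat_gl (eq_bigr (fun=> vat v T)); last by move=> x /eqP<-; rewrite upd_id.
by rewrite sumr_const mulr_natl.
Qed.

Lemma cnt_upd T x b c : (cnt (upd T x b) c + (T x == c) = cnt T c + (b == c))%N.
Proof.
rewrite /cnt (cardD1 x) [in RHS](cardD1 x) !inE updE eqxx.
rewrite (@eq_card _ _ [predD1 [pred y | T y == c] & x]) => [|y].
  by rewrite addnAC [RHS]addnAC (addnC (b == c)).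
by rewrite !inE updE; case: (y == x).
Qed.

Definition tact (s : {perm 'I_n}) T : X := [ffun x => T (s^-1 x)%g].
Definition tmx (s : {perm 'I_n}) : 'M[F]_#|{: X}| :=
  kerop (fun T S : X => (tact s T == S)%:R).

Lemma tactM s t T : tact t (tact s T) = tact (s * t)%g T.
Proof. by apply/ffunP => x; rewrite !ffunE invMg permM. Qed.
Lemma tact1 T : tact 1%g T = T.
Proof. by apply/ffunP => x; rewrite ffunE invg1 perm1. Qed.
Lemma tact_eq s T S : (tact s T == S) = (T == tact s^-1%g S).
Proof.
apply/eqP/eqP => [<-|->]; by rewrite tactM ?mulgV ?mulVg tact1.
Qed.

Lemma vat_tmx v s T : vat (v *m tmx s) T = vat v (tact s^-1%g T).
Proof.
rewrite kerop_mul (bigD1 (tact s^-1%g T)) //= tactM mulVg tact1 eqxx mulr1.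
by rewrite big1 ?addr0 // => S; rewrite tact_eq => /negPf->; rewrite mulr0.
Qed.

Lemma vdelta_tmx s T : vdelta F T *m tmx s = vdelta F (tact s T).
Proof. by apply: vatP => S; rewrite vat_tmx !vdeltaE tact_eq invgK. Qed.

Lemma upd_tact s T x b : upd (tact s T) x b = tact s (upd T (s^-1 x)%g b).
Proof.
by apply/ffunP => y; rewrite !(updE, ffunE) (inj_eq perm_inj).
Qed.

Lemma gl_tmx s a b : gl a b *m tmx s = tmx s *m gl a b.
Proof.
suff H v : v *m (gl a b *m tmx s) = v *m (tmx s *m gl a b).
  by apply/row_matrixP => i; rewrite !rowE H.
rewrite !mulmxA; apply: vatP => T; rewrite vat_tmx !vat_gl.
rewrite (reindex_inj (@perm_inj _ s^-1%g)) /=.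
apply: eq_big => [x|x _]; first by rewrite ffunE invgK permKV.
by rewrite vat_tmx upd_tact invgK permKV.
Qed.

Lemma cnt_tact s T a : cnt (tact s T) a = cnt T a.
Proof.
rewrite /cnt -!sum1_card (reindex_inj (@perm_inj _ s)).
by apply: eq_bigl => x; rewrite !inE ffunE permK.
Qed.

Lemma perm_of_cnt T S : (forall a, cnt T a = cnt S a) ->
  exists p : {perm 'I_n}, S = tact p T.
Proof.
move=> TS.
have : perm_eq [tuple S i | i < n] [tuple T i | i < n].
  apply/allP => a _ /=; rewrite eq_sym.
  have e (U : X) : count_mem a [tuple U i | i < n] = cnt U a.
    rewrite /cnt cardE /enum_mem size_filter -enumT /= count_map.
    by apply: eq_count => x.
  by apply/eqP; rewrite !e TS.
case/tuple_permP => p eqp; exists p^-1%g.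
apply/ffunP => x; rewrite ffunE invgK.
have := congr1 (fun s => nth (S x) s x) eqp.
by rewrite -!tnth_nth !tnth_mktuple.
Qed.

End Gl.

(** * Weight spaces and highest weight vectors *)

Lemma sub_mulmx_rows (F : fieldType) (m p q N : nat) (A : 'M[F]_(m, N))
    (f : 'M[F]_(N, p)) (B : 'M[F]_(q, p)) :
  (forall v : 'rV_N, (v <= A)%MS -> (v *m f <= B)%MS) -> (A *m f <= B)%MS.
Proof.
by move=> AB; apply/row_subP => i; rewrite row_mul AB ?row_sub.
Qed.

Section Weights.
Variables (F : fieldType) (n : nat) (R : finType).
Local Notation X := {ffun 'I_n -> R}.
Local Notation V := 'rV[F]_#|{: X}|.
Implicit Types (v : V) (w : R -> nat) (T : X).

Definition wsp w : 'M[F]_#|{: X}| := coordmx F (fun T : X => [forall c, cnt T c == w c]).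

Lemma wspP w v :
  (v <= wsp w)%MS <-> forall T, vat v T != 0 -> forall c, cnt T c = w c.
Proof.
split=> [/sub_coordmx vP T /vP/forallP Tw c | vP]; first exact/eqP.
by apply/sub_coordmx => T /vP Tw; apply/forallP => c; rewrite Tw.
Qed.

Lemma gl_neq0 a b v S : vat (v *m gl F n a b) S != 0 ->
  exists2 x, S x = a & vat v (upd S x b) != 0.
Proof.
rewrite vat_gl => nz.
have [x /andP[/eqP Sx vx] | all0] := pickP (fun x => (S x == a) && (vat v (upd S x b) != 0)).
  by exists x.
case/eqP: nz; apply: big1 => x Sx; apply/eqP; have := all0 x.
by rewrite Sx /= => /negbFE.
Qed.

(** The value at S is taken from fillings in which one entry a of S has become b, so the support
    gains an a and loses a b. *)
Lemma gl_wsp a b w w' v : (forall c, w' c + (b == c) = w c + (a == c))%N ->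
  (v <= wsp w)%MS -> (v *m gl F n a b <= wsp w')%MS.
Proof.
move=> ww' /wspP vw; apply/wspP => S /gl_neq0[x Sx /vw vS] c.
have := cnt_upd S x b c; rewrite vS Sx -ww' => /eqP.
by rewrite eqn_add2r => /eqP.
Qed.

Lemma gl_wsp0 a b w v : w b = 0%N -> (v <= wsp w)%MS -> v *m gl F n a b = 0.
Proof.
move=> wb0 /wspP vw; apply: vatP => S; rewrite vat0; apply/eqP.
apply: contraT => /gl_neq0[x Sx /vw /(_ b)]; rewrite wb0 /cnt => /card0_eq/(_ x).
by rewrite !inE updE !eqxx.
Qed.

Lemma gl_diag_wsp a w v : (v <= wsp w)%MS -> v *m gl F n a a = (w a)%:R *: v.
Proof.
move=> /wspP vw; apply: vatP => S; rewrite gl_diag vatZ.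
by have [->|/vw ->] := eqVneq (vat v S) 0; rewrite ?mulr0.
Qed.

Lemma stable_wsp w (s : {perm 'I_n}) : stable_mx (wsp w) (tmx F R s).
Proof.
apply: sub_mulmx_rows => v /wspP vw; apply/wspP => T.
by rewrite vat_tmx => /vw vT c; rewrite -vT cnt_tact.
Qed.

End Weights.

(** * Raising and lowering operators on three rows *)

Section ThreeRows.
Variables (F : fieldType) (charF0 : [pchar F] =i pred0) (n : nat) (R : finType).
Variables (r0 r1 r2 : R) (r_uniq : uniq [:: r0; r1; r2]).
Local Notation X := {ffun 'I_n -> R}.
Local Notation V := 'rV[F]_#|{: X}|.
Implicit Types (v : V) (T : X).

Let natF_neq0 m : (m.+1%:R : F) != 0.
Proof. by rewrite ((pcharf0P F).1 charF0). Qed.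

(** The weight (i, j, k) on r0, r1, r2, extended by 0. In the notations below D, E, D2 are the
    raising operators E_01, E_12, E_02, and U, E', A are the opposite lowering operators E_10, E_21,
    E_20. *)
Definition wt3 i j k (c : R) : nat :=
  if c == r0 then i else if c == r1 then j else if c == r2 then k else 0%N.
Definition weight_space i j k := wsp F n (wt3 i j k).
Local Notation W := weight_space.

Let r01 : (r0 == r1) = false.
Proof. by apply/negbTE; move: r_uniq; rewrite /= !inE; case: (r0 == r1). Qed.
Let r02 : (r0 == r2) = false.
Proof. by apply/negbTE; move: r_uniq; rewrite /= !inE orbC; case: (r0 == r2). Qed.
Let r12 : (r1 == r2) = false.
Proof. by apply/negbTE; move: r_uniq; rewrite /= !inE => /and3P[]. Qed.
Let r10 : (r1 == r0) = false. Proof. by rewrite eq_sym. Qed.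
Let r20 : (r2 == r0) = false. Proof. by rewrite eq_sym. Qed.
Let r21 : (r2 == r1) = false. Proof. by rewrite eq_sym. Qed.
Definition rows_neqE := (eqxx, r01, r02, r12, r10, r20, r21).

Local Notation D := (gl F n r0 r1).
Local Notation U := (gl F n r1 r0).
Local Notation E := (gl F n r1 r2).
Local Notation E' := (gl F n r2 r1).
Local Notation A := (gl F n r2 r0).
Local Notation D2 := (gl F n r0 r2).

Let wt_solve (a b c : R) i j k i' j' k' :
  (i' + (b == r0) = i + (a == r0))%N -> (j' + (b == r1) = j + (a == r1))%N ->
  (k' + (b == r2) = k + (a == r2))%N -> a \in [:: r0; r1; r2] -> b \in [:: r0; r1; r2] ->
  (wt3 i' j' k' c + (b == c) = wt3 i j k c + (a == c))%N.
Proof.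
move=> h0 h1 h2 ain bin; rewrite /wt3.
case: (eqVneq c r0) => [->|c0] //; case: (eqVneq c r1) => [->|c1] //.
case: (eqVneq c r2) => [->|c2] //.
by move: ain bin; rewrite !inE => /or3P[]/eqP-> /or3P[]/eqP->;
   rewrite !(eq_sym _ c) ?(negPf c0) ?(negPf c1) ?(negPf c2).
Qed.

Ltac wt_tac := move=> ?; apply: wt_solve; rewrite ?inE !rows_neqE ?orbT //=; lia.

Lemma W_D i j k v : (v <= W i j.+1 k)%MS -> (v *m D <= W i.+1 j k)%MS.
Proof. by apply: gl_wsp; wt_tac. Qed.
Lemma W_U i j k v : (v <= W i.+1 j k)%MS -> (v *m U <= W i j.+1 k)%MS.
Proof. by apply: gl_wsp; wt_tac. Qed.
Lemma W_E i j k v : (v <= W i j k.+1)%MS -> (v *m E <= W i j.+1 k)%MS.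
Proof. by apply: gl_wsp; wt_tac. Qed.
Lemma W_E' i j k v : (v <= W i j.+1 k)%MS -> (v *m E' <= W i j k.+1)%MS.
Proof. by apply: gl_wsp; wt_tac. Qed.
Lemma W_A i j k v : (v <= W i.+1 j k)%MS -> (v *m A <= W i j k.+1)%MS.
Proof. by apply: gl_wsp; wt_tac. Qed.
Lemma W_D2 i j k v : (v <= W i j k.+1)%MS -> (v *m D2 <= W i.+1 j k)%MS.
Proof. by apply: gl_wsp; wt_tac. Qed.

Lemma W_diag0 i j k v : (v <= W i j k)%MS -> v *m gl F n r0 r0 = i%:R *: v.
Proof. by move/gl_diag_wsp->; rewrite /wt3 rows_neqE. Qed.
Lemma W_diag1 i j k v : (v <= W i j k)%MS -> v *m gl F n r1 r1 = j%:R *: v.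
Proof. by move/gl_diag_wsp->; rewrite /wt3 !rows_neqE. Qed.
Lemma W_diag2 i j k v : (v <= W i j k)%MS -> v *m gl F n r2 r2 = k%:R *: v.
Proof. by move/gl_diag_wsp->; rewrite /wt3 !rows_neqE. Qed.

Lemma W_UD i j k v : (v <= W i j k)%MS ->
  v *m U *m D - v *m D *m U = (i%:R - j%:R) *: v.
Proof.
by move=> vW; rewrite gl_comm !rows_neqE !scale1r (W_diag0 vW) (W_diag1 vW) scalerBl.
Qed.

(** On these weights D U has no negative integer eigenvalue. Indeed v D is again an eigenvector,
    with the eigenvalue lowered further by the weight difference, so induction on j gives v D = 0,
    and then v itself is zero. *)
Lemma DU_inj j i k m v : (j <= i.+1)%N -> (v <= W i j k)%MS ->
  v *m D *m U = - m.+1%:R *: v -> v = 0.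
Proof.
have fin (v' : V) m' : v' *m D = 0 -> v' *m D *m U = - m'.+1%:R *: v' -> v' = 0.
  move=> ->; rewrite mul0mx => /esym/eqP.
  by rewrite scaler_eq0 oppr_eq0 (negPf (natF_neq0 _)) => /eqP.
elim: j i m v => [|j IHj] i m v ji vW vDU; apply: (fin _ m) => //.
  by apply: gl_wsp0 vW; rewrite /wt3 !rows_neqE.
have := W_D vW; set v' := v *m D => v'W.
apply: (IHj i.+1 (m + (i.+1 - j))%N _ _ v'W); first by clear -ji; lia.
have := W_UD v'W; rewrite {1}/v' vDU => /eqP; rewrite subr_eq => /eqP.
rewrite -scalemxAl -/v' => e; apply/eqP.
rewrite -subr_eq0 -[X in X - _](addKr ((i.+1%:R - j%:R) *: v')) -e.
rewrite -scaleNr -scalerDl -scalerBl -addSn natrD natrB; last by clear -ji; lia.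
set c := (X in X *: _); have -> : c = 0 by rewrite /c; ring.
by rewrite scale0r.
Qed.

(** On the target weight space U D = D U + (i + 1 - j), so a vector killed by U D would be an
    eigenvector of D U with eigenvalue -(i + 1 - j), which [DU_inj] excludes. Hence U D is bijective
    there and D is onto. *)
Lemma W_D_surj i j k : (j <= i)%N -> (W i j.+1 k *m D :=: W i.+1 j k)%MS.
Proof.
move=> ji; have sDW : (W i j.+1 k *m D <= W i.+1 j k)%MS.
  by apply: sub_mulmx_rows => v /W_D.
apply/eqmxP; rewrite sDW /=; set W' := W i.+1 j k.
have sUD : (W' *m (U *m D) <= W i j.+1 k *m D)%MS.
  rewrite mulmxA submxMr //.
  by apply: sub_mulmx_rows => v /W_U.
have sUDW := submx_trans sUD sDW.
have : (W' <= W' *m (U *m D))%MS.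
  rewrite -(mxrank_leqif_sup sUDW) eqn_leq mxrankS //=.
  have K0 : (W' :&: kermx (U *m D))%MS = 0.
    apply/eqP; rewrite -submx0; apply/row_subP => l; set v := row l _.
    have : (v <= W' :&: kermx (U *m D))%MS by apply: row_sub.
    rewrite sub_capmx => /andP[vW /sub_kermxP]; rewrite mulmxA => vUD.
    suff -> : v = 0 by rewrite sub0mx.
    apply: (DU_inj (m := i - j) _ vW); first by clear -ji; lia.
    have := W_UD vW; rewrite vUD sub0r => /eqP; rewrite eqr_oppLR => /eqP->.
    by rewrite -scaleNr -subSn // natrB // ltnW.
  by have := mxrank_mul_ker W' (U *m D); rewrite K0 mxrank0 addn0 => ->.
by move/submx_trans; apply.
Qed.

Definition ker01 i j k := (W i j k :&: kermx D)%MS.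
Definition ker01_sq i j := (W i j 0 :&: kermx (D *m D))%MS.
Definition hw_space i j := (ker01 i j 1 :&: kermx E)%MS.
Local Notation H := ker01.
Local Notation H2 := ker01_sq.
Local Notation K := hw_space.

(** The image lies in the kernel of D^2 because [E_01, E_12] = E_02 commutes with E_01. Conversely a
    vector g of that kernel gets an explicit preimage, a combination of three lowered forms of g and
    g D. *)
Lemma H_E_surj i j : (j < i)%N -> (H i j.+1 1 *m E :=: H2 i j.+2)%MS.
Proof.
move=> ji; apply/eqmxP/andP; split.
  apply: sub_mulmx_rows => v; rewrite !sub_capmx => /andP[vW /sub_kermxP vD].
  rewrite (W_E vW) /=; apply/sub_kermxP; rewrite mulmxA.
  have e1 : v *m E *m D = v *m D2.
    by have := gl_comm v r0 r1 r1 r2; rewrite vD mul0mx subr0 !rows_neqE scale1r scale0r subr0.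
  have := gl_comm v r0 r1 r0 r2; rewrite vD mul0mx subr0 !rows_neqE !scale0r subr0.
  by rewrite e1.
apply/row_subP => l; set g := row l _.
have : (g <= H2 i j.+2)%MS by apply: row_sub.
rewrite sub_capmx => /andP[gW /sub_kermxP]; rewrite mulmxA => gDD.
have gDW := W_D gW; have gE : g *m E = 0 by apply: gl_wsp0 gW; rewrite /wt3 !rows_neqE.
have gDE : g *m D *m E = 0 by apply: gl_wsp0 gDW; rewrite /wt3 !rows_neqE.
have gE'W := W_E' gW; have gDAW := W_A gDW; have gDE'W := W_E' gDW.
have gDE'UW := W_U gDE'W.
(* The coefficients solve the three equations that h D = 0 and h E = g amount to: al (j + 2) = 1, be
   + ga (j + 1) = 0 and al - be + ga (i + 1 - j) = 0. *)
pose J : F := j.+2%:R; pose al := J^-1; pose be := al * j.+1%:R / i.+2%:R.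
pose ga := - al / i.+2%:R.
pose h := al *: (g *m E') + be *: (g *m D *m A) + ga *: (g *m D *m E' *m U).
have hW : (h <= W i j.+1 1)%MS.
  by rewrite !addmx_sub ?scalemx_sub.
have n1 := natF_neq0 j.+1; have n2 := natF_neq0 i.+1.
have hD : h *m D = 0.
  have c1 : g *m E' *m D = g *m D *m E'.
    have := gl_comm g r0 r1 r2 r1; rewrite !rows_neqE !scale0r subr0 => /eqP.
    by rewrite subr_eq0 => /eqP.
  have c2 : g *m D *m A *m D = - (g *m D *m E').
    have := gl_comm (g *m D) r0 r1 r2 r0; rewrite gDD mul0mx subr0 !rows_neqE scale0r.
    by rewrite scale1r sub0r.
  have c3 : g *m D *m E' *m U *m D = (i.+1%:R - j%:R) *: (g *m D *m E').
    have <- := W_UD gDE'W.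
    have := gl_comm (g *m D) r0 r1 r2 r1; rewrite gDD mul0mx subr0 !rows_neqE !scale0r.
    by rewrite subr0 => ->; rewrite mul0mx subr0.
  rewrite /h !mulmxDl -!scalemxAl c1 c2 c3 scalerN scalerA -scaleNr -!scalerDl.
  set c := (X in X *: _); have -> : c = 0; last by rewrite scale0r.
  by rewrite /c /ga /be /al /J; field; rewrite -!natrD; apply/andP.
have hE : h *m E = g.
  have c1 : g *m E' *m E = J *: g.
    have := gl_comm g r1 r2 r2 r1; rewrite gE mul0mx subr0 !rows_neqE !scale1r.
    by rewrite (W_diag1 gW) (W_diag2 gW) scale0r subr0.
  have c2 : g *m D *m A *m E = g *m D *m U.
    have := gl_comm (g *m D) r1 r2 r2 r0; rewrite gDE mul0mx subr0 !rows_neqE scale1r.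
    by rewrite scale0r subr0.
  have c3 : g *m D *m E' *m U *m E = j.+1%:R *: (g *m D *m U).
    have := gl_comm (g *m D *m E') r1 r2 r1 r0; rewrite !rows_neqE !scale0r subr0.
    move/eqP; rewrite subr_eq0 => /eqP->; rewrite scalemxAl; congr (_ *m U).
    have := gl_comm (g *m D) r1 r2 r2 r1; rewrite gDE mul0mx subr0 !rows_neqE !scale1r.
    by rewrite (W_diag1 gDW) (W_diag2 gDW) scale0r subr0.
  rewrite /h !mulmxDl -!scalemxAl c1 c2 c3 !scalerA mulVf // scale1r -addrA -scalerDl.
  set c := (X in _ + X *: _); have -> : c = 0; last by rewrite scale0r addr0.
  by rewrite /c /ga /be /al /J; field; rewrite -!natrD; apply/andP.
by rewrite -hE submxMr // !sub_capmx hW; apply/sub_kermxP.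
Qed.

Definition ker02 i j := (W i j 1 :&: kermx D2)%MS.
Local Notation Z := ker02.

(** D2 kills vectors without r2, so on the weight (i + 1, j, 0) the composite A D2 is the scalar i +
    1, which is invertible. *)
Lemma W_D2_surj i j : (W i j 1 *m D2 :=: W i.+1 j 0)%MS.
Proof.
apply/eqmxP/andP; split; first by apply: sub_mulmx_rows => v /W_D2.
apply/row_subP => l; set g := row l _; have gW : (g <= W i.+1 j 0)%MS by apply: row_sub.
have -> : g = (i.+1%:R^-1 *: g) *m A *m D2.
  have := gl_comm g r0 r2 r2 r0; rewrite (gl_wsp0 (b := r2) _ _ gW); last by rewrite /wt3 !rows_neqE.
  rewrite mul0mx subr0 !rows_neqE !scale1r (W_diag0 gW) (W_diag2 gW) scale0r subr0.
  by rewrite -!scalemxAl => ->; rewrite scalerA mulVf ?scale1r.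
by rewrite submxMr // W_A // scalemx_sub.
Qed.

(** E and E' are inverse to each other here: they relabel the only entry different from r0. This
    identifies the two weights that meet at the boundary of the final telescoping sum. *)
Lemma W_E_iso i : (W i 0 1 *m E :=: W i 1 0)%MS /\ (W i 0 1 :&: kermx E)%MS = 0.
Proof.
have EE' v : (v <= W i 0 1)%MS -> v *m E *m E' = v.
  move=> vW; have := gl_comm v r2 r1 r1 r2; rewrite (gl_wsp0 (b := r1) _ _ vW); last by rewrite /wt3 !rows_neqE.
  by rewrite mul0mx subr0 !rows_neqE !scale1r (W_diag1 vW) (W_diag2 vW) scale0r scale1r subr0.
have E'E v : (v <= W i 1 0)%MS -> v *m E' *m E = v.
  move=> vW; have := gl_comm v r1 r2 r2 r1; rewrite (gl_wsp0 (b := r2) _ _ vW); last by rewrite /wt3 !rows_neqE.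
  by rewrite mul0mx subr0 !rows_neqE !scale1r (W_diag1 vW) (W_diag2 vW) scale0r scale1r subr0.
split; last first.
  apply/eqP; rewrite -submx0; apply/row_subP => l; set v := row l _.
  have : (v <= W i 0 1 :&: kermx E)%MS by apply: row_sub.
  rewrite sub_capmx => /andP[vW /sub_kermxP vE].
  by rewrite -(EE' v vW) vE mul0mx sub0mx.
apply/eqmxP/andP; split; first by apply: sub_mulmx_rows => v /W_E.
apply/row_subP => l; set v := row l _; have vW : (v <= W i 1 0)%MS by apply: row_sub.
by rewrite -(E'E v vW) submxMr // W_E'.
Qed.

Section Tau.
Variable M : 'M[F]_#|{: X}|.
Hypothesis (gl_M : forall a b, gl F n a b *m M = M *m gl F n a b).
Hypothesis (stM : forall w, stable_mx (wsp F n w) M).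

Lemma stable_H i j k : stable_mx (H i j k) M.
Proof. by apply: stable_capmx (stM _) (stable_kermx (esym (gl_M _ _))). Qed.

Lemma DD_M : M *m (D *m D) = D *m D *m M.
Proof. by rewrite mulmxA -gl_M -mulmxA -gl_M mulmxA. Qed.

Lemma stable_H2 i j : stable_mx (H2 i j) M.
Proof. by apply: stable_capmx (stM _) (stable_kermx DD_M). Qed.

Lemma stable_K i j : stable_mx (K i j) M.
Proof. by apply: stable_capmx (stable_H _ _ _) (stable_kermx (esym (gl_M _ _))). Qed.

Lemma stable_Z i j : stable_mx (Z i j) M.
Proof. by apply: stable_capmx (stM _) (stable_kermx (esym (gl_M _ _))). Qed.

Lemma tau_H i j k : (j <= i)%N ->
  trace_on (H i j.+1 k) M = trace_on (W i j.+1 k) M - trace_on (W i.+1 j k) M.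
Proof.
move=> ji; rewrite (trace_on_exact (esym (gl_M r0 r1)) (stM _)).
by rewrite (trace_on_eqmx (W_D_surj k ji) (stM _)) addrK.
Qed.

Lemma tau_Z i j :
  trace_on (Z i j) M = trace_on (W i j 1) M - trace_on (W i.+1 j 0) M.
Proof.
rewrite (trace_on_exact (esym (gl_M r0 r2)) (stM _)).
by rewrite (trace_on_eqmx (W_D2_surj i j) (stM _)) addrK.
Qed.

Lemma tau_W01 i : trace_on (W i 0 1) M = trace_on (W i 1 0) M.
Proof.
have [e k0] := W_E_iso i.
by rewrite (trace_on_inj (esym (gl_M r1 r2)) (stM _) k0) (trace_on_eqmx e (stM _)).
Qed.

(** The right-hand side is the Jacobi-Trudi determinant of the shape (i, j + 1, 1), as [tau_H] with
    k = 0 is that of (i, j + 1). It comes from the exact sequence of E on the kernel of D, whose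
    image is the kernel of D^2, and from the surjectivity of D^2. *)
Lemma tau_K i j : (j < i)%N ->
  trace_on (K i j.+1) M = trace_on (W i j.+1 1) M - trace_on (W i.+1 j 1) M
    - trace_on (W i j.+2 0) M + trace_on (W i.+2 j 0) M.
Proof.
move=> ji; rewrite -tau_H ?(ltnW ji) //.
rewrite [trace_on (H _ _ _) _](trace_on_exact (esym (gl_M r1 r2)) (stable_H _ _ _)).
rewrite (trace_on_eqmx (H_E_surj ji) (stable_H2 _ _)).
rewrite (trace_on_exact DD_M (stM (wt3 i j.+2 0))).
have e : (W i j.+2 0 *m (D *m D) :=: W i.+2 j 0)%MS.
  rewrite mulmxA; apply: eqmx_trans (eqmxMr _ (W_D_surj _ ji)) _.
  by apply: W_D_surj; rewrite ltnW // ltnW.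
by rewrite (trace_on_eqmx e (stM _)) opprD addrA addrNK addrK.
Qed.

End Tau.

End ThreeRows.

(** * Specht modules with at most three rows *)

Section ColumnSums.
Variables (F : fieldType) (charF0 : [pchar F] =i pred0) (n : nat) (R : finType).
Local Notation X := {ffun 'I_n -> R}.
Implicit Types (T S : X) (g : 'I_n -> nat) (q p : {perm 'I_n}).

(* Only the columns of index < m are permuted, so that the column
   antisymmetrizer can be peeled off one column at a time. *)
Definition cstab m g : {set {perm 'I_n}} :=
  [set q : {perm 'I_n} | [forall x, if (g x < m)%N then g (q x) == g x else q x == x]].

Lemma cstabP m g q :
  reflect (forall x, if (g x < m)%N then g (q x) = g x else q x = x) (q \in cstab m g).
Proof.
rewrite inE; apply: (iffP forallP) => H x; have := H x; case: ifP => _.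
all: by [move/eqP | move=> /eqP].
Qed.

Lemma cstab_ext m g g' : (forall x, minn (g x) m = minn (g' x) m) ->
  cstab m g = cstab m g'.
Proof.
move=> gg'; apply/setP => q; rewrite !inE; apply: eq_forallb => x.
have := gg' x; have := gg' (q x); clear; case: (q x == x) => ? ?.
all: case: ltnP => ?; case: ltnP => ?; lia.
Qed.

Lemma cstab0 g : cstab 0 g = [set 1%g].
Proof.
apply/setP => q; rewrite [in RHS]inE; apply/cstabP/eqP => [H|-> x] /=; last by rewrite perm1.
by apply/permP => x; rewrite H perm1.
Qed.

Lemma cstab_tperm m g x y q : (g x < m)%N -> g x = g y ->
  ((tperm x y * q)%g \in cstab m g) = (q \in cstab m g).
Proof.
move=> gx gxy.
have H q' : q' \in cstab m g -> (tperm x y * q')%g \in cstab m g.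
  move=> /cstabP qC; apply/cstabP => z; rewrite permM.
  by case: tpermP => [->|->|_ _]; [have := qC y | have := qC x | exact: qC];
     rewrite -?gxy gx.
by apply/idP/idP => [/H|/H //]; rewrite mulgA tperm2 mul1g.
Qed.

Section Sums.
Variable L : lmodType F.
Implicit Type phi : X -> L.

(** The target L is left general: with [vdelta F] for phi the sum is a polytabloid, with [vat v] it
    is the pairing of v with that polytabloid. *)
Definition csum m g phi T : L :=
  \sum_(q in cstab m g) (-1) ^+ q *: phi (tact q T).

Lemma csum_tperm m g phi T x y : x != y -> (g x < m)%N -> g x = g y ->
  csum m g phi (tact (tperm x y) T) = - csum m g phi T.
Proof.
move=> xy gx gxy; rewrite /csum -sumrN (reindex_inj (mulgI (tperm x y))) /=.
apply: eq_big => q; rewrite cstab_tperm // => _.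
by rewrite odd_permM odd_tperm xy /= signrN scaleNr tactM mulgA tperm2 mul1g.
Qed.

Lemma csum_eq0 m g phi T x y : x != y -> (g x < m)%N -> g x = g y -> T x = T y ->
  csum m g phi T = 0.
Proof.
move=> xy gx gxy Txy; have := csum_tperm phi T xy gx gxy.
have -> : tact (tperm x y) T = T.
  by apply/ffunP => z; rewrite ffunE tpermV; case: tpermP => [->|->|].
move/eqP; rewrite -addr_eq0 -mulr2n -scaler_nat scaler_eq0.
by rewrite ((pcharf0P F).1 charF0) => /eqP.
Qed.

(** Column m has exactly the two entries u and w, so the larger column group consists of two cosets
    of the smaller one, represented by the identity and the transposition of u and w. *)
Lemma csum_split m g phi T u w : u != w -> g u = m -> g w = m ->
  (forall x, g x = m -> x = u \/ x = w) ->
  csum m.+1 g phi T = csum m g phi T - csum m g phi (tact (tperm u w) T).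
Proof.
move=> uw gu gw only.
have sub q : q \in cstab m g = (q \in cstab m.+1 g) && (q u == u).
  apply/idP/andP => [/cstabP qC | [/cstabP qC /eqP qu]].
    have qu : q u = u by have := qC u; rewrite gu ltnn.
    split; last by rewrite qu.
    apply/cstabP => x; have := qC x; case: ltnP => gx qx; first by rewrite ltnW.
    by rewrite qx; case: ifP.
  have qw : q w = w.
    have := qC w; rewrite gw ltnSn => /only[] // e.
    by move: uw; rewrite -(inj_eq (@perm_inj _ q)) e qu eqxx.
  apply/cstabP => x; have := qC x; rewrite ltnS leq_eqVlt.
  have [/only[]-> //|_ /=] := eqVneq (g x) m; rewrite ?gu ?gw ?ltnn //.
rewrite /csum (bigID (fun q : {perm 'I_n} => q u == u)) /=; congr (_ + _).
  by apply: eq_bigl => q; rewrite sub.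
rewrite -sumrN (reindex_inj (mulgI (tperm u w))) /=.
apply: eq_big => q; last first.
  by move=> _; rewrite odd_permM odd_tperm uw /= signrN scaleNr tactM.
rewrite cstab_tperm ?gu ?gw // sub permM tpermL.
case: (boolP (q \in _)) => //= /cstabP qC.
have qw : q w = u \/ q w = w by have := qC w; rewrite gw ltnSn => /only.
have qu : q u = u \/ q u = w by have := qC u; rewrite gu ltnSn => /only.
have : q u != q w by rewrite (inj_eq perm_inj).
by case: qw => ->; case: qu => ->; rewrite ?eqxx // => h; rewrite ?(negPf h) // eq_sym h.
Qed.

Lemma csum_0 g phi T : csum 0 g phi T = phi T.
Proof. by rewrite /csum cstab0 big_set1 odd_perm1 scale1r tact1. Qed.

End Sums.

Lemma csum_gl m g (v : 'rV[F]_#|{: X}|) T a b :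
  \sum_(y | T y == a) csum m g (vat v : X -> F^o) (upd T y b) =
  csum m g (vat (v *m gl F n a b) : X -> F^o) T.
Proof.
rewrite exchange_big; apply: eq_bigr => q _; rewrite -scaler_sumr; congr (_ *: _).
rewrite vat_gl [RHS](reindex_inj (@perm_inj _ q)).
apply: eq_big => [x|x _]; first by rewrite ffunE permK.
by rewrite upd_tact permK.
Qed.

Lemma vdelta_gl T a b :
  vdelta F T *m gl F n a b = \sum_(x | T x == b) vdelta F (upd T x a).
Proof.
apply: vatP => S; rewrite vat_gl vat_sum big_mkcond [RHS]big_mkcond.
apply: eq_bigr => x _; rewrite !vdeltaE.
case: (eqVneq (S x) a) => Sx; case: (eqVneq (T x) b) => Tx.
- congr (nat_of_bool _)%:R; apply/eqP/eqP => [<-|->]; first by rewrite updK -Sx upd_id.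
  by rewrite updK -Tx upd_id.
- case: eqP => // e; by move: Tx; rewrite -e updE !eqxx.
- case: eqP => // e; by move: Sx; rewrite e updE eqxx eqxx.
- by [].
Qed.

(** Changing a b into an a repeats an entry in one column, and the antisymmetrized sum of such a
    filling is zero. Polytabloids are highest weight vectors for this reason. *)
Lemma csum_vdelta_gl m g T a b :
  (forall y, T y = b -> exists y', [/\ T y' = a, (g y < m)%N & g y' = g y]) ->
  a != b -> csum m g (@vdelta F _) T *m gl F n a b = 0.
Proof.
move=> partner ab; rewrite /csum mulmx_suml.
transitivity (\sum_(y | T y == b) csum m g (@vdelta F _) (upd T y a)).
  rewrite exchange_big /=; apply: eq_bigr => q _; rewrite -scaler_sumr -scalemxAl.
  congr (_ *: _); rewrite vdelta_gl (reindex_inj (@perm_inj _ q)).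
  apply: eq_big => [x|x _]; first by rewrite ffunE permK.
  by rewrite upd_tact permK.
apply: big1 => y /eqP Ty; have [y' [Ty' gy gyy']] := partner _ Ty.
have yy' : y != y' by apply: contra ab => /eqP e; rewrite -Ty -Ty' e.
apply: (csum_eq0 _ yy') => //.
by rewrite !updE eqxx eq_sym (negPf yy').
Qed.

End ColumnSums.

(** * Polytabloids of shape (a, b, e) with e at most 1 *)

Section Tableaux.
Variables (F : fieldType) (charF0 : [pchar F] =i pred0) (n : nat) (R : finType).
Variables (r0 r1 r2 : R) (r_uniq : uniq [:: r0; r1; r2]).
Local Notation X := {ffun 'I_n -> R}.
Local Notation V := 'rV[F]_#|{: X}|.
Implicit Types (v : V) (T S : X) (p q : {perm 'I_n}).
Local Notation D := (gl F n r0 r1).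
Local Notation E := (gl F n r1 r2).
Local Notation D2 := (gl F n r0 r2).
Local Notation W := (weight_space F n r0 r1 r2).
Local Notation H := (ker01 F n r0 r1 r2).
Local Notation K := (hw_space F n r0 r1 r2).

Let natF_neq0 m : (m.+1%:R : F) != 0.
Proof. by rewrite ((pcharf0P F).1 charF0). Qed.
Let rE := rows_neqE r_uniq.

Variables (a b e : nat) (n_eq : n = (a + b + e)%N).
Hypotheses (ba : (b <= a)%N) (eb : (e <= b)%N) (e1 : (e <= 1)%N).

(* The cells of the diagram (a, b, e) are numbered in reading order. *)
Definition cell_row : X :=
  [ffun c : 'I_n => if (c < a)%N then r0 else if (c < a + b)%N then r1 else r2].
Definition cell_col (c : 'I_n) : nat :=
  if (c < a)%N then (c : nat) else if (c < a + b)%N then (c - a)%N else (c - (a + b))%N.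

Definition tab p : X := tact p cell_row.
Definition tcol p (x : 'I_n) : nat := cell_col (p^-1 x)%g.

Lemma rho_r0 c : cell_row c = r0 -> (c < a)%N.
Proof. by rewrite ffunE; case: ltnP => // _; case: ifP => _ /eqP; rewrite rE. Qed.
Lemma rho_r1 c : cell_row c = r1 -> (a <= c < a + b)%N.
Proof.
by rewrite ffunE; case: ltnP => _; [|case: ltnP => _ //]; move/eqP; rewrite rE.
Qed.
Lemma rho_r2 c : cell_row c = r2 -> (a + b <= c)%N.
Proof.
by rewrite ffunE; case: ltnP => _; [|case: ltnP => _ //]; move/eqP; rewrite rE.
Qed.

Lemma cell_lt (c : 'I_n) : (c < a + b + e)%N.
Proof. by rewrite -n_eq. Qed.

Lemma cell_ex i : (i < a + b + e)%N -> exists c : 'I_n, c = i :> nat.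
Proof. by rewrite -n_eq => ci; exists (Ordinal ci). Qed.

Lemma partner_r1 c : cell_row c = r1 -> exists c', [/\ cell_row c' = r0, (cell_col c < b)%N & cell_col c' = cell_col c].
Proof.
move/rho_r1/andP => [c1 c2]; have ci : (c - a < a + b + e)%N by clear -c1 c2 ba; lia.
have [c' ec'] := cell_ex ci; exists c'.
have lt : (c' < a)%N by rewrite ec'; clear -c1 c2 ba; lia.
have lt3 : (c < a)%N = false by clear -c1; lia.
rewrite /cell_col ffunE lt lt3 c2; split => //.
by clear -c1 c2 ba; lia.
Qed.

Lemma partner_r2 c : cell_row c = r2 -> exists c', [/\ cell_row c' = r1, (cell_col c < b)%N & cell_col c' = cell_col c].
Proof.
move/rho_r2 => c1; have c2 := cell_lt c.
have ci : (c - b < a + b + e)%N by clear -c2; lia.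
have [c' ec'] := cell_ex ci; exists c'.
have lt1 : (c' < a)%N = false by rewrite ec'; clear -c1; lia.
have lt2 : (c' < a + b)%N by rewrite ec'; clear -c1 c2 eb; lia.
have lt3 : (c < a)%N = false by clear -c1; lia.
have lt4 : (c < a + b)%N = false by clear -c1; lia.
rewrite /cell_col ffunE lt1 lt2 lt3 lt4; split => //.
  by clear -c1 c2 eb; lia.
by rewrite ec'; clear -c1; lia.
Qed.

Lemma partner_r0 c : cell_row c = r0 -> (cell_col c < b)%N -> exists c', cell_row c' = r1 /\ cell_col c' = cell_col c.
Proof.
move/rho_r0 => c1; rewrite /cell_col c1 => cb.
have ci : (a + c < a + b + e)%N by clear -cb; lia.
have [c' ec'] := cell_ex ci; exists c'.
have lt1 : (c' < a)%N = false by rewrite ec'; clear; lia.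
have lt2 : (c' < a + b)%N by rewrite ec'; clear -cb; lia.
by rewrite ffunE lt1 lt2 ec' addKn.
Qed.

Lemma column_pair m : (e <= m < b)%N -> exists c0 c1, [/\ cell_row c0 = r0, cell_row c1 = r1,
  cell_col c0 = m, cell_col c1 = m & forall c, cell_col c = m -> c = c0 \/ c = c1].
Proof.
move=> /andP[em mb].
have ci0 : (m < a + b + e)%N by clear -mb; lia.
have ci1 : (a + m < a + b + e)%N by clear -mb; lia.
have [c0 e0] := cell_ex ci0; have [c1 ec1] := cell_ex ci1; exists c0, c1.
have lt0 : (c0 < a)%N by rewrite e0; clear -mb ba; lia.
have lt1 : (c1 < a)%N = false by rewrite ec1; clear; lia.
have lt2 : (c1 < a + b)%N by rewrite ec1; clear -mb; lia.
rewrite /cell_col !ffunE lt0 lt1 lt2 ec1 addKn; split => // c.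
have cl := cell_lt c; case: (ltnP c a) => [_ cm | ac].
  by left; apply: val_inj; rewrite /= e0.
case: (ltnP c (a + b)) => cab cm.
  by right; apply: val_inj; rewrite /= ec1 -cm subnKC.
by exfalso; clear -cl cab cm em; lia.
Qed.

Lemma tab_at p c : tab p (p c) = cell_row c.
Proof. by rewrite ffunE permK. Qed.
Lemma tcol_at p c : tcol p (p c) = cell_col c.
Proof. by rewrite /tcol permK. Qed.

(** Exchanging two entries of one row changes the tableau but not its row filling, so any entry of
    the row of c may be assumed to stand in the cell c. *)
Lemma tab_move p c x : tab p x = cell_row c -> exists p', [/\ tab p' = tab p, p' c = x &
  forall c', cell_row c' <> cell_row c -> p' c' = p c'].
Proof.
move=> px; exists (p * tperm (p c) x)%g.
have e0 : tact (tperm (p c) x) (tab p) = tab p.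
  apply/ffunP => z; rewrite ffunE tpermV; case: tpermP => [->|->|] //.
    by rewrite tab_at.
  by rewrite tab_at.
split; first by rewrite /tab -tactM e0.
  by rewrite permM tpermL.
move=> c' nc; rewrite permM tpermD //.
  by apply/eqP => /perm_inj e'; apply: nc; rewrite e'.
by apply/eqP => e'; apply: nc; rewrite -px e' tab_at.
Qed.

(** By [csum_split] the hypothesis says that exchanging the two entries of column m leaves the sum
    over the smaller group unchanged. A Garnir-like relation coming from v D = 0 then has terms that
    are either zero, by a repetition in a column of index less than m, or equal to the sum g in
    question; so a positive multiple of g vanishes. *)
Lemma csum_peel v m : (e <= m < b)%N -> v *m D = 0 ->
  (forall p, csum m.+1 (tcol p) (vat v : X -> F^o) (tab p) = 0) ->
  forall p, csum m (tcol p) (vat v : X -> F^o) (tab p) = 0.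
Proof.
move=> mb vD Gm1; have [c0 [c1 [rc0 rc1 gc0 gc1 only]]] := column_pair mb.
have c01 : c0 != c1 by apply/eqP => ec; move: rc0; rewrite ec rc1 => /eqP; rewrite rE.
pose phi := vat v : X -> F^o.
have swap p : csum m (tcol p) phi (tab p) =
    csum m (tcol p) phi (tact (tperm (p c0) (p c1)) (tab p)).
  have := Gm1 p; rewrite (csum_split _ _ (u := p c0) (w := p c1)) ?tcol_at //.
  - by move/eqP; rewrite subr_eq0 => /eqP.
  - by rewrite (inj_eq perm_inj).
  by move=> x /only[] <-; [left|right]; rewrite permKV.
(* [h] moves the second-row entry z of column m up to the first row. The vanishing of v D at [h] is
   a sum over all ways of moving a first-row entry y of [h] down; y = z gives back g. *)
move=> p; set g := csum m _ _ _; pose z := p c1; pose h := upd (tab p) z r0.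
have tz : tab p z = r1 by rewrite tab_at.
have hz : h z == r0 by rewrite updE eqxx.
have := csum_gl m (tcol p) v h r0 r1; rewrite vD.
rewrite [RHS]big1 => [|q _]; last by rewrite vat0 scaler0.
have term y : h y == r0 -> csum m (tcol p) phi (upd h y r1) =
    (if (tcol p y < m)%N then 0 else g).
  move=> hy; case: ltnP => ym.
    have yz : y != z by apply: contraTneq ym => ->; rewrite tcol_at gc1 ltnn.
    have ty : cell_row (p^-1 y)%g = r0.
      by move: hy; rewrite updE (negPf yz) ffunE => /eqP.
    have yb : (cell_col (p^-1 y)%g < b)%N by apply: leq_trans ym _; case/andP: mb => _ /ltnW.
    have [c' [rc' gc']] := partner_r0 ty yb.
    have yc' : y != p c'.
      by apply/eqP => ey; move: ty; rewrite ey permK rc' => /eqP; rewrite rE.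
    apply: (csum_eq0 charF0 _ yc') => //; first by rewrite tcol_at gc'.
    rewrite !updE eqxx eq_sym (negPf yc') tab_at rc'.
    by case: eqP => // e'; move: ym; rewrite /tcol -gc' -[c'](permK p) e' -/(tcol p z) tcol_at gc1 ltnn.
  have [-> | yz] := eqVneq y z; first by rewrite updK -tz upd_id.
  have ty : tab p y = r0 by move: hy; rewrite updE (negPf yz) => /eqP.
  (* Exchanging y with the first-row entry of column m keeps the filling and the columns of index
     less than m, and puts y above z; [swap] for the new tableau identifies the term with g. *)
  have [p' [tp' py' pc']] : exists p', [/\ tab p' = tab p, p' c0 = y & p' c1 = z /\
      cstab m (tcol p') = cstab m (tcol p)].
    exists (p * tperm (p c0) y)%g; have e0 : tact (tperm (p c0) y) (tab p) = tab p.
      apply/ffunP => x; rewrite ffunE tpermV; case: tpermP => [->|->|] //.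
        by rewrite tab_at ty.
      by rewrite tab_at ty.
    split; first by rewrite /tab -tactM e0.
      by rewrite permM tpermL.
    split; first by rewrite permM tpermD // (inj_eq perm_inj).
    apply: cstab_ext => x; rewrite /tcol invMg permM tpermV.
    case: tpermP => [->|->|] //.
      by rewrite permK gc0 minnn; apply/minn_idPr.
    by rewrite permK gc0 minnn; apply/esym/minn_idPr.
  case: pc' => pz cs; have := swap p'; rewrite /csum cs tp' -/(csum _ _ _ _) -/g => ->.
  congr (csum m (tcol p) phi _); apply/ffunP => x; rewrite !updE [RHS]ffunE tpermV py' pz.
  by case: tpermP => [->|->|/eqP/negPf-> /eqP/negPf->]; rewrite ?eqxx ?(negPf yz) ?(eq_sym z) ?(negPf yz).
under eq_bigr => y hy do rewrite (term y hy) -if_neg -leqNgt.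
rewrite -big_mkcondr /= sumr_const -scaler_nat => /eqP; rewrite scaler_eq0.
set N := #|_|; have N0 : (0 < N)%N.
  by apply/card_gt0P; exists z; rewrite unfold_in /= hz /z tcol_at gc1 leqnn.
by rewrite -(prednK N0) (negPf (natF_neq0 _)) => /eqP.
Qed.

Lemma csum_descend v m : (e <= m <= b)%N -> v *m D = 0 ->
  (forall p, csum b (tcol p) (vat v : X -> F^o) (tab p) = 0) ->
  forall p, csum m (tcol p) (vat v : X -> F^o) (tab p) = 0.
Proof.
move=> /andP[em mb] vD vb.
have {mb} := subnK mb; move: (b - m)%N => d; elim: d m em => [|d IHd] m em bd p.
  by move: bd; rewrite add0n => ->; apply: vb.
have mlt : (e <= m < b)%N by rewrite em -bd addSn ltnS leq_addl.
apply: (csum_peel mlt vD) => p'; apply: IHd; first exact: ltnW.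
by rewrite addnS -addSn.
Qed.

Definition polytabloid p : V := csum b (tcol p) (@vdelta F _) (tab p).

Lemma polytabloid_dot v p : csum b (tcol p) (vat v : X -> F^o) (tab p) =
  \sum_T vat v T * vat (polytabloid p) T.
Proof.
rewrite /polytabloid /csum; under [RHS]eq_bigr => T _ do rewrite vat_sum mulr_sumr.
rewrite exchange_big /=; apply: eq_bigr => q _.
rewrite (bigD1 (tact q (tab p))) //= vatZ vdeltaE eqxx mulr1 big1 ?addr0.
  by rewrite mulrC.
by move=> T nT; rewrite vatZ vdeltaE (negPf nT) !mulr0.
Qed.

Lemma card_interval i j : (j <= n)%N -> #|[pred c : 'I_n | (i <= c < j)%N]| = (j - i)%N.
Proof.
move=> jn; rewrite -sum1_card.
have E m : (\sum_(c < m | i <= c < j) 1 = minn m j - i)%N.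
  elim: m => [|m IHm]; first by rewrite big_ord0 min0n.
  rewrite big_mkcond big_ord_recr /= -big_mkcond IHm; clear.
  by case: ifP; lia.
by rewrite E; congr subn; apply/minn_idPr.
Qed.

Lemma cnt_rho c : cnt cell_row c = wt3 r0 r1 r2 a b e c.
Proof.
rewrite /cnt /wt3; case: (eqVneq c r0) => [->|c0].
  rewrite -[RHS](subn0 a) -card_interval; last by rewrite n_eq; clear; lia.
  apply: eq_card => x; rewrite !inE ffunE leq0n /=.
  by case: ltnP => _; rewrite ?eqxx //; case: ifP => _; rewrite rE.
case: (eqVneq c r1) => [->|c1].
  rewrite -[RHS](addKn a b) -card_interval; last by rewrite n_eq; clear; lia.
  apply: eq_card => x; rewrite !inE ffunE.
  by case: ltnP => _; rewrite ?rE //; case: ifP => _; rewrite ?rE.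
case: (eqVneq c r2) => [->|c2].
  rewrite -[RHS](addKn (a + b) e) -card_interval; last by rewrite n_eq; clear; lia.
  apply: eq_card => x; rewrite !inE ffunE cell_lt andbT.
  case: (ltnP x a) => xa; first by rewrite rE; apply/esym; clear -xa; lia.
  by case: ltnP => xa'; rewrite ?rE.
apply: eq_card0 => x; rewrite !inE ffunE.
by case: ifP => _; last case: ifP => _; rewrite eq_sym ?(negPf c0) ?(negPf c1) ?(negPf c2).
Qed.

Lemma tab_W p q : (vdelta F (tact q (tab p)) <= W a b e)%MS.
Proof.
apply/wspP => T; rewrite vdeltaE; case: (eqVneq T) => [->|]; last by rewrite eqxx.
by move=> _ c; rewrite /tab !cnt_tact cnt_rho.
Qed.

Lemma tab_ex T v : (v <= W a b e)%MS -> vat v T != 0 -> exists p, T = tab p.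
Proof.
move/wspP => vW /vW Tc; have [c|p ->] := @perm_of_cnt n R cell_row T; last by exists p.
by rewrite cnt_rho Tc.
Qed.

Lemma polytabloid_W p : (polytabloid p <= W a b e)%MS.
Proof. by apply: summx_sub => q _; rewrite scalemx_sub ?tab_W. Qed.

Lemma polytabloid_D p : polytabloid p *m D = 0.
Proof.
apply: (csum_vdelta_gl charF0); last by rewrite rE.
move=> y; rewrite ffunE => /partner_r1[c' [rc' gc gcc']].
by exists (p c'); rewrite tab_at tcol_at.
Qed.

Lemma polytabloid_E p : polytabloid p *m E = 0.
Proof.
apply: (csum_vdelta_gl charF0); last by rewrite rE.
move=> y; rewrite ffunE => /partner_r2[c' [rc' gc gcc']].
by exists (p c'); rewrite tab_at tcol_at.
Qed.

(** The six permutations of a column of height three, sorted by which of z, x, y they send to z. *)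
Lemma csum1_three v T g x y z : uniq [:: x; y; z] ->
  (forall t, (g t < 1)%N = (t \in [:: x; y; z])) ->
  csum 1 g (vat v : X -> F^o) T =
    (vat v T - vat v (tact (tperm x y) T))
    - (vat v (tact (tperm x z) T) - vat v (tact (tperm x y) (tact (tperm x z) T)))
    - (vat v (tact (tperm y z) T) - vat v (tact (tperm x y) (tact (tperm y z) T))).
Proof.
move=> xyz gP; have [xy xz yz] : [/\ x != y, x != z & y != z].
  by move: xyz; rewrite /= !inE negb_or => /and3P[/andP[-> ->] ->].
have gE t : t \in [:: x; y; z] -> g t = 0%N by rewrite -gP ltnS leqn0 => /eqP.
have [gx gy gz] : [/\ g x = 0%N, g y = 0%N & g z = 0%N].
  by split; apply: gE; rewrite !inE eqxx ?orbT.
pose f q T := (-1) ^+ (q : {perm 'I_n}) *: (vat v (tact q T) : F^o).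
have fz S : \sum_(q in cstab 1 g | q z == z) f q S = vat v S - vat v (tact (tperm x y) S).
  have -> : vat v S - vat v (tact (tperm x y) S) = \sum_(q in [set 1%g; tperm x y]) f q S.
    rewrite big_setU1 ?inE /= ?big_set1 /f; last first.
      by apply: contra xy => /eqP ey; have := tpermL x y; rewrite -ey perm1 => ->.
    by rewrite odd_perm1 odd_tperm xy tact1 scale1r expr1 scaleN1r.
  apply: eq_bigl => q; rewrite in_set2.
  apply/andP/orP => [[/cstabP qC /eqP qz]|]; last first.
    case=> /eqP->; last first.
      rewrite tpermD // eqxx -[tperm x y]mulg1 cstab_tperm ?gx ?gy //.
      by split=> //; apply/cstabP => t; rewrite perm1; case: ifP.
    by rewrite perm1 eqxx; split=> //; apply/cstabP => t; rewrite perm1; case: ifP.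
  have out t : t \notin [:: x; y; z] -> q t = t.
    by rewrite -gP => ng; have := qC t; rewrite (negPf ng).
  have im t : t \in [:: x; y; z] -> t != z -> q t = x \/ q t = y.
    move=> tin tz; have := qC t; rewrite gP tin => qt.
    have : q t \in [:: x; y; z] by rewrite -gP qt (gE _ tin).
    have : q t != z by rewrite -qz (inj_eq perm_inj).
    by rewrite !inE => /negPf->; rewrite orbF => /orP[]/eqP; [left|right].
  have qx := im x; have qy := im y; rewrite !inE !eqxx ?orbT xz yz in qx qy.
  have qxy : q x != q y by rewrite (inj_eq perm_inj).
  case: (qx isT isT) => ex; case: (qy isT isT) => ey.
  - by move: qxy; rewrite ex ey eqxx.
  - left; apply/eqP/permP => t; rewrite perm1.
    case: (boolP (t \in [:: x; y; z])) => [|/out //].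
    by rewrite !inE => /or3P[]/eqP->.
  - right; apply/eqP/permP => t; case: tpermP => [->|->|/eqP nx /eqP ny] //.
    have [->//|nz] := eqVneq t z.
    by apply: out; rewrite !inE (negPf nx) (negPf ny).
  - by move: qxy; rewrite ex ey eqxx.
have shift t S : t != z -> g t = 0%N ->
    \sum_(q in cstab 1 g | q t == z) f q S =
    - (vat v (tact (tperm t z) S) - vat v (tact (tperm x y) (tact (tperm t z) S))).
  move=> tz gt; rewrite -fz -sumrN (reindex_inj (mulgI (tperm t z))) /=.
  apply: eq_big => [q|q _]; first by rewrite cstab_tperm ?gt ?gz // permM tpermL.
  by rewrite /f odd_permM odd_tperm tz /= signrN scaleNr tactM.
rewrite -!shift // -fz /csum.
rewrite (bigID (fun q : {perm 'I_n} => q z == z)) /= -addrA; congr (_ + _).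
rewrite (bigID (fun q : {perm 'I_n} => q x == z)) /=; congr (_ + _).
  apply: eq_bigl => q; rewrite -andbA; congr andb; apply/andP/idP => [[]//|/eqP qx].
  split; last exact/eqP.
  by apply: contra xz => /eqP qz; rewrite -(inj_eq (@perm_inj _ q)) qx qz.
apply: eq_bigl => q; rewrite -!andbA; case: (boolP (q \in cstab _ _)) => //= /cstabP qC.
have [t qt] : exists t, q t = z by exists (q^-1 z)%g; rewrite permKV.
have tin : t \in [:: x; y; z].
  apply: contraT; rewrite -gP => ng; have := qC t; rewrite (negPf ng) qt => et.
  by rewrite -et gz in ng.
have h s : (q s == z) = (s == t) by rewrite -qt (inj_eq perm_inj).
rewrite !h; move: tin; rewrite !inE => /or3P[]/eqP->.
- by rewrite eqxx andbF eq_sym (negPf xy).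
- by rewrite eqxx (negPf xy) eq_sym yz.
- by rewrite eqxx (negPf yz).
Qed.

Section SpanDual.
Variables (m : nat) (P : 'M[F]_(m, #|{: X}|)).
Hypothesis P_polytab : forall i, exists p, row i P = polytabloid p.
Hypothesis P_all : forall p, exists i, row i P = polytabloid p.

Lemma dual_csum v p : v *m P^T = 0 -> csum b (tcol p) (vat v : X -> F^o) (tab p) = 0.
Proof.
move=> vP; rewrite polytabloid_dot; have [i <-] := P_all p.
have := congr1 (fun M : 'rV_m => M 0 i) vP; rewrite !mxE => Pe; rewrite -[RHS]Pe.
rewrite (reindex (fun k : 'I_#|{: X}| => enum_val k)) /=; last first.
  by exists (@enum_rank _) => k _; rewrite ?enum_valK ?enum_rankK.
by apply: eq_bigr => k _; rewrite /vat !mxE enum_valK.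
Qed.

Lemma span_eq (Q : 'M[F]_#|{: X}|) :
  (forall p, (polytabloid p <= Q)%MS) ->
  (forall v, (v <= Q)%MS ->
    (forall p, csum b (tcol p) (vat v : X -> F^o) (tab p) = 0) -> v = 0) ->
  (P :=: Q)%MS.
Proof.
move=> PQ Q0; apply: eqmx_dual => [|v vQ vP].
  by apply/row_subP => i; have [p ->] := P_polytab i.
by apply: Q0 => // p; apply: dual_csum.
Qed.

(** All columns can be peeled off: the sum over the trivial group is a single value of v, so every
    value of v on the weight space is zero. *)
Lemma span_H : e = 0%N -> (P :=: H a b 0)%MS.
Proof.
move=> e0; have W0 : W a b e = W a b 0 by rewrite e0.
apply: span_eq => [p|v].
  by rewrite sub_capmx -W0 polytabloid_W; apply/sub_kermxP/polytabloid_D.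
rewrite sub_capmx -W0 => /andP[vW /sub_kermxP vD] vb.
apply: vatP => T; rewrite vat0; apply/eqP; apply: contraT => nT.
have [p eT] := tab_ex vW nT.
have := csum_descend (m := 0) _ vD vb p; rewrite csum_0 -eT e0 leqnn => /(_ isT) vT.
by rewrite vT eqxx in nT.
Qed.

(** Peeling stops at the first column, which has three cells. What is left is a six-term relation in
    that column; combined with the vanishing of v D and v D2 it shows that exchanging an entry of
    row r1 with one of row r2 does not change v, and then v E = 0 gives a positive multiple of each
    value of v. *)
Lemma span_K : e = 1%N -> (P :=: K a b)%MS.
Proof.
move=> ee; have W1 : W a b e = W a b 1 by rewrite ee.
apply: span_eq => [p|v].
  rewrite !sub_capmx -W1 polytabloid_W /=.
  by apply/andP; split; apply/sub_kermxP; [apply: polytabloid_D | apply: polytabloid_E].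
rewrite !sub_capmx -W1 => /andP[/andP[vW /sub_kermxP vD] /sub_kermxP vE] vb.
have vD2 : v *m D2 = 0.
  have := gl_comm v r0 r1 r1 r2; rewrite vD vE !mul0mx subr0 !rE scale1r scale0r.
  by rewrite subr0.
have v1 p : csum 1 (tcol p) (vat v : X -> F^o) (tab p) = 0.
  by apply: csum_descend => //; rewrite e1 -ee.
(* S is a filling in which the entries of the first column are still in row r0; x is then moved to
   row r1 and y to row r2. *)
pose phi S x y := vat v (upd (upd S x r1) y r2).
have ci0 : (0 < a + b + e)%N by rewrite ee; clear; lia.
have ci1 : (a < a + b + e)%N by rewrite ee; clear; lia.
have ci2 : (a + b < a + b + e)%N by rewrite ee; clear; lia.
have [c0 e0] := cell_ex ci0; have [c1 ec1] := cell_ex ci1; have [c2 ec2] := cell_ex ci2.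
have b0 : (0 < b)%N by rewrite -ee.
have a0 : (0 < a)%N by apply: leq_trans ba.
have rc0 : cell_row c0 = r0 by rewrite ffunE e0 a0.
have rc1 : cell_row c1 = r1 by rewrite ffunE ec1 ltnn -{1}(addn0 a) ltn_add2l b0.
have rc2 : cell_row c2 = r2 by rewrite ffunE ec2 ltnn ltnNge leq_addr.
have col0 c : (cell_col c < 1)%N = (c \in [:: c0; c1; c2]).
  have cl := cell_lt c; rewrite !inE -!(inj_eq val_inj) /= e0 ec1 ec2 /cell_col.
  rewrite ee in cl; clear -cl b0 a0.
  by case: (ltnP c a) => ca; [|case: (ltnP c (a + b)) => cb]; apply/idP/idP; lia.
have three S u x y : uniq [:: u; x; y] ->
    S u = r0 -> S x = r0 -> S y = r0 -> (vdelta F (upd (upd S x r1) y r2) <= W a b e)%MS ->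
    phi S x y - phi S u y - (phi S x u - phi S u x) - (phi S y x - phi S y u) = 0.
  move=> uxy Su Sx Sy SW; set T := upd (upd S x r1) y r2 in SW.
  have [ux uy xy] : [/\ u != x, u != y & x != y].
    by move: uxy; rewrite /= !inE negb_or => /and3P[/andP[-> ->] ->].
  have nxu : (x == u) = false by rewrite eq_sym (negPf ux).
  have nyu : (y == u) = false by rewrite eq_sym (negPf uy).
  have nyx : (y == x) = false by rewrite eq_sym (negPf xy).
  have NE := (@eqxx, negPf ux, negPf uy, negPf xy, nxu, nyu, nyx).
  have Tu : T u = cell_row c0 by rewrite !updE (negPf ux) (negPf uy) Su rc0.
  have Tx : T x = cell_row c1 by rewrite !updE eqxx (negPf xy) rc1.
  have Ty : T y = cell_row c2 by rewrite !updE eqxx rc2.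
  have [p0 eT] : exists p, T = tab p.
    by apply: tab_ex SW _; rewrite vdeltaE eqxx oner_eq0.
  have [p1 [t1 pu1 _]] : exists p', [/\ tab p' = tab p0, p' c0 = u &
      forall c', cell_row c' <> cell_row c0 -> p' c' = p0 c'].
    by apply: tab_move; rewrite -eT.
  have [p2 [t2 px2 k2]] : exists p', [/\ tab p' = tab p1, p' c1 = x &
      forall c', cell_row c' <> cell_row c1 -> p' c' = p1 c'].
    by apply: tab_move; rewrite t1 -eT.
  have [p3 [t3 py3 k3]] : exists p', [/\ tab p' = tab p2, p' c2 = y &
      forall c', cell_row c' <> cell_row c2 -> p' c' = p2 c'].
    by apply: tab_move; rewrite t2 t1 -eT.
  have pu3 : p3 c0 = u.
    rewrite k3 ?k2 // ?rc0 ?rc1 ?rc2 => /eqP; by rewrite rE.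
  have px3 : p3 c1 = x by rewrite k3 // rc1 rc2 => /eqP; rewrite rE.
  have := v1 p3; rewrite (@csum1_three _ _ _ u x y) //; last first.
    move=> t; rewrite /tcol col0 !inE -[t in RHS](permKV p3).
    by rewrite -pu3 -px3 -py3 !(inj_eq perm_inj).
  rewrite t3 t2 t1 -eT.
  have tp i j (S' : X) z : tact (tperm i j) S' z = S' (tperm i j z) by rewrite ffunE tpermV.
  have -> : tact (tperm u x) T = upd (upd S u r1) y r2.
    apply/ffunP => z; rewrite tp /T !updE.
    case: tpermP => [->|->|/eqP/negPf nu /eqP/negPf nx].
    - by rewrite !NE.
    - by rewrite !NE Su Sx.
    - by rewrite nx nu.
  have -> : tact (tperm u y) T = upd (upd S x r1) u r2.
    apply/ffunP => z; rewrite tp /T !updE.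
    case: tpermP => [->|->|/eqP/negPf nu /eqP/negPf ny].
    - by rewrite !NE.
    - by rewrite !NE Su Sy.
    - by rewrite nu ny.
  have -> : tact (tperm x y) T = upd (upd S y r1) x r2.
    apply/ffunP => z; rewrite tp /T !updE.
    case: tpermP => [->|->|/eqP/negPf nu /eqP/negPf ny].
    - by rewrite !NE.
    - by rewrite !NE.
    - by rewrite nu ny.
  have -> : tact (tperm u x) (upd (upd S x r1) u r2) = upd (upd S u r1) x r2.
    apply/ffunP => z; rewrite tp !updE.
    case: tpermP => [->|->|/eqP/negPf nu /eqP/negPf nx].
    - by rewrite !NE.
    - by rewrite !NE.
    - by rewrite nx nu.
  have -> : tact (tperm u x) (upd (upd S y r1) x r2) = upd (upd S y r1) u r2.
    apply/ffunP => z; rewrite tp !updE.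
    case: tpermP => [->|->|/eqP/negPf nu /eqP/negPf nx].
    - by rewrite !NE.
    - by rewrite !NE Su Sx.
    - by rewrite nx nu.
  by [].
have sumD2 S x : \sum_(y | (S y == r0) && (y != x)) phi S x y = 0.
  have := congr1 (fun w => vat w (upd S x r1)) vD2; rewrite vat_gl vat0 => sm; rewrite -[RHS]sm.
  apply: eq_big => // y; rewrite updE; case: (y == x); first by rewrite rE andbF.
  by rewrite andbT.
have sumD S x : \sum_(y | (S y == r0) && (y != x)) phi S y x = 0.
  have := congr1 (fun w => vat w (upd S x r2)) vD; rewrite vat_gl vat0 => sm; rewrite -[RHS]sm.
  apply: eq_big => y; first by rewrite updE; case: (y == x); rewrite ?rE ?andbF ?andbT.
  by move=> /andP[_ yx]; rewrite updC // eq_sym.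
have baseW S x y : (forall c, cnt S c = wt3 r0 r1 r2 a.+2 b.-1 0 c) ->
    S x = r0 -> S y = r0 -> y != x -> (vdelta F (upd (upd S x r1) y r2) <= W a b e)%MS.
  move=> Sc Sx Sy yx; apply/wspP => T; rewrite vdeltaE; case: (eqVneq T) => [->|]; last by rewrite eqxx.
  move=> _ c; have h1 := cnt_upd S x r1 c; have h2 := cnt_upd (upd S x r1) y r2 c.
  move: h2; rewrite updE (negPf yx) Sy => h2; rewrite Sx Sc in h1.
  move: (cnt (upd _ y r2) c) (cnt (upd S x r1) c) h1 h2 => k1 k2; rewrite /wt3 ee.
  case: (eqVneq c r0) => [->|c0']; first by rewrite !rE; clear; lia.
  case: (eqVneq c r1) => [->|c1']; first by rewrite !rE; clear -b0; lia.
  case: (eqVneq c r2) => _; first by clear; lia.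
  by clear; lia.
(* The six-term relation is summed over all y in row r0 other than u and x. Each of the four sums
   that depend on y equals minus a single missing term by [sumD] and [sumD2], and together with the
   N copies of the difference this gives N + 2 times it. *)
have sym S u x : (forall c, cnt S c = wt3 r0 r1 r2 a.+2 b.-1 0 c) ->
    u != x -> S u = r0 -> S x = r0 -> phi S x u = phi S u x.
  move=> Sc ux Su Sx; have xu : x != u by rewrite eq_sym.
  have s1 := sumD2 S x; rewrite (bigD1 u) /= ?Su ?eqxx ?ux // in s1.
  have s2 := sumD2 S u; rewrite (bigD1 x) /= ?Sx ?eqxx ?xu // in s2.
  have s3 := sumD S x; rewrite (bigD1 u) /= ?Su ?eqxx ?ux // in s3.
  have s4 := sumD S u; rewrite (bigD1 x) /= ?Sx ?eqxx ?xu // in s4.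
  pose Q := [pred y | (S y == r0) && (y != x) && (y != u)].
  have eQ : (fun y => (S y == r0) && (y != u) && (y != x)) =1 Q by move=> y /=; rewrite -!andbA (andbC (y != u)).
  rewrite !(eq_bigl _ _ eQ) -/Q in s2 s4; rewrite -/Q in s1 s3.
  have tot : \sum_(y | Q y) (phi S x y - phi S u y - (phi S x u - phi S u x)
      - (phi S y x - phi S y u)) = 0.
    apply: big1 => y /= /andP[/andP[/eqP Sy yx] yu].
    by apply: three => //; [rewrite /= !inE negb_or ux !(eq_sym _ y) yx yu | exact: baseW].
  rewrite !sumrB !sumr_const in tot; set N := #|_| in tot.
  have : (N.+2)%:R * (phi S x u - phi S u x) = 0.
    rewrite -[RHS]oppr0 -[in RHS]tot.
    move: (\sum_(i | Q i) phi S x i) (\sum_(i | Q i) phi S u i) s1 s2.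
    move: (\sum_(i | Q i) phi S i x) (\sum_(i | Q i) phi S i u) s3 s4.
    move=> t1 t2 /eqP; rewrite addrC addr_eq0 => /eqP-> /eqP; rewrite addrC addr_eq0 => /eqP->.
    move=> t3 t4 /eqP; rewrite addrC addr_eq0 => /eqP-> /eqP; rewrite addrC addr_eq0 => /eqP->.
    rewrite -(mulr_natl (phi S x u) N) -(mulr_natl (phi S u x) N).
    by move: (phi S x u) (phi S u x) => f1 f2; clear; ring.
  by move/eqP; rewrite mulf_eq0 (negPf (natF_neq0 _)) subr_eq0 => /eqP.
apply: vatP => T; rewrite vat0; apply/eqP; apply: contraT => nT.
have Tc := (wspP _ _).1 vW T nT.
have [z /eqP Tz] : exists z, T z == r2.
  apply/existsP; apply: contraT; rewrite negb_exists => /forallP none.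
  have := Tc r2; rewrite /wt3 !rE ee /cnt => /eqP; rewrite eq_card0 // => z.
  by rewrite !inE (negPf (none z)).
(* The entry z of row r2 is put into row r1; v E at this filling sums over the choice of the entry
   that goes down instead, and by [sym] all these values equal the one at T. *)
have := congr1 (fun w => vat w (upd T z r1)) vE; rewrite vat_gl vat0.
rewrite (eq_bigr (fun=> vat v T)) => [|y].
  rewrite sumr_const -mulr_natl => /eqP; rewrite mulf_eq0 (negPf nT) orbF.
  set N := #|_|; have N0 : (0 < N)%N.
    by apply/card_gt0P; exists z; rewrite -[_ \in _]/(upd T z r1 z == r1) updE !eqxx.
  by rewrite -(prednK N0) (negPf (natF_neq0 _)).
have [-> _|yz] := eqVneq y z; first by rewrite updK -Tz upd_id.
rewrite updE (negPf yz) => /eqP Ty.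
have zy : z != y by rewrite eq_sym.
pose S := upd (upd T y r0) z r0.
have -> : vat v (upd (upd T z r1) y r2) = phi S z y.
  congr (vat v _); apply/ffunP => t; rewrite !updE.
  by case: (t == y) => //; case: (t == z).
have -> : vat v T = phi S y z.
  congr (vat v _); apply/ffunP => t; rewrite !updE.
  by case: eqP => [->|_] //; case: eqP => [->|].
apply: sym => //; rewrite ?updE ?eqxx // ?(negPf yz) //.
move=> c; have h1 := cnt_upd T y r0 c; have h2 := cnt_upd (upd T y r0) z r0 c.
move: h2; rewrite updE (negPf zy) Tz -/S => h2; rewrite Ty Tc in h1.
move: (cnt S c) (cnt _ c) h1 h2 => k1 k2; rewrite /wt3 ee.
case: (eqVneq c r0) => [->|c0']; first by rewrite !rE; clear; lia.
case: (eqVneq c r1) => [->|c1']; first by rewrite !rE; clear -b0; lia.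
case: (eqVneq c r2) => _; first by clear; lia.
by clear; lia.
Qed.

End SpanDual.

End Tableaux.

(** * Characters of Specht modules as traces on highest weight vectors *)

Section SpechtCharacters.
Variables (F : fieldType) (charF0 : [pchar F] =i pred0) (n : nat) (n2 : (2 <= n)%N).

(** Tabloids take values in the type of row indices ['I_n.+1], so its elements 0, 1, 2, distinct for
    n >= 2, serve as r0, r1, r2. *)
Definition trow0 : 'I_n.+1 := inord 0.
Definition trow1 : 'I_n.+1 := inord 1.
Definition trow2 : 'I_n.+1 := inord 2.

Lemma rows_uniq : uniq [:: trow0; trow1; trow2].
Proof.
by rewrite /= !inE -!(inj_eq val_inj) /= !inordK // ltnS; exact: ltnW.
Qed.

Local Notation H := (ker01 F n trow0 trow1 trow2).
Local Notation K := (hw_space F n trow0 trow1 trow2).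

Section Shape.
Variables (lam : seq nat) (a b e : nat) (n_eq : n = (a + b + e)%N).
Hypotheses (ba : (b <= a)%N) (eb : (e <= b)%N) (e1 : (e <= 1)%N).
Hypothesis rowE : forall j : 'I_n, rowof lam j =
  if (j < a)%N then 0%N else if (j < a + b)%N then 1%N else 2.
Hypothesis colE : forall j : 'I_n, colof lam j = cell_col a b j.

Lemma tablE (p : {perm 'I_n}) : tabl lam p = tab trow0 trow1 trow2 a b p.
Proof.
apply/ffunP => x; rewrite !ffunE rowE.
by case: ifP => // _; case: ifP.
Qed.

(** Columns of index at least b have one cell only, so preserving them means fixing their entry. *)
Lemma colstabE (p : {perm 'I_n}) : colstab lam p = cstab b (tcol a b p).
Proof.
have long (c c' : 'I_n) : (b <= cell_col a b c)%N -> cell_col a b c' = cell_col a b c -> c' = c.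
  have cl := cell_lt n_eq c; have cl' := cell_lt n_eq c'; rewrite /cell_col => bc cc'.
  apply: val_inj => /=; move: bc cc'; clear -cl cl' ba eb e1.
  by case: (ltnP c a); case: (ltnP c (a + b)); case: (ltnP c' a); case: (ltnP c' (a + b)); lia.
apply/setP => q; rewrite [LHS]inE; apply/forallP/cstabP => [qC x | qC x].
  have /eqP := qC x; rewrite !colE -/(tcol a b p x) -/(tcol a b p (q x)).
  by case: ltnP => // bx e0; apply: (@perm_inj _ p^-1%g); apply: long.
rewrite !colE -/(tcol a b p x) -/(tcol a b p (q x)).
by have := qC x; case: ifP => _ ->.
Qed.

Lemma polytabE (p : {perm 'I_n}) : polytab F lam p = polytabloid F trow0 trow1 trow2 a b p.
Proof.
rewrite /polytab /polytabloid /csum colstabE; apply: eq_bigr => q _.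
by congr (_ *: _); rewrite tablE /tab tactM.
Qed.

Lemma specht_row i : row i (specht F lam n) = polytabloid F trow0 trow1 trow2 a b (enum_val i).
Proof. by rewrite rowK polytabE. Qed.

Lemma chiS_H (s : {perm 'I_n}) : e = 0%N ->
  chiS F lam s = trace_on (H a b 0) (tmx F 'I_n.+1 s).
Proof.
move=> e0; apply: trace_on_eqmx.
  apply: (span_H charF0 rows_uniq n_eq ba) => // [i|p].
    by exists (enum_val i); apply: specht_row.
  by exists (enum_rank p); rewrite specht_row enum_rankK.
by apply: stable_H => *; [apply: gl_tmx | apply: stable_wsp].
Qed.

Lemma chiS_K (s : {perm 'I_n}) : e = 1%N ->
  chiS F lam s = trace_on (K a b) (tmx F 'I_n.+1 s).
Proof.
move=> e1'; apply: trace_on_eqmx.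
  apply: (span_K charF0 rows_uniq n_eq ba eb e1) => // [i|p].
    by exists (enum_val i); apply: specht_row.
  by exists (enum_rank p); rewrite specht_row enum_rankK.
by apply: stable_K => *; [apply: gl_tmx | apply: stable_wsp].
Qed.

End Shape.

Lemma chiS_row (s : {perm 'I_n}) :
  chiS F [:: n] s = trace_on (H n 0 0) (tmx F 'I_n.+1 s).
Proof.
apply: (@chiS_H _ n 0 0) => //; first by rewrite !addn0.
all: move=> j; rewrite /colof /rowof /cell_col ltn_ord /= !big_cons !big_nil addn0 addn0.
  by rewrite leqNgt ltn_ord.
by rewrite leqNgt ltn_ord /= big_nil subn0.
Qed.

Lemma chiS_two_rows a b (s : {perm 'I_n}) : n = (a + b)%N -> (b <= a)%N ->
  chiS F [:: a; b] s = trace_on (H a b 0) (tmx F 'I_n.+1 s).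
Proof.
move=> nab ba; apply: (@chiS_H _ a b 0) => //; first by rewrite addn0.
all: move=> j; rewrite /colof /rowof /cell_col /= !big_cons !big_nil !addn0.
all: have jl := ltn_ord j; rewrite [X in (_ < X)%N]nab in jl.
all: have -> : (a + b <= j)%N = false by apply/negbTE; rewrite -ltnNge.
all: rewrite jl leqNgt; case: (ltnP j a) => ja //=.
  by rewrite big_nil subn0.
by rewrite big_cons big_nil addn0.
Qed.

Lemma chiS_three_rows a b (s : {perm 'I_n}) : n = (a + b + 1)%N -> (b <= a)%N ->
  (0 < b)%N -> chiS F [:: a; b; 1%N] s = trace_on (K a b) (tmx F 'I_n.+1 s).
Proof.
move=> nab ba b0; apply: (@chiS_K _ a b 1) => //.
all: move=> j; rewrite /colof /rowof /cell_col /= !big_cons !big_nil !addn0 !addnA.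
all: have jl := ltn_ord j; rewrite [X in (_ < X)%N]nab in jl.
all: have -> : (a + b + 1 <= j)%N = false by apply/negbTE; rewrite -ltnNge.
all: rewrite !(leqNgt _ j); case: (ltnP j a) => ja /=.
- by rewrite (leq_trans ja) ?leq_addr.
- by case: ltnP.
- by rewrite (leq_trans ja) ?leq_addr //= big_nil subn0.
case: ltnP => jb /=; first by rewrite big_cons big_nil addn0.
by rewrite !big_cons big_nil addn0.
Qed.

End SpechtCharacters.

(** * The filtration of multilinear words by keys *)

Lemma mulmx_basis (F : fieldType) (X : finType) (P : pred X) m (A B : 'M[F]_(#|{: X}|, m)) (u : 'rV_#|{: X}|) :
  (forall T, P T -> vdelta F T *m A = vdelta F T *m B) ->
  (u <= coordmx F P)%MS -> u *m A = u *m B.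
Proof.
move=> AB /sub_coordmx uP; rewrite [u]vat_basis !mulmx_suml; apply: eq_bigr => T _.
have [->|/uP PT] := eqVneq (vat u T) 0; first by rewrite !scale0r !mul0mx.
by rewrite -!scalemxAl AB.
Qed.

Definition fmx (F : fieldType) (X Y : finType) (f : X -> Y) : 'M[F]_(#|{: X}|, #|{: Y}|) :=
  kerop (fun T S => (f T == S)%:R).

Lemma vdelta_fmx (F : fieldType) (X Y : finType) (f : X -> Y) T :
  vdelta F T *m fmx F f = vdelta F (f T).
Proof. by apply: vatP => S; rewrite vdelta_kerop vdeltaE eq_sym. Qed.

Section Filtration.
Variables (F : fieldType) (charF0 : [pchar F] =i pred0) (n : nat) (R : finType).
Variables (r0 r1 r2 : R) (r_uniq : uniq [:: r0; r1; r2]) (w : {perm 'I_n}).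
Local Notation X := {ffun 'I_n -> R}.
Local Notation D2 := (gl F n r0 r2).
Local Notation E := (gl F n r1 r2).
Local Notation W := (weight_space F n r0 r1 r2).
Local Notation Z := (ker02 F n r0 r1 r2).
Let rE := rows_neqE r_uniq.

(* The letters of a word of length n after (r1), at (r2) and before (r0) the
   position which is followed by exactly j letters; [tailp j] forgets r2. *)
Definition markp j : X := [ffun c : 'I_n =>
  if (c + j.+1 == n)%N then r2 else if (n <= c + j)%N then r1 else r0].
Definition tailp j : X := [ffun c : 'I_n => if (n <= c + j)%N then r1 else r0].

Lemma markpE j (c : 'I_n) : (c + j.+1)%N = n -> markp j = upd (tailp j) c r2.
Proof.
move=> cj; apply/ffunP => y; rewrite updE !ffunE.
have -> // : (y + j.+1 == n)%N = (y == c).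
by rewrite -(inj_eq val_inj) /=; apply/eqP/eqP; clear -cj; lia.
Qed.

Lemma mark_pos j : (j < n)%N -> exists c : 'I_n, (c + j.+1)%N = n.
Proof.
move=> jn; have cn : (n - j.+1 < n)%N by clear -jn; lia.
by exists (Ordinal cn) => /=; rewrite subnK.
Qed.

Lemma vdelta_mark_gl j a : (j < n)%N -> a \in [:: r0; r1] ->
  exists2 c : 'I_n, (c + j.+1)%N = n &
  vdelta F (markp j) *m gl F n a r2 = vdelta F (upd (tailp j) c a).
Proof.
move=> jn a01; have [c cj] := mark_pos jn; exists c => //.
apply: vatP => S; rewrite vat_gl vdeltaE (markpE cj).
have tn (y : 'I_n) : (tailp j y == r2) = false by rewrite ffunE; case: ifP; rewrite rE.
have an : (a == r2) = false by move: a01; rewrite !inE => /orP[]/eqP->; rewrite rE.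
case: eqP => [->|nS].
  rewrite (bigD1 c) ?updE ?eqxx //= updK vdeltaE eqxx big1 ?addr0 // => y /andP[_ yc].
  rewrite vdeltaE; case: eqP => // /ffunP/(_ y); rewrite !updE eqxx (negPf yc) => /esym/eqP.
  by rewrite tn.
apply: big1 => y /eqP Sy; rewrite vdeltaE; case: eqP => // e; case: nS.
have yc : y = c.
  apply/eqP; have := congr1 (fun f : X => f y) e; rewrite !updE eqxx; case: (y == c) => //.
  by move/esym/eqP; rewrite tn.
by rewrite -[S](upd_id S c) -yc Sy -(updK S y r2) e yc updK.
Qed.

Lemma mark_D2 j : (j < n)%N -> vdelta F (markp j) *m D2 = vdelta F (tailp j).
Proof.
move=> jn; have [|c cj ->] := vdelta_mark_gl (a := r0) jn; first by rewrite !inE eqxx.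
congr vdelta; rewrite -[RHS](upd_id _ c); congr upd.
by rewrite ffunE ifF //; clear -cj; lia.
Qed.

Lemma mark_E j : (j < n)%N -> vdelta F (markp j) *m E = vdelta F (tailp j.+1).
Proof.
move=> jn; have [|c cj ->] := vdelta_mark_gl (a := r1) jn; first by rewrite !inE eqxx orbT.
congr vdelta; apply/ffunP => y; rewrite updE !ffunE.
case: eqP => [->|/eqP yc]; first by rewrite cj leqnn.
have ync : (y : nat) <> c by apply/eqP; rewrite (inj_eq val_inj).
by congr (if _ then _ else _); clear -cj ync; lia.
Qed.

Lemma markp_wt j c : (j < n)%N -> cnt (markp j) c = wt3 r0 r1 r2 (n - j.+1) j 1 c.
Proof.
move=> jn; rewrite /cnt /wt3; case: (eqVneq c r0) => [->|c0].
  rewrite -[RHS]subn0 -(@card_interval n 0) ?leq_subr //.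
  apply: eq_card => x; rewrite !inE ffunE leq0n /=.
  case: ((x + j.+1)%N =P n) => [e|ne]; first by rewrite rE; apply/esym; clear -e jn; lia.
  by case: (leqP n (x + j)) => h; rewrite ?rE ?eqxx; apply/esym; clear -ne h jn; lia.
case: (eqVneq c r1) => [->|c1].
  rewrite -[RHS](subKn (ltnW jn)) -(@card_interval n (n - j)) //.
  apply: eq_card => x; rewrite !inE ffunE ltn_ord andbT.
  case: ((x + j.+1)%N =P n) => [e|ne]; first by rewrite rE; apply/esym; clear -e jn; lia.
  by case: (leqP n (x + j)) => h; rewrite ?rE ?eqxx; apply/esym; clear -ne h jn; lia.
case: (eqVneq c r2) => [->|c2].
  have [y yj] := mark_pos jn; apply/eqP/card1P; exists y => x; rewrite !inE.
  by rewrite (markpE yj) updE; case: (x == y); rewrite ?eqxx // ffunE; case: ifP; rewrite rE.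
apply: eq_card0 => x; rewrite !inE ffunE.
by case: ifP => _; last case: ifP => _; rewrite eq_sym ?(negPf c0) ?(negPf c1) ?(negPf c2).
Qed.

Definition word0 (p : Mon n) : bool := p.2 == [ffun => false].

(** An even word labels each variable by the value of T at its position; words with an odd letter go
    to 0. The permutation w of positions is the identity for A_k and the reversal for B_k. *)
Definition place (T : X) : 'M[F]_(Nmon n, #|{: X}|) :=
  kerop (fun (p : Mon n) S => (word0 p && (tact (w * p.1)%g T == S))%:R).
Definition Psi j := place (markp j).
Definition Bsi j := place (tailp j).

Lemma vdelta_place (p : Mon n) T :
  vdelta F p *m place T = if word0 p then vdelta F (tact (w * p.1)%g T) else 0.
Proof.
apply: vatP => S; rewrite vdelta_kerop; case: (word0 p) => /=; last by rewrite vat0.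
by rewrite vdeltaE eq_sym.
Qed.

Lemma eq_rows_basis m (A B : 'M[F]_(Nmon n, m)) :
  (forall p : Mon n, vdelta F p *m A = vdelta F p *m B) -> A = B.
Proof.
move=> AB; apply/row_matrixP => i; rewrite !rowE.
apply: (@mulmx_basis F (Mon n) predT); first by move=> T _; apply: AB.
by apply/sub_coordmx.
Qed.

Lemma vdelta_tact_gl s T a b :
  vdelta F (tact s T) *m gl F n a b = vdelta F T *m gl F n a b *m tmx F R s.
Proof. by rewrite -vdelta_tmx -[LHS]mulmxA -[RHS]mulmxA gl_tmx. Qed.

Lemma place_gl T S a b : vdelta F T *m gl F n a b = vdelta F S ->
  place T *m gl F n a b = place S.
Proof.
move=> TS; apply: eq_rows_basis => p; rewrite mulmxA !vdelta_place.
by case: ifP; rewrite ?mul0mx // vdelta_tact_gl TS vdelta_tmx.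
Qed.

Lemma Psi_D2 j : (j < n)%N -> Psi j *m D2 = Bsi j.
Proof. by move=> jn; apply: place_gl (mark_D2 jn). Qed.
Lemma Psi_E j : (j < n)%N -> Psi j *m E = Bsi j.+1.
Proof. by move=> jn; apply: place_gl (mark_E jn). Qed.

(** The base is the condition on the content: all multilinear words in even variables have the same
    content, and [Bsi 0] adds up their coefficients. *)
Fixpoint kerPsi j : 'M[F]_(Nmon n) :=
  if j is j'.+1 then (kerPsi j' :&: kermx (Psi j'))%MS else kermx (Bsi 0).

Lemma sub_kerPsi j (v : 'rV_(Nmon n)) : (v <= kerPsi j)%MS <->
  v *m Bsi 0 = 0 /\ forall i, (i < j)%N -> v *m Psi i = 0.
Proof.
elim: j => [|j IHj] /=; first by split=> [/sub_kermxP //|[/sub_kermxP]].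
rewrite sub_capmx; split=> [/andP[/IHj[v0 vi] /sub_kermxP vj]|[v0 vi]].
  by split=> // i; rewrite ltnS leq_eqVlt => /orP[/eqP->|/vi].
apply/andP; split; last by apply/sub_kermxP/vi.
by apply/IHj; split=> // i ij; apply: vi; apply: ltnW.
Qed.

Lemma kerPsi_Bsi j (v : 'rV_(Nmon n)) : (j <= n)%N -> (v <= kerPsi j)%MS -> v *m Bsi j = 0.
Proof.
case: j => [_ /sub_kerPsi[]//|j jn /sub_kerPsi[_ vi]].
by rewrite -Psi_E // mulmxA vi ?mul0mx.
Qed.

Lemma tailp_wt j c : (j < n)%N -> cnt (tailp j) c = wt3 r0 r1 r2 (n - j) j 0 c.
Proof.
move=> jn; have [x xj] := mark_pos jn.
have := cnt_upd (tailp j) x r2 c; rewrite -(markpE xj) markp_wt //.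
have -> : tailp j x = r0 by rewrite ffunE ifF //; clear -xj; lia.
rewrite /wt3.
case: (eqVneq c r0) => [->|c0]; first by rewrite !rE; clear -jn; lia.
case: (eqVneq c r1) => [->|c1]; first by rewrite !rE; clear; lia.
by case: (eqVneq c r2) => c2; clear; lia.
Qed.

Lemma Psi_W j (v : 'rV_(Nmon n)) : (j < n)%N -> (v *m Psi j <= W (n - j.+1) j 1)%MS.
Proof.
move=> jn; apply/wspP => T; rewrite kerop_mul => nz c.
rewrite -markp_wt //.
have [p /andP[_ /eqP <-]|none] := pickP (fun p : Mon n => word0 p && (tact (w * p.1)%g (markp j) == T)).
  by rewrite cnt_tact.
by case/eqP: nz; apply: big1 => p _; rewrite none mulr0.
Qed.

Definition erase2 (T : X) : X := [ffun x => if T x == r2 then r0 else T x].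

Lemma erase2_unique (T : X) x : (forall y, (T y == r2) = (y == x)) -> erase2 T = upd T x r0.
Proof. by move=> Tx; apply/ffunP => y; rewrite updE ffunE Tx. Qed.

Lemma unique_r2 i j (T : X) : (forall c, cnt T c = wt3 r0 r1 r2 i j 1 c) ->
  exists x, forall y, (T y == r2) = (y == x).
Proof.
move=> Tc; have := Tc r2; rewrite /wt3 !rE => /eqP/card1P[x Tx].
by exists x => y; have := Tx y; rewrite !inE.
Qed.

(** Erasing the mark turns [Psi j] into [Bsi j], which vanishes on [kerPsi j]; so the image lies in
    the kernel of D2. Conversely each marked filling is lifted to a word in such a way that all
    earlier conditions see only the filling with its mark erased, and over each such filling the
    coefficients of a vector in the kernel of D2 add up to zero. *)
Lemma kerPsi_Psi j : (j < n)%N -> (kerPsi j *m Psi j :=: Z (n - j.+1) j)%MS.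
Proof.
move=> jn; apply/eqmxP/andP; split.
  apply: sub_mulmx_rows => v vN; rewrite sub_capmx Psi_W //=.
  by apply/sub_kermxP; rewrite -mulmxA Psi_D2 // kerPsi_Bsi // ltnW.
apply/row_subP => l; set u := row l _.
have : (u <= Z (n - j.+1) j)%MS by apply: row_sub.
rewrite sub_capmx => /andP[uW /sub_kermxP uD2].
have [c cj] := mark_pos jn.
(* [pi] depends only on the filling with its mark erased. The two positions exchanged by [pt],
   namely c and that of the marked variable, both lie in the segment labelled r0 by [tailp j], so
   the exchange is seen by the mark with suffix length j and by none with a shorter suffix. *)
pose pi (S : X) : {perm 'I_n} := odflt 1%g [pick p : {perm 'I_n} | tact p (tailp j) == S].
pose pt (T : X) := (tperm c ((pi (erase2 T))^-1 (odflt c [pick x | T x == r2]))%g * pi (erase2 T))%g.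
pose g (T : X) : Mon n := ((w^-1 * pt T)%g, [ffun => false]).
have uE : u *m fmx F erase2 = 0.
  rewrite -uD2; apply: mulmx_basis uW => T /forallP Tw.
  have [|x Tx] := @unique_r2 (n - j.+1) j T; first by move=> d; apply/eqP.
  rewrite vdelta_fmx vdelta_gl (eq_bigl (pred1 x)) ?big_pred1_eq; last by move=> y /=.
  by rewrite (erase2_unique Tx).
have ptP T : (forall d, cnt T d = wt3 r0 r1 r2 (n - j.+1) j 1 d) ->
  exists c' : 'I_n, [/\ pt T = (tperm c c' * pi (erase2 T))%g,
    (c' + j < n)%N & T = tact (pi (erase2 T)) (upd (tailp j) c' r2)].
  move=> Tw; have [x Tx] := unique_r2 Tw.
  have eS := erase2_unique Tx; set S := erase2 T in eS *.
  have piS : tact (pi S) (tailp j) = S.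
    rewrite /pi; case: pickP => [p /eqP //|none].
    have [d|p eSp] := @perm_of_cnt n R (tailp j) S; last by have := none p; rewrite -eSp eqxx.
    rewrite tailp_wt // eS; have := cnt_upd T x r0 d; rewrite Tw.
    have /eqP -> : T x == r2 by rewrite Tx.
    rewrite /wt3; move: (cnt _ d) => k.
    case: (eqVneq d r0) => [->|d0]; first by rewrite !rE; clear -jn; lia.
    case: (eqVneq d r1) => [->|d1]; first by rewrite !rE; clear; lia.
    by case: (eqVneq d r2) => d2; clear; lia.
  exists ((pi S)^-1 x)%g; split.
  - rewrite /pt -/S; case: pickP => [y|/(_ x)]; last by rewrite Tx eqxx.
    by rewrite Tx => /eqP->.
  - have : S x = r0 by rewrite eS updE eqxx.
    by rewrite -{1}piS ffunE ffunE; case: leqP => // _ /eqP; rewrite rE.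
  - rewrite -upd_tact piS eS updK; have /eqP <- : T x == r2 by rewrite Tx.
    by rewrite upd_id.
have gPsi T U : vdelta F (g T) *m place U = vdelta F (tact (pt T) U).
  by rewrite vdelta_place /word0 /= eqxx mulKVg.
have same (U : X) (c1 c2 : 'I_n) : U c1 = U c2 -> tact (tperm c1 c2) U = U.
  by move=> e; apply/ffunP => y; rewrite ffunE tpermV; case: tpermP => [->|->|].
(* When U is r0 on these positions, the image of T depends on [erase2 T] alone, and the push-forward
   of u along [erase2] is u D2 = 0. *)
have low (U : X) : (forall c' : 'I_n, (c' + j < n)%N -> U c' = r0) ->
    u *m fmx F g *m place U = 0.
  move=> Ulow; transitivity (u *m (fmx F erase2 *m fmx F (fun S => tact (pi S) U))).
    rewrite -mulmxA; apply: mulmx_basis uW => T /forallP Tw.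
    have [|c' [e c'j _]] := ptP T; first by move=> d; apply/eqP.
    rewrite !mulmxA !vdelta_fmx gPsi e -tactM (same U) // !Ulow //.
    by clear -cj; lia.
  by rewrite mulmxA uE mul0mx.
have -> : u = u *m fmx F g *m Psi j.
  rewrite -[LHS]mulmx1 -mulmxA; apply: mulmx_basis uW => T /forallP Tw.
  rewrite mulmx1 mulmxA vdelta_fmx gPsi.
  have [|c' [e c'j eT]] := ptP T; first by move=> d; apply/eqP.
  rewrite e -tactM {1}eT; congr (vdelta F (tact _ _)).
  have tc : tailp j c = r0 by rewrite ffunE ifF //; clear -cj; lia.
  have tc' : tailp j c' = r0 by rewrite ffunE ifF //; clear -c'j; lia.
  apply/ffunP => y; rewrite [RHS]ffunE tpermV (markpE cj) !updE.
  case: tpermP => [->|->|/eqP/negPf yc /eqP/negPf yc'].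
  - by rewrite tc tc' eq_sym.
  - by rewrite !eqxx.
  - by rewrite yc yc'.
apply: submxMr; apply/sub_kerPsi; split; first apply: low.
  by move=> c' _; rewrite ffunE addn0 leqNgt ltn_ord.
move=> i ij; apply: low => c' c'j; rewrite ffunE !ifF //; clear -c'j ij; lia.
Qed.

Lemma Bsi0_W : (0 < n)%N -> (Bsi 0 :=: W n 0 0)%MS.
Proof.
move=> n0; apply/eqmxP/andP; split.
  rewrite -[Bsi 0]mul1mx; apply: sub_mulmx_rows => v _; apply/wspP => T.
  rewrite kerop_mul => nz c; have := tailp_wt c n0; rewrite subn0 => <-.
  have [p /andP[_ /eqP <-]|none] := pickP (fun p : Mon n => word0 p && (tact (w * p.1)%g (tailp 0) == T)).
    by rewrite cnt_tact.
  by case/eqP: nz; apply: big1 => p _; rewrite none mulr0.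
apply/row_subP => l; set u := row l _.
have uW : (u <= W n 0 0)%MS by apply: row_sub.
rewrite [u]vat_basis; apply: summx_sub => T _.
have [->|/((wspP _ _).1 uW) Tw] := eqVneq (vat u T) 0; first by rewrite scale0r sub0mx.
have [c|p ->] := @perm_of_cnt n R (tailp 0) T; first by rewrite tailp_wt // subn0 Tw.
apply: scalemx_sub.
have -> : vdelta F (tact p (tailp 0)) = vdelta F ((w^-1 * p)%g, [ffun => false] : {ffun 'I_n -> bool}) *m Bsi 0.
  by rewrite vdelta_place /word0 /= eqxx mulKVg.
exact: submxMl.
Qed.

Section TraceFormula.
Variables (M : 'M[F]_(Nmon n)) (M' : 'M[F]_#|{: X}|).
Hypothesis (place_M : forall T, M *m place T = place T *m M').
Hypothesis (gl_M' : forall a b, gl F n a b *m M' = M' *m gl F n a b).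
Hypothesis (stM' : forall wt, stable_mx (wsp F n wt) M').

Lemma stable_kerPsi k : stable_mx (kerPsi k) M.
Proof.
elim: k => [|k IHk] /=; first exact: stable_kermx (place_M _).
by apply: stable_capmx => //; apply: stable_kermx (place_M _).
Qed.

(** The trace on the quotient by [kerPsi k]: each further condition removes a space isomorphic,
    compatibly with the operators, to the kernel of D2 on one weight space, and D2 is onto. *)
Lemma trace_kerPsi k : (0 < n)%N -> (k <= n)%N ->
  \tr M - trace_on (kerPsi k) M = trace_on (W n 0 0) M' +
    \sum_(j < k) (trace_on (W (n - j.+1) j 1) M' - trace_on (W (n - j) j 0) M').
Proof.
move=> n0; elim: k => [_|k IHk kn].
  rewrite big_ord0 addr0 -trace_on_full.
  have st1 : stable_mx (1%:M : 'M[F]_(Nmon n)) M by apply: submx1.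
  rewrite (trace_on_exact (place_M (tailp 0)) st1) mul1mx.
  rewrite (trace_on_eqmx (Bsi0_W n0) (stM' _)).
  have e : (1%:M :&: kermx (Bsi 0) :=: kerPsi 0)%MS by apply/eqmxP; rewrite capmxSr sub_capmx submx1 submx_refl.
  by rewrite (trace_on_eqmx e (stable_kerPsi 0)) [X in X - _]addrC addrK.
rewrite big_ord_recr /= addrA -IHk 1?ltnW //.
rewrite [trace_on (kerPsi k) M](trace_on_exact (place_M (markp k)) (stable_kerPsi k)).
rewrite (trace_on_eqmx (kerPsi_Psi kn)); last by apply: stable_Z.
rewrite (tau_Z charF0 r_uniq gl_M' stM') -subSn // subSS.
by rewrite -/(Psi k); ring.
Qed.

End TraceFormula.

Lemma cnt_pos (T : X) x : (0 < cnt T (T x))%N.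
Proof. by apply/card_gt0P; exists x; rewrite inE. Qed.

Lemma cnt_set (T : X) c : cnt T c = #|[set x | T x == c]|.
Proof. by apply: eq_card => x; rewrite !inE. Qed.

Definition settab (A : {set 'I_n}) : X := [ffun x => if x \in A then r1 else r0].

Lemma settab_inj : injective settab.
Proof.
move=> A B /ffunP AB; apply/setP => x; have := AB x; rewrite !ffunE.
by case: ifP => xA; case: ifP => xB // /eqP; rewrite rE.
Qed.

Lemma settab_wt A c : cnt (settab A) c = wt3 r0 r1 r2 (n - #|A|) #|A| 0 c.
Proof.
rewrite /wt3 cnt_set; case: (eqVneq c r0) => [->|c0].
  have <- : #|~: A| = (n - #|A|)%N by rewrite cardsCs setCK card_ord.
  by apply: eq_card => x; rewrite !inE ffunE; case: ifP; rewrite ?rE ?eqxx.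
case: (eqVneq c r1) => [->|c1].
  by apply: eq_card => x; rewrite !inE ffunE; case: ifP; rewrite ?rE ?eqxx.
rewrite if_same; apply: eq_card0 => x; rewrite !inE ffunE.
by case: ifP => _; rewrite eq_sym ?(negPf c0) ?(negPf c1).
Qed.

Lemma rank_W0 j : \rank (W (n - j) j 0) = 'C(n, j).
Proof.
rewrite rank_coordmx -[in RHS](card_ord n) -card_draws.
rewrite -(card_imset _ settab_inj); apply: eq_card => T; apply/forallP/imsetP => [Tw|[A]].
  have {}Tw c := eqP (Tw c); exists [set x | T x == r1].
    by rewrite inE -cnt_set Tw /wt3 !rE.
  apply/ffunP => x; rewrite ffunE inE; have := cnt_pos T x; rewrite Tw /wt3.
  by case: (T x =P r0) => [->|_]; [rewrite rE | case: (T x =P r1) => [->|_]; rewrite ?if_same].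
by rewrite inE => /eqP <- -> c; rewrite settab_wt.
Qed.

Lemma rank_W1 j : \rank (W (n - j.+1) j 1) = ('C(n, j) * (n - j))%N.
Proof.
rewrite rank_coordmx -[X in 'C(X, j)](card_ord n) -card_draws.
pose P := [set Ax : {set 'I_n} * 'I_n | (#|Ax.1| == j) && (Ax.2 \notin Ax.1)].
have -> : (#|[set A : {set 'I_n} | #|A| == j]| * (n - j) = #|P|)%N.
  rewrite -sum_nat_const -[RHS]sum1_card (partition_big fst (fun A : {set 'I_n} => #|A| == j)) /=; last first.
    by move=> Ax; rewrite inE => /andP[].
  under [LHS]eq_bigl => A do rewrite inE.
  apply: eq_bigr => A /eqP Aj.
  have <- : #|~: A| = (n - j)%N by rewrite cardsCs setCK card_ord Aj.
  have inj : {in ~: A &, injective (fun x => (A, x))} by move=> x y _ _ [].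
  rewrite -(card_in_imset inj) -sum1_card; apply: eq_bigl => -[B x].
  rewrite [in RHS]inE /=; apply/imsetP/andP => [[y yA [-> ->]]|[/andP[_ xB] /eqP <-]].
    by rewrite inE in yA; split; rewrite ?Aj ?eqxx.
  by exists x; rewrite ?inE.
pose f (Ax : {set 'I_n} * 'I_n) : X := upd (settab Ax.1) Ax.2 r2.
have finj : {in P &, injective f}.
  move=> [A x] [B y]; rewrite !inE /= => /andP[_ xA] /andP[_ yB] /ffunP AB.
  have xy : x = y.
    have := AB x; rewrite /f /= !updE eqxx ffunE; case: eqP => // _.
    by case: ifP => _ /eqP; rewrite rE.
  congr pair => //; apply/setP => z; have := AB z; rewrite /f /= xy !updE !ffunE.
  case: eqP => [-> _|_]; first by rewrite (negPf yB) -xy (negPf xA).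
  by case: ifP => zA; case: ifP => zB // /eqP; rewrite rE.
rewrite -(card_in_imset finj); apply: eq_card => T; apply/forallP/imsetP => [Tw|[[A x]]].
  have {}Tw c := eqP (Tw c); have [x Tx] := unique_r2 Tw.
  exists ([set y | T y == r1], x).
    rewrite !inE /= -cnt_set Tw /wt3 !rE /=.
    have /eqP -> : T x == r2 by rewrite Tx.
    by rewrite rE.
  apply/ffunP => y; rewrite updE ffunE inE /=; have := Tx y.
  case: (y =P x) => [_ /eqP //|_ ny]; have := cnt_pos T y; rewrite Tw /wt3 ny.
  by case: (T y =P r0) => [->|_]; [rewrite rE | case: (T y =P r1) => [->|_]].
rewrite inE /= => /andP[/eqP <- xA] -> c; have := cnt_upd (settab A) x r2 c.
rewrite settab_wt ffunE (negPf xA) /f /= /wt3.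
have : (0 < n - #|A|)%N.
  have <- : #|~: A| = (n - #|A|)%N by rewrite cardsCs setCK card_ord.
  by apply/card_gt0P; exists x; rewrite inE.
move: (cnt _ c) #|A| => k m nm.
case: (eqVneq c r0) => [->|c0]; first by rewrite !rE => h; apply/eqP; clear -nm h; lia.
case: (eqVneq c r1) => [->|c1]; first by rewrite !rE => h; apply/eqP; clear -nm h; lia.
by case: (eqVneq c r2) => c2 h; apply/eqP; clear -h; lia.
Qed.

(** This is the trace formula for the identity operator, with summand C(n, j) (n - j) - C(n, j);
    characteristic zero brings the equality in F back to natural numbers. *)
Lemma rank_kerPsi k : (0 < n)%N -> (k <= n)%N ->
  (Nmon n - \rank (kerPsi k) = 1 + \sum_(0 <= i < k) 'C(n, i) * (n - i - 1))%N.
Proof.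
move=> n0 kn.
have pl T : 1%:M *m place T = place T *m 1%:M by rewrite mulmx1 mul1mx.
have gl1 (a b : R) : gl F n a b *m 1%:M = 1%:M *m gl F n a b by rewrite mulmx1 mul1mx.
have st (wt : R -> nat) : stable_mx (wsp F n wt) 1%:M by rewrite /stable_mx mulmx1.
have := trace_kerPsi pl gl1 st n0 kn; rewrite mxtrace1 !trace_on_id.
have := rank_W0 0; rewrite subn0 bin0 => ->.
rewrite (eq_bigr (fun j : 'I_k => ('C(n, j) * (n - j - 1))%:R)) => [|j _]; last first.
  have jn : (0 < n - j)%N by rewrite subn_gt0 (leq_trans (ltn_ord j)).
  by rewrite !trace_on_id rank_W1 rank_W0 subn1 -{1}(prednK jn) mulnS natrD addrAC subrr add0r.
rewrite -natr_sum -(big_mkord xpredT (fun j => 'C(n, j) * (n - j - 1))%N).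
rewrite -natrB ?rank_leq_row // -natrD => e.
have inj (a b : nat) : (a%:R : F) = b%:R -> (a <= b)%N.
  move=> ab; rewrite leqNgt; apply/negP => ba.
  have := (pcharf0P F).1 charF0 (a - b)%N; rewrite natrB ?(ltnW ba) // ab subrr eqxx.
  by move/esym; rewrite subn_eq0 leqNgt ba.
by apply/eqP; rewrite eqn_leq !inj.
Qed.

End Filtration.

Lemma weighted_sumS (V : pzRingType) (f : nat -> V) m :
  \sum_(0 <= i < m.+1) (m.+1 - i)%:R * f i =
  \sum_(0 <= i < m) (m - i)%:R * f i + \sum_(0 <= i < m.+1) f i.
Proof.
rewrite [X in _ = X + _](_ : _ = \sum_(0 <= i < m.+1) (m - i)%:R * f i); last first.
  by rewrite [RHS]big_nat_recr //= subnn mul0r addr0.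
rewrite -big_split /=; apply: eq_big_nat => i; rewrite ltnS => im.
by rewrite subSn // -addn1 natrD mulrDl mul1r.
Qed.

(** Raising m by one adds to each weighted sum the corresponding unweighted one, by [weighted_sumS],
    and the unweighted sums telescope. The relation x_0 = y_1 absorbs the boundary terms. *)
Lemma double_telescope (V : comPzRingType) (x y : nat -> V) m : x 0%N = y 1%N ->
  \sum_(j < m) (x j - y j) =
  \sum_(1 <= i < m.+1) (m.+1 - i)%:R * (y i - y i.-1) +
  \sum_(1 <= i < m) (m - i)%:R * (x i - x i.-1 - y i.+1 + y i.-1).
Proof.
move=> xy; rewrite !big_add1 /=.
transitivity (\sum_(0 <= i < m) (m - i)%:R * (y i.+1 - y i) +
    \sum_(0 <= i < m.-1) (m.-1 - i)%:R * (x i.+1 - x i - y i.+2 + y i)); last first.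
  congr (_ + _); apply: eq_big_nat => i _.
  by have -> : (m - i.+1 = m.-1 - i)%N by clear; lia.
elim: m => [|[|m] IHm]; first by rewrite big_ord0 !big_nil addr0.
  by rewrite big_ord1 big_nat1 big_nil addr0 subn0 mul1r xy.
have wy := weighted_sumS (fun i => y i.+1 - y i) m.+1.
have wx := weighted_sumS (fun i => x i.+1 - x i - y i.+2 + y i) m.
rewrite big_ord_recr {}IHm /= {}wy {}wx telescope_sumr //.
have -> : \sum_(0 <= i < m.+1) (x i.+1 - x i - y i.+2 + y i) =
    (x m.+1 - x 0%N) - (y m.+2 - y 1%N) - (y m.+1 - y 0%N).
  rewrite -(telescope_sumr x) // -(telescope_sumr (fun i => y i.+1)) //.
  rewrite -(telescope_sumr y) // -!sumrB; apply: eq_bigr => i _; ring.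
by rewrite xy; ring.
Qed.

Section CharacterSum.
Variables (F : fieldType) (charF0 : [pchar F] =i pred0) (n : nat) (n2 : (2 <= n)%N).
Local Notation W := (weight_space F n (trow0 n) (trow1 n) (trow2 n)).
Local Notation H := (ker01 F n (trow0 n) (trow1 n) (trow2 n)).
Variable s : {perm 'I_n}.
Local Notation M := (tmx F 'I_n.+1 s).
Let r_uniq := rows_uniq n2.

Lemma specht_sum m : (2 * m <= n)%N ->
  trace_on (W n 0 0) M +
    \sum_(j < m) (trace_on (W (n - j.+1) j 1) M - trace_on (W (n - j) j 0) M) =
  chiS F [:: n] s
    + \sum_(1 <= i < m.+1) (m.+1 - i)%:R * chiS F [:: (n - i)%N; i] s
    + \sum_(1 <= i < m) (m - i)%:R * chiS F [:: (n - i - 1)%N; i; 1%N] s.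
Proof.
move=> mn; have glM a b : gl F n a b *m M = M *m gl F n a b by apply: gl_tmx.
have stM w : stable_mx (wsp F n w) M by apply: stable_wsp.
pose x j := trace_on (W (n - j.+1) j 1) M; pose y j := trace_on (W (n - j) j 0) M.
rewrite -addrA; congr (_ + _).
  rewrite (chiS_row charF0 n2); apply: esym; apply: trace_on_eqmx; last exact: stM.
  apply/eqmxP; rewrite capmxSl sub_capmx submx_refl /=.
  apply/sub_kermxP/row_matrixP => i; rewrite row_mul row0.
  apply: (@gl_wsp0 _ _ _ _ _ (wt3 (trow0 n) (trow1 n) (trow2 n) n 0 0)); last exact: row_sub.
  by rewrite /wt3 !(rows_neqE r_uniq).
have xy : x 0%N = y 1%N by apply: tau_W01.
rewrite (double_telescope m xy); congr (_ + _); apply: eq_big_nat => i /andP[i0 im].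
  congr (_ * _); rewrite (chiS_two_rows charF0 n2); first last.
  - by clear -mn im; lia.
  - by clear -mn im; lia.
  case: i i0 im => // i _ im; rewrite (tau_H charF0 r_uniq glM stM); last by clear -mn im; lia.
  have e3 : ((n - i.+1).+1 = n - i)%N by clear -mn im; lia.
  by rewrite /y /= e3.
congr (_ * _); rewrite (chiS_three_rows charF0 n2) //; first last.
- by clear -mn im; lia.
- by clear -mn im; lia.
case: i i0 im => // i _ im; rewrite (tau_K charF0 r_uniq glM stM); last by clear -mn im; lia.
have e1 : (n - i.+1 - 1 = n - i.+2)%N by clear; lia.
have e2 : ((n - i.+2).+1 = n - i.+1)%N by clear -mn im; lia.
have e3 : ((n - i.+1).+1 = n - i)%N by clear -mn im; lia.
by rewrite /x /y /= e1 e2 e3.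
Qed.

End CharacterSum.

(** * The free algebra and its T-ideals *)

Section FreeAlgebra.
Variable F : fieldType.
Implicit Types (f g : FA F) (s t : seq Var) (c : F).

Definition w2f s : FA F := << FMonom s >>.

Lemma malgUZ c (m : {fmonom Var}) : << c *g m >> = c *: << m >> :> FA F.
Proof.
apply: (proj1 (malgP _ _)) => k; rewrite [RHS]mcoeffZ.
rewrite [LHS]mcoeffU.
rewrite mcoeffU1.
by case: (m == k); rewrite ?mulr1n ?mulr0n ?mulr1 ?mulr0.
Qed.

Lemma w2f_val (m : {fmonom Var}) : w2f m = << m >>.
Proof. by case: m. Qed.

Lemma FA_sum f : f = \sum_(m <- msupp f) f@_m *: w2f m.
Proof.
rewrite {1}[f]monalgE; apply: eq_bigr => m _.
by rewrite malgUZ w2f_val.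
Qed.

Lemma FA_ind (P : FA F -> Prop) : P 0 ->
  (forall c s f, P f -> P (c *: w2f s + f)) -> forall f, P f.
Proof.
move=> P0 PD f; rewrite [f]FA_sum; elim/big_rec: _ => // m g _ Pg.
exact: PD.
Qed.

Lemma malgUM c1 c2 (m1 m2 : {fmonom Var}) :
  << c1 *g m1 >> * << c2 *g m2 >> = << c1 * c2 *g mmul m1 m2 >> :> FA F.
Proof. by rewrite malgM_def fgmulUU. Qed.

Lemma w2fM s t : w2f s * w2f t = w2f (s ++ t).
Proof.
rewrite /w2f malgUM mulr1.
by congr << _ >>; apply/eqP; rewrite fmP fmM.
Qed.

Lemma w2f0 : w2f [::] = 1.
Proof.
by rewrite /w2f; congr << _ >>; apply/eqP; rewrite fmP fm1.
Qed.

Lemma mul_malgCr c f : f * c%:MP = c *: f.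
Proof.
rewrite (malgM_def f) fgmulgU malgZ_def /fgscale.
by apply: eq_bigr => m _; rewrite mulrC mulm1.
Qed.

Lemma FA_scalerAr c f g : f * (c *: g) = c *: (f * g).
Proof. by rewrite -(mul_malgC c g) (mulrA f) mul_malgCr -(scalerAl c f g). Qed.

Section Lext.
Variable L : lmodType F.
Implicit Type chi : seq Var -> L.

Definition lext chi f : L := \sum_(m <- msupp f) f@_m *: chi m.

Lemma lextEw chi f (d : {fset {fmonom Var}}) : (msupp f `<=` d)%fset ->
  lext chi f = \sum_(m <- d) f@_m *: chi m.
Proof.
move=> fd; rewrite /lext (big_fset_incl _ fd) // => m _ /mcoeff_outdom ->.
by rewrite scale0r.
Qed.

Lemma lext_linear chi c f g : lext chi (c *: f + g) = c *: lext chi f + lext chi g.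
Proof.
pose d := (msupp f `|` msupp g)%fset.
have df : (msupp f `<=` d)%fset by apply: fsubsetUl.
have dg : (msupp g `<=` d)%fset by apply: fsubsetUr.
have dfg : (msupp (c *: f + g) `<=` d)%fset.
  by apply: fsubset_trans (msuppD_le _ _) _; apply: fsetSU; apply: msuppZ_le.
rewrite !(lextEw _ df) !(lextEw _ dg) (lextEw _ dfg) scaler_sumr -big_split.
by apply: eq_bigr => m _ /=; rewrite mcoeffD mcoeffZ scalerDl scalerA.
Qed.

Lemma lext0 chi : lext chi 0 = 0.
Proof. by rewrite /lext msupp0 big_nil. Qed.
Lemma lextZ chi c f : lext chi (c *: f) = c *: lext chi f.
Proof. by have := lext_linear chi c f 0; rewrite lext0 !addr0. Qed.
Lemma lextD chi f g : lext chi (f + g) = lext chi f + lext chi g.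
Proof. by have := lext_linear chi 1 f g; rewrite !scale1r. Qed.
Lemma lextB chi f g : lext chi (f - g) = lext chi f - lext chi g.
Proof. by have := lext_linear chi (-1) g f; rewrite !scaleN1r addrC => ->; rewrite addrC. Qed.
Lemma lext_sum chi (J : Type) (r : seq J) (P : pred J) (h : J -> FA F) :
  lext chi (\sum_(j <- r | P j) h j) = \sum_(j <- r | P j) lext chi (h j).
Proof. by apply: (big_morph _ (lextD chi) (lext0 chi)). Qed.

Lemma lext_w chi s : lext chi (w2f s) = chi s.
Proof.
rewrite /lext msuppU1 big_seq_fset1 mcoeffUU scale1r.
by [].
Qed.

End Lext.

(** The product is an arbitrary bilinear map, so that the statement serves substitution, evaluation
    in matrices, the constant term and, with the factors exchanged, the reversal of words. *)
Lemma lextM (L : lmodType F) (chi : seq Var -> L)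
  (mul : L -> L -> L) f g :
  (forall c x y z, mul (c *: x + y) z = c *: mul x z + mul y z) ->
  (forall c x y z, mul x (c *: y + z) = c *: mul x y + mul x z) ->
  (forall s t, chi (s ++ t) = mul (chi s) (chi t)) ->
  lext chi (f * g) = mul (lext chi f) (lext chi g).
Proof.
move=> ml mr chiM.
have m0l x : mul 0 x = 0 by have := ml (-1) 0 0 x; rewrite scaler0 addr0 scaleN1r addNr.
have m0r x : mul x 0 = 0 by have := mr (-1) x 0 0; rewrite scaler0 addr0 scaleN1r addNr.
elim/FA_ind: f => [|c s f IHf]; first by rewrite mul0r !lext0 m0l.
rewrite (mulrDl (c *: w2f s)) (lext_linear chi c) (lextD chi) ml -IHf; congr (_ + _).
rewrite -(scalerAl c (w2f s)) (lextZ chi c) (lext_w chi s); congr (_ *: _).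
elim/FA_ind: g {f IHf} => [|d t g IHg]; first by rewrite mulr0 !lext0 m0r.
rewrite (mulrDr (w2f s)) (FA_scalerAr d) w2fM !(lext_linear chi d) IHg mr.
by rewrite (lext_w chi t) (lext_w chi (s ++ t)) chiM.
Qed.

Lemma substE psi f : subst psi f = lext (fun s => \prod_(v <- s) psi v) f.
Proof. by []. Qed.

Lemma substM psi f g : subst psi (f * g) = subst psi f * subst psi g.
Proof.
rewrite !substE; apply: (@lextM _ _ (fun x y : FA F => x * y)).
- by move=> c x y z; rewrite mulrDl -scalerAl.
- by move=> c x y z; rewrite mulrDr FA_scalerAr.
- by move=> s t; rewrite big_cat.
Qed.

Lemma subst_var psi v : subst psi (var F v) = psi v.
Proof. by rewrite substE (lext_w _ [:: v]) big_seq1. Qed.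

Lemma substB psi f g : subst psi (f - g) = subst psi f - subst psi g.
Proof. by rewrite !substE lextB. Qed.
Lemma subst1 (psi : Var -> FA F) : subst psi 1 = 1.
Proof. by rewrite -w2f0 substE (lext_w _ [::]) big_nil w2f0. Qed.

Lemma subst_prod psi (J : Type) (r : seq J) (h : J -> FA F) :
  subst psi (\prod_(j <- r) h j) = \prod_(j <- r) subst psi (h j).
Proof. by apply: (big_morph _ (substM psi) (subst1 psi)). Qed.

Lemma subst_comm psi f g : subst psi (comm f g) = comm (subst psi f) (subst psi g).
Proof.
rewrite /comm.
rewrite (substB psi (f * g) (g * f)).
exact: (congr2 (fun x y : FA F => x - y) (substM psi f g) (substM psi g f)).
Qed.

Definition evw : seq Var -> bool := all (fun v : Var => ~~ v.1).

Lemma evw_even s : evw s -> FA_even (w2f s).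
Proof.
move=> es m; rewrite msuppU1 inE => /eqP->; rewrite /odd_count /=.
suff -> : count (fun v : Var => v.1) s = 0%N by [].
apply/eqP; rewrite -leqn0 leqNgt -has_count; apply/hasPn => v vs.
by apply: (allP es).
Qed.

Lemma w2f_no_const s : s != [::] -> no_const (w2f s).
Proof.
move=> s0; rewrite /no_const mcoeffU1; case: eqP => // /(congr1 (@fmonom_val _)) /= e.
by move: s0; rewrite e fm1 eqxx.
Qed.

End FreeAlgebra.

(** Adjacent transpositions generate all rearrangements. Closure is asked only under adding a letter
    in front; what follows the two exchanged letters is covered by the last condition. *)
Lemma perm_cong (T : eqType) (P : pred T) (E : seq T -> seq T -> Prop) :
  (forall s, E s s) -> (forall s t u, E s t -> E t u -> E s u) ->
  (forall x s t, P x -> E s t -> E (x :: s) (x :: t)) ->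
  (forall x y s, P x -> P y -> all P s -> E (x :: y :: s) (y :: x :: s)) ->
  forall s t, all P s -> perm_eq s t -> E s t.
Proof.
move=> Er Et Ec Es; elim=> [|x s IHs] t /=.
  by move=> _; rewrite perm_sym => /perm_nilP ->.
move=> /andP[Px Ps] xst; have xt : x \in t by rewrite -(perm_mem xst) mem_head.
have Pt : all P t by rewrite -(perm_all _ xst) /= Px.
move: xst Pt; case/splitPr: xt => t1 t2.
rewrite perm_sym (perm_catCA t1 [:: x] t2) /= perm_cons perm_sym all_cat /= => st /and3P[P1 _ P2].
apply: (Et _ _ _ (Ec _ _ _ Px (IHs _ Ps st))).
elim: t1 P1 {st} => [|y t1 IHt] //= /andP[Py P1].
apply: (Et _ (y :: x :: t1 ++ t2)); last exact: Ec (IHt P1).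
by apply: Es => //; rewrite all_cat P1.
Qed.

Lemma group_sum0 (F : pzRingType) (V : lmodType F) (I K : eqType)
    (r : seq I) (Q : pred I) (c : I -> F) (key : I -> K) (G : K -> V) :
  (forall kappa, \sum_(i <- r | Q i && (key i == kappa)) c i = 0) ->
  \sum_(i <- r | Q i) c i *: G (key i) = 0.
Proof.
move=> c0; pose ks := undup [seq key i | i <- r].
transitivity (\sum_(i <- r | Q i) \sum_(kappa <- ks | key i == kappa) c i *: G kappa).
  rewrite big_seq_cond [RHS]big_seq_cond; apply: eq_bigr => i /andP[ir _].
  rewrite big_mkcond (bigD1_seq (key i)) ?undup_uniq //=; last first.
    by rewrite mem_undup map_f.
  by rewrite eqxx big1 ?addr0 // => kappa; rewrite eq_sym => /negPf->.
rewrite (exchange_big_dep xpredT) //= big1 // => kappa _.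
by rewrite -scaler_suml c0 scale0r.
Qed.

(** * Normal forms of words modulo an abstract ideal *)

Section WordReduction.
Variables (F : comPzRingType) (A : lalgType F) (T : countType).
Implicit Types (s t u v w : seq T) (x y : T).
Variables (P : pred T) (om : seq T -> A) (x0 : T).
Hypotheses (om0 : om [::] = 1) (omM : forall s t, om (s ++ t) = om s * om t).
Variable I : A -> Prop.
Hypotheses (ID : forall f g, I f -> I g -> I (f + g)) (I0 : I 0).
Hypotheses (IZ : forall c f, I f -> I (c *: f)).
Hypotheses (IL : forall f g, I f -> I (g * f)) (IR : forall f g, I f -> I (f * g)).

Definition swap x y : A := om [:: x; y] - om [:: y; x].

Variable K : nat.
Hypothesis I_swap2 : forall a b u c d, P a -> P b -> all P u -> P c -> P d ->
  I (swap a b * om u * swap c d).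
Hypothesis I_swapK : forall a b v, P a -> P b -> all P v -> (K <= size v)%N ->
  I (swap a b * om v).

Lemma om_cons x s : om (x :: s) = om [:: x] * om s.
Proof. by rewrite -omM. Qed.

Lemma om_swap x y s : om (x :: y :: s) - om (y :: x :: s) = swap x y * om s.
Proof. by rewrite /swap mulrBl -!omM. Qed.

(** The identity [a, b] u = [a, b u] - b [a, u] expresses a commutator followed by a word through
    commutators without one; hence [a, b] u [c, d] lies in the ideal generated by products of two
    commutators of words. *)
Lemma swap_word a b u : swap a b * om u =
  (om [:: a] * om (b :: u) - om (b :: u) * om [:: a])
  - om [:: b] * (om [:: a] * om u - om u * om [:: a]).
Proof.
rewrite /swap mulrBr mulrBl !mulrA -!omM /= opprB addrA.
by rewrite addrAC -addrA [X in _ = _ + X]addrC !addrA addrNK addrC.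
Qed.

Lemma I_trans (g r : A) s t u : I (g * (om s - om t) * r) -> I (g * (om t - om u) * r) ->
  I (g * (om s - om u) * r).
Proof.
move=> st tu; have := ID st tu; rewrite -mulrDl -mulrDr.
by rewrite addrA addrNK.
Qed.

(** Letters to the right of a commutator commute modulo I, since each exchange creates a second
    commutator. *)
Lemma swap_perm a b u s t : P a -> P b -> all P u -> all P s -> perm_eq s t ->
  I (swap a b * om u * (om s - om t)).
Proof.
move=> Pa Pb Pu Ps st.
pose E s t := forall u, all P u -> I (swap a b * om u * (om s - om t) * 1).
suff : E s t by move=> /(_ u Pu); rewrite mulr1.
apply: (perm_cong (P := P)) st => //.
- by move=> s1 u1 _; rewrite subrr mulr0 mul0r.
- move=> s1 t1 v st tv u1 Pu1; exact: I_trans (st u1 Pu1) (tv u1 Pu1).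
- move=> x s1 t1 Px st u1 Pu1; rewrite om_cons (om_cons x t1) -mulrBr mulrA.
  by rewrite -(mulrA (swap a b)) -omM; apply: st; rewrite all_cat Pu1 /= Px.
- move=> x y s1 Px Py Ps1 u1 Pu1; rewrite om_swap mulr1 mulrA.
  by apply: IR; apply: I_swap2.
Qed.

Lemma perm_left r s t :
  (forall a b u, P a -> P b -> all P u -> I (swap a b * om u * r)) ->
  all P s -> perm_eq s t -> I ((om s - om t) * r).
Proof.
move=> Ir; pose E s t := I ((om s - om t) * r).
apply: (perm_cong (P := P) (E := E)); rewrite /E.
- by move=> s1; rewrite subrr mul0r.
- move=> s1 t1 u st tu; have := @I_trans 1 r s1 t1 u.
  by rewrite !mul1r; apply.
- by move=> x s1 t1 Px st; rewrite om_cons (om_cons x t1) -mulrBr -mulrA; apply: IL.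
- by move=> x y s1 Px Py Ps; rewrite om_swap; apply: Ir.
Qed.

Definition pickle_le (x y : T) := (choice.pickle x <= choice.pickle y)%N.
Definition srt := sort pickle_le.

Lemma perm_srt s : perm_eq (srt s) s. Proof. by rewrite perm_sort. Qed.
Lemma all_srt s : all P (srt s) = all P s. Proof. exact: all_sort. Qed.

Lemma srtP s t : reflect (srt s = srt t) (perm_eq s t).
Proof.
rewrite perm_sym; apply: (iffP idP) => [st|e].
  apply/perm_sortP; last by rewrite perm_sym.
  - by move=> x y; apply: leq_total.
  - by move=> y x z; apply: leq_trans.
  - by move=> x y; rewrite /pickle_le -eqn_leq => /eqP/(pcan_inj choice.pickleK).
by rewrite -(permPl (perm_srt t)) -e perm_srt.
Qed.

Definition wkey d w : seq T * T * seq T :=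
  (srt (take (size w - d.+1) w), nth x0 w (size w - d.+1), srt (drop (size w - d) w)).

(** The correction term for one letter of a word. It is a function of the key, so it disappears once
    the coefficients of the words with that key add up to zero. *)
Definition wred (kappa : seq T * T * seq T) : A :=
  (om (rcons kappa.1.1 kappa.1.2) - om (srt (rcons kappa.1.1 kappa.1.2))) * om kappa.2.

(** The words f i, with the prefix sorted and the last i letters kept, interpolate between [srt w]
    and w. The step from d to d + 1 sorts one letter fewer, so it is a combination of commutators
    followed by the suffix of length d: for d >= K it lies in I, and for d < K the suffix may be
    sorted by [swap_perm]. *)
Lemma word_reduce w : all P w ->
  I (om w - (om (srt w) + \sum_(d < K | (d < size w)%N) wred (wkey d w))).
Proof.
move=> Pw; pose n := size w.
pose f i := om (srt (take (n - i) w)) * om (drop (n - i) w).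
have f0 : f 0%N = om (srt w).
  by rewrite /f subn0 take_size drop_size om0 mulr1.
have fn : f n = om w by rewrite /f subnn take0 drop0 om0 mul1r.
have sumE : \sum_(d < K | (d < n)%N) wred (wkey d w) =
    \sum_(d < n) (if (d < K)%N then wred (wkey d w) else 0).
  rewrite -(big_mkord xpredT (fun d => if (d < K)%N then wred (wkey d w) else 0)).
  rewrite -(big_mkord (fun d => d < n)%N (fun d => wred (wkey d w))).
  rewrite (big_nat_widen _ _ (maxn K n)) ?leq_maxl // (big_nat_widen 0 n (maxn K n)) ?leq_maxr //.
  rewrite [RHS]big_mkcondr [LHS]big_mkcond [RHS]big_mkcond /=.
  by apply: eq_bigr => d _; case: (d < n)%N; case: (d < K)%N.
have -> : om w - (om (srt w) + \sum_(d < K | (d < n)%N) wred (wkey d w)) =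
    \sum_(d < n) (f d.+1 - f d - (if (d < K)%N then wred (wkey d w) else 0)).
  rewrite sumrB -sumE -(big_mkord xpredT (fun d => f d.+1 - f d)) telescope_sumr //.
  by rewrite fn f0 opprD addrA.
apply: big_ind => // [] [d /= dn] _.
have lt1 : (n - d.+1 < size w)%N by rewrite /n; clear -dn; lia.
have e1 : (n - d = (n - d.+1).+1)%N by clear -dn; lia.
set U := take (n - d.+1) w; set x := nth x0 w (n - d.+1); set V := drop (n - d) w.
have PU : all P U by move: Pw; rewrite -{1}(cat_take_drop (n - d.+1) w) all_cat => /andP[].
have PV : all P V by move: Pw; rewrite -{1}(cat_take_drop (n - d) w) all_cat => /andP[].
have Px : P x by apply: (allP Pw); rewrite mem_nth.
have fd1 : f d.+1 = om (rcons (srt U) x) * om V.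
  by rewrite /f (drop_nth x0) // -e1 om_cons -cats1 omM mulrA.
have fd : f d = om (srt (rcons (srt U) x)) * om V.
  rewrite /f {1}e1 (take_nth x0) //; congr (om _ * _); apply/srtP.
  by rewrite -!cats1 perm_cat2r perm_sym perm_srt.
have Pk : all P (rcons (srt U) x) by rewrite all_rcons Px all_srt.
have permk : perm_eq (rcons (srt U) x) (srt (rcons (srt U) x)) by rewrite perm_sym perm_srt.
rewrite fd1 fd -mulrBl; case: ltnP => dK; last first.
  rewrite subr0; apply: perm_left permk => // a b u Pa Pb Pu.
  rewrite -mulrA -omM; apply: I_swapK => //; first by rewrite all_cat Pu.
  by rewrite size_cat /V size_drop; move: dK; rewrite /n; clear -dn; lia.
rewrite /wred /wkey -/n -/U -/x -/V /= -mulrBr.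
apply: perm_left permk => // a b u Pa Pb Pu.
by apply: swap_perm => //; rewrite perm_sym perm_srt.
Qed.

Hypothesis I_odd : forall w, ~~ all P w -> I (om w).

Lemma ideal_of_sums (r : seq (seq T)) (c : seq T -> F) :
  (forall s, \sum_(w <- r | all P w && (srt w == s)) c w = 0) ->
  (forall d kappa, (d < K)%N ->
    \sum_(w <- r | [&& all P w, (d < size w)%N & wkey d w == kappa]) c w = 0) ->
  I (\sum_(w <- r) c w *: om w).
Proof.
move=> c0 cd; rewrite (bigID (all P)) /=; apply: ID; last first.
  by apply: big_ind => // w nPw; apply: IZ; apply: I_odd.
pose red w := om (srt w) + \sum_(d < K | (d < size w)%N) wred (wkey d w).
have -> : \sum_(w <- r | all P w) c w *: om w =
    \sum_(w <- r | all P w) c w *: (om w - red w) + \sum_(w <- r | all P w) c w *: red w.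
  by rewrite -big_split; apply: eq_bigr => w _ /=; rewrite -scalerDr addrNK.
apply: ID; first by apply: big_ind => // w Pw; apply: IZ; apply: word_reduce.
suff -> : \sum_(w <- r | all P w) c w *: red w = 0 by [].
under eq_bigr => w _ do rewrite scalerDr.
rewrite big_split /= group_sum0 // add0r.
under eq_bigr => w _ do rewrite scaler_sumr big_mkcond.
rewrite exchange_big /= big1 // => d _; rewrite -big_mkcondr /=.
by apply: group_sum0 => kappa; rewrite -[RHS](cd d kappa) //; apply: eq_bigl => w; rewrite andbA.
Qed.

End WordReduction.

(** * From coefficient sums to the two T-ideals *)

Section Ideals.
Variable F : fieldType.
Implicit Types (f g : FA F) (s t u v w : seq Var).
Local Notation om := (@w2f F).
Local Notation ev := (fun v : Var => ~~ v.1).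
Local Notation swap := (swap om).

(** Substitutions given by a list: y_i goes to entry i, so entry 0 is a placeholder for generators
    in y_1, y_2, ...; odd variables go to 0. *)
Definition esub (l : seq (FA F)) (x : Var) : FA F :=
  if x.1 then 0 else nth 0 l x.2.

Definition even_nc f := FA_even f /\ no_const f.

Lemma even_nc0 : even_nc 0.
Proof. by split; [move=> m; rewrite msupp0 | rewrite /no_const mcoeff0]. Qed.

Lemma even_nc_w2f s : s != [::] -> all ev s -> even_nc (om s).
Proof. by move=> s0 es; split; [apply: evw_even | apply: w2f_no_const]. Qed.

Lemma esub_endo (l : seq (FA F)) : (forall i, even_nc (nth 0 l i)) -> graded_endo (esub l).
Proof.
by move=> le; split=> [i|i m]; [apply: le | rewrite /esub /= msupp0].
Qed.

Lemma subst_comm_var psi x y : subst psi (comm (var F x) (var F y)) = comm (psi x) (psi y).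
Proof.
exact: etrans (subst_comm _ _ _) (congr2 (@comm F) (subst_var psi x) (subst_var psi y)).
Qed.

Lemma subst_mul psi f g f' g' : subst psi f = f' -> subst psi g = g' ->
  subst psi (f * g) = f' * g'.
Proof. by move=> <- <-; exact: substM. Qed.

Section InIdeal.
Variable I : FA F -> Prop.
Hypothesis I_T2 : is_T2ideal I.

Lemma T2_D f g : I f -> I g -> I (f + g). Proof. by case: I_T2 => H _ _ _; apply: H. Qed.
Lemma T2_Z c f : I f -> I (c *: f). Proof. by case: I_T2 => _ H _ _; apply: H. Qed.
Lemma T2_L f g : I f -> I (g * f). Proof. case: I_T2 => _ _ H _ If; exact: (proj1 (H f g If)). Qed.
Lemma T2_R f g : I f -> I (f * g). Proof. case: I_T2 => _ _ H _ If; exact: (proj2 (H f g If)). Qed.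
Lemma T2_0 f : I f -> I 0. Proof. by move=> /(T2_Z 0); rewrite scale0r. Qed.
Lemma T2_subst psi f : graded_endo psi -> I f -> I (subst psi f).
Proof. by case: I_T2 => _ _ _ H ge; apply: H. Qed.

Lemma comm_swap a b : comm (om [:: a]) (om [:: b]) = swap a b.
Proof. exact: (congr2 (fun x y : FA F => x - y) (w2fM F [:: a] [:: b]) (w2fM F [:: b] [:: a])). Qed.

Lemma comm_letters (x y z t : FA F) :
  I (comm (yv F 1) (yv F 2) * comm (yv F 3) (yv F 4)) ->
  even_nc x -> even_nc y -> even_nc z -> even_nc t -> I (comm x y * comm z t).
Proof.
move=> Ig ex ey ez et; have ge : graded_endo (esub [:: 0; x; y; z; t]).
  by apply: esub_endo => -[|[|[|[|[|i]]]]] //=; rewrite ?nth_nil; exact: even_nc0.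
have := T2_subst ge Ig.
by rewrite (subst_mul (subst_comm_var _ _ _) (subst_comm_var _ _ _)).
Qed.

Lemma swap2_in a b u c d :
  I (comm (yv F 1) (yv F 2) * comm (yv F 3) (yv F 4)) ->
  ev a -> ev b -> all ev u -> ev c -> ev d -> I (swap a b * om u * swap c d).
Proof.
move=> Ig ea eb eu ec ed; have e1 x : ev x -> even_nc (om [:: x]).
  by move=> ex; apply: even_nc_w2f => //=; rewrite ex.
have Icd x y : even_nc x -> even_nc y -> I (comm x y * swap c d).
  by move=> ex ey; rewrite -comm_swap; apply: comm_letters => //; apply: e1.
have key : swap a b * om u = comm (om [:: a]) (om (b :: u)) - om [:: b] * comm (om [:: a]) (om u).
  exact: (@swap_word F (FA F) Var om (fun s t => esym (w2fM F s t)) a b u).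
rewrite key mulrBl -mulrA -scaleN1r; apply: T2_D; first by apply: Icd; [apply: e1 | apply: even_nc_w2f => //=; rewrite eb].
(* The empty word is 1, which has a constant term and so is not an admissible value for an even
   variable; its commutators vanish anyway. *)
apply: T2_Z; apply: T2_L; case: u eu {key} => [_|x u eu]; last by apply: Icd; [apply: e1 | apply: even_nc_w2f].
have -> : comm (om [:: a]) (om [::]) = 0.
  by rewrite /comm w2f0 mulr1 mul1r subrr.
by rewrite mul0r; apply: T2_0 Ig.
Qed.

Lemma prod_letters v : \prod_(x <- v) om [:: x] = om v.
Proof.
elim: v => [|x v IHv]; first by rewrite big_nil w2f0.
by rewrite big_cons IHv (w2fM F [:: x] v).
Qed.

Definition letters_sub a b v : seq (FA F) :=
  [:: 0, om [:: a], om [:: b] & [seq om [:: x] | x <- v]].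

Lemma letters_endo a b v : ev a -> ev b -> all ev v -> graded_endo (esub (letters_sub a b v)).
Proof.
have e1 x : ev x -> even_nc (om [:: x]).
  by move=> ex; apply: even_nc_w2f => //=; rewrite ex.
move=> ea eb Pv; apply: esub_endo => -[|[|[|i]]] /=; [exact: even_nc0 | exact: e1 | exact: e1 |].
case: (ltnP i (size v)) => iv; last by rewrite nth_default ?size_map //; exact: even_nc0.
by rewrite (nth_map a) //; apply: e1; apply: (allP Pv); rewrite mem_nth.
Qed.

Lemma letters_prod a b v : subst (esub (letters_sub a b v)) (\prod_(3 <= i < (size v).+3) yv F i) = om v.
Proof.
rewrite subst_prod -prod_letters [RHS](big_nth a) !big_add1 /=.
apply: eq_big_nat => i /andP[_ iv]; rewrite subst_var /esub /=.
by rewrite (nth_map a).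
Qed.

Lemma swapA_in k a b v : I (comm (yv F 1) (yv F 2) * \prod_(3 <= i < k.+3) yv F i) ->
  ev a -> ev b -> all ev v -> (k <= size v)%N -> I (swap a b * om v).
Proof.
move=> Ig ea eb Pv kv; set v1 := take k v.
have sv1 : size v1 = k by rewrite size_take_min; apply/minn_idPl.
have Pv1 : all ev v1 by move: Pv; rewrite -{1}(cat_take_drop k v) all_cat => /andP[].
rewrite -(cat_take_drop k v) -w2fM mulrA; apply: T2_R.
have := T2_subst (letters_endo ea eb Pv1) Ig; have := letters_prod a b v1; rewrite sv1 => pr.
by rewrite (subst_mul (subst_comm_var _ _ _) pr) -comm_swap.
Qed.

Lemma swapB_in k a b v : I ((\prod_(3 <= i < k.+3) yv F i) * comm (yv F 1) (yv F 2)) ->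
  ev a -> ev b -> all ev v -> (k <= size v)%N -> I (om v * swap a b).
Proof.
move=> Ig ea eb Pv kv; set v1 := drop (size v - k) v.
have sv1 : size v1 = k by rewrite size_drop subKn.
have Pv1 : all ev v1 by move: Pv; rewrite -{1}(cat_take_drop (size v - k) v) all_cat => /andP[].
rewrite -(cat_take_drop (size v - k) v) -w2fM -mulrA; apply: T2_L.
have := T2_subst (letters_endo ea eb Pv1) Ig; have := letters_prod a b v1; rewrite sv1 => pr.
by rewrite (subst_mul pr (subst_comm_var _ _ _)) -comm_swap.
Qed.

Lemma odd_in w : I (zv F 1) -> ~~ all ev w -> I (om w).
Proof.
move=> Iz; rewrite -has_predC => /hasP[[b i] vin /=]; rewrite negbK => bt.
have Iv : I (om [:: (b, i)]).
  have ge : graded_endo (fun x : Var => if x.1 then om [:: (b, i)] else 0).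
    split=> [j|j m]; first exact: even_nc0.
    by rewrite /= msuppU1 inE => /eqP->; rewrite /odd_count /= bt.
  by have := T2_subst ge Iz; rewrite subst_var.
case/splitPr: vin => s t; rewrite -w2fM; apply: T2_L.
by rewrite -(w2fM F [:: (b, i)] t); apply: T2_R.
Qed.

End InIdeal.

Definition wsum (Q : pred (seq Var)) f : F :=
  \sum_(m <- msupp f | Q (fmonom_val m)) f@_m.

(** The numerical form of being an identity, for A_k with [tr] = [id] and for B_k with [tr] = [rev],
    both with K = k - 1. The inequality d < K reflects that K letters after a commutator, or before
    it for B_k, produce an identity. *)
Definition crit (tr : seq Var -> seq Var) (K : nat) f : Prop :=
  (forall s, wsum (fun w => evw w && (srt (tr w) == s)) f = 0) /\
  (forall d kappa, (d < K)%N ->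
    wsum (fun w => [&& evw w, (d < size w)%N & wkey (false, 0%N) d (tr w) == kappa]) f = 0).

Lemma T2genA k f : (2 <= k)%N -> crit id k.-1 f -> T2gen (@gensA F k) f.
Proof.
case: k => [|[|k]] // _ [c0 cd] I I_T2 Ig.
have I2 : I (comm (yv F 1) (yv F 2) * comm (yv F 3) (yv F 4)) by apply: Ig; constructor 1.
have Iz : I (zv F 1) by apply: Ig; constructor 3.
have Ik : I (comm (yv F 1) (yv F 2) * \prod_(3 <= i < k.+4) yv F i) by apply: Ig; constructor 2.
rewrite [f]FA_sum.
have := @ideal_of_sums F (FA F) Var ev om (false, 0%N) (w2f0 F) (fun s t => esym (w2fM F s t)) I
  (T2_D I_T2) (T2_0 I_T2 Iz) (T2_Z I_T2) (T2_L I_T2) (T2_R I_T2) k.+1 _ _ _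
  [seq fmonom_val m | m <- msupp f] (fun w => f@_(FMonom w)).
rewrite big_map => H; under eq_bigr => m _ do rewrite -{1}(fmK m).
apply: H.
- by move=> a b u c d; apply: swap2_in.
- by move=> a b v; apply: swapA_in.
- by move=> w; apply: odd_in.
- by move=> s; rewrite big_map -[RHS](c0 s); apply: eq_bigr => m _; rewrite fmK.
- by move=> d kappa dk; rewrite big_map -[RHS](cd d kappa dk); apply: eq_bigr => m _; rewrite fmK.
Qed.

Definition rv f : FA F := lext (fun s => om (rev s)) f.

Lemma rv_w s : rv (om s) = om (rev s).
Proof. exact: lext_w. Qed.

Lemma rvM f g : rv (f * g) = rv g * rv f.
Proof.
apply: (@lextM _ (FA F) (fun s => om (rev s)) (fun x y : FA F => y * x)).
- by move=> c x y z; rewrite mulrDr FA_scalerAr.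
- by move=> c x y z; rewrite mulrDl -scalerAl.
- by move=> s t; rewrite rev_cat w2fM.
Qed.

Lemma rv_swap a b : rv (swap a b) = swap b a.
Proof.
exact: etrans (lextB _ _ _) (congr2 (fun x y : FA F => x - y) (lext_w _ [:: a; b]) (lext_w _ [:: b; a])).
Qed.

Lemma rv_mul f g f' g' : rv f = f' -> rv g = g' -> rv (f * g) = g' * f'.
Proof. by move=> <- <-; exact: rvM. Qed.

(** The reduction of words is applied to the predicate sending g to [I (rv g)]: reversal exchanges
    left and right multiples and turns letters before a commutator into letters after it. *)
Lemma T2genB k f : (2 <= k)%N -> crit rev k.-1 f -> T2gen (@gensB F k) f.
Proof.
case: k => [|[|k]] // _ [c0 cd] I I_T2 Ig.
have I2 : I (comm (yv F 1) (yv F 2) * comm (yv F 3) (yv F 4)) by apply: Ig; constructor 1.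
have Iz : I (zv F 1) by apply: Ig; constructor 3.
have Ik : I ((\prod_(3 <= i < k.+4) yv F i) * comm (yv F 1) (yv F 2)) by apply: Ig; constructor 2.
have I0 := T2_0 I_T2 Iz.
have JD f1 f2 : I (rv f1) -> I (rv f2) -> I (rv (f1 + f2)).
  by move=> h1 h2; rewrite /rv lextD; exact: (T2_D I_T2 h1 h2).
have J0 : I (rv 0) by rewrite /rv lext0.
have JZ c f1 : I (rv f1) -> I (rv (c *: f1)).
  by move=> h1; rewrite /rv lextZ; exact: (T2_Z I_T2 c h1).
have JL f1 f2 : I (rv f1) -> I (rv (f2 * f1)).
  by move=> h1; rewrite rvM; exact: (T2_R I_T2 _ h1).
have JR f1 f2 : I (rv f1) -> I (rv (f1 * f2)).
  by move=> h1; rewrite rvM; exact: (T2_L I_T2 _ h1).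
have fE : f = rv (\sum_(m <- msupp f) f@_m *: om (rev (fmonom_val m))).
  rewrite {1}[f]FA_sum /rv lext_sum; apply: eq_bigr => m _.
  by rewrite lextZ lext_w revK.
rewrite fE.
have := @ideal_of_sums F (FA F) Var ev om (false, 0%N) (w2f0 F) (fun s t => esym (w2fM F s t))
  (fun g => I (rv g)) JD J0 JZ JL JR k.+1 _ _ _
  [seq rev (fmonom_val m) | m <- msupp f] (fun w => f@_(FMonom (rev w))).
rewrite big_map => H.
have rf (m : {fmonom Var}) : f@_(FMonom (rev (rev (fmonom_val m)))) = f@_m by rewrite revK fmK.
rewrite (eq_bigr (fun m : {fmonom Var} => f@_(FMonom (rev (rev (fmonom_val m)))) *: om (rev (fmonom_val m)))); last first.
  by move=> m _; rewrite rf.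
apply: H.
- move=> a b u c d ea eb eu ec ed; rewrite (rv_mul (rv_mul (rv_swap _ _) (rv_w _)) (rv_swap _ _)) mulrA.
  by apply: (swap2_in I_T2 I2) => //; rewrite all_rev.
- move=> a b v ea eb evv kv; rewrite (rv_mul (rv_swap _ _) (rv_w _)).
  by apply: (swapB_in I_T2 Ik) => //; rewrite ?all_rev ?size_rev.
- by move=> w nw; rewrite rv_w; apply: (odd_in I_T2 Iz); rewrite all_rev.
- move=> s; rewrite big_map -[RHS](c0 s).
  by apply: eq_big => [m|m _]; rewrite ?rf // all_rev.
- move=> d kappa dk; rewrite big_map -[RHS](cd d kappa dk).
  by apply: eq_big => [m|m _]; rewrite ?rf // all_rev size_rev.
Qed.

End Ideals.

(** * Evaluations in A_k and B_k *)

(** Dedekind's argument: the relation at p q minus chi_y(p) times the relation at q eliminates y and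
    leaves the coefficients C x (chi_x(p) - chi_y(p)), where p separates x from y. *)
Lemma dedekind_independence (F : fieldType) (K : eqType) (Pt : Type) (mul : Pt -> Pt -> Pt)
    (chi : K -> Pt -> F) (ks : seq K) (C : K -> F) :
  (forall x p q, x \in ks -> chi x (mul p q) = chi x p * chi x q) ->
  (forall x, x \in ks -> exists p, chi x p != 0) ->
  {in ks &, forall x y, x != y -> exists p, chi x p != chi y p} ->
  uniq ks ->
  (forall p, \sum_(x <- ks) C x * chi x p = 0) -> forall x, x \in ks -> C x = 0.
Proof.
elim: ks C => [//|y ks IH] C chiM chi0 chi_neq /= /andP[yks uks] sum0.
have inks x : x \in ks -> x \in y :: ks by rewrite inE => ->; rewrite orbT.
have tail x : x \in ks -> C x = 0.
  move=> xks; have xy : x != y by apply: contraNneq yks => <-.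
  have [p np] := chi_neq x y (inks _ xks) (mem_head _ _) xy.
  have /eqP : C x * (chi x p - chi y p) = 0.
    apply: (IH (fun x => C x * (chi x p - chi y p))) => //.
    - by move=> z p1 p2 /inks; apply: chiM.
    - by move=> z /inks; apply: chi0.
    - by move=> z t /inks zk /inks tk; apply: chi_neq.
    move=> q; have := sum0 (mul p q); have := sum0 q; rewrite !big_cons => e1 e2.
    have e3 : \sum_(j <- ks) C j * chi j (mul p q) = \sum_(j <- ks) C j * (chi j p * chi j q).
      by apply: eq_big_seq => j /inks jk; rewrite chiM.
    rewrite chiM ?mem_head // e3 in e2.
    transitivity ((C y * (chi y p * chi y q) + \sum_(j <- ks) C j * (chi j p * chi j q))
        - chi y p * (C y * chi y q + \sum_(j <- ks) C j * chi j q)); last first.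
      by rewrite e2 e1 mulr0 subr0.
    rewrite mulrDr opprD addrACA [X in X + _](_ : _ = 0) ?add0r; last by ring.
    by rewrite mulr_sumr -sumrB; apply: eq_bigr => j _; ring.
  by rewrite mulf_eq0 subr_eq0 (negPf np) orbF => /eqP.
move=> x; rewrite inE => /orP[/eqP->|/tail //].
have [p np] := chi0 y (mem_head _ _); have := sum0 p; rewrite big_cons big_seq big1 ?addr0.
  by move/eqP; rewrite mulf_eq0 (negPf np) orbF => /eqP.
by move=> j /tail->; rewrite mul0r.
Qed.

Section Separate.
Variables (F : fieldType) (charF0 : [pchar F] =i pred0) (I : eqType).
Implicit Types (a b : Var -> F) (s t : seq Var).

Lemma pow2_inj m n : (2%:R ^+ m : F) = 2%:R ^+ n -> m = n.
Proof.
rewrite -!natrX.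
wlog mn : m n / (m <= n)%N.
  by move=> H e; case: (leqP m n) => [/H|/ltnW/H /(_ (esym e))]; [apply | move=> ->].
move=> e; have := (pcharf0P F).1 charF0 (2 ^ n - 2 ^ m)%N.
rewrite natrB ?leq_exp2l // e subrr eqxx => /esym; rewrite subn_eq0 leq_exp2l // => nm.
by apply/eqP; rewrite eqn_leq mn.
Qed.

Lemma prod_pow2 s v : \prod_(u <- s) (if u == v then 2%:R else 1 : F) = 2%:R ^+ count_mem v s.
Proof.
elim: s => [|x s IHs]; first by rewrite big_nil.
by rewrite big_cons IHs /=; case: (x == v); rewrite ?add1n ?exprS // mul1r.
Qed.

Lemma srt_neq s t : srt s != srt t -> exists v, count_mem v s != count_mem v t.
Proof.
move=> st; have : ~~ perm_eq s t by apply: contra st => /srtP->.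
by case/allPn => v _ /=; exists v.
Qed.

(** The monomials in (a, b) are multiplicative characters for the pointwise product. Two different
    ones disagree when a single variable is given the value 2 and all others 1: the values are
    powers of 2, distinct in characteristic zero. *)
Lemma separate (r : seq I) (Q : pred I) (c : I -> F) (U T : I -> seq Var) :
  (forall a b, \sum_(i <- r | Q i)
     c i * (\prod_(v <- U i) a v * \prod_(v <- T i) b v) = 0) ->
  forall s t, \sum_(i <- r | Q i && ((srt (U i) == s) && (srt (T i) == t))) c i = 0.
Proof.
move=> sum0 s0 t0; pose key i := (srt (U i), srt (T i)).
pose ks := undup [seq key i | i <- r].
pose C (kap : seq Var * seq Var) := \sum_(i <- r | Q i && (key i == kap)) c i.
pose chi (kap : seq Var * seq Var) (p : (Var -> F) * (Var -> F)) :=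
  \prod_(v <- kap.1) p.1 v * \prod_(v <- kap.2) p.2 v.
have CE : \sum_(i <- r | Q i && ((srt (U i) == s0) && (srt (T i) == t0))) c i = C (s0, t0).
  by apply: eq_bigl => i; rewrite -xpair_eqE.
rewrite CE; case: (boolP ((s0, t0) \in ks)) => [kin|nk]; last first.
  rewrite /C big_seq_cond big1 // => i /andP[ir /andP[_ /eqP ek]].
  by case/negP: nk; rewrite -ek mem_undup map_f.
apply: (dedekind_independence (mul := fun p q => (fun v => p.1 v * q.1 v, fun v => p.2 v * q.2 v))
  (chi := chi) _ _ _ (undup_uniq _) _ kin).
- move=> kap p q _; rewrite /chi /= !big_split /=; ring.
- move=> kap _; exists (fun=> 1, fun=> 1); rewrite /chi /= !big1 ?mul1r ?oner_eq0 //.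
- move=> x y; rewrite !mem_undup => /mapP[i _ ->] /mapP[j _ ->] nk.
  have [eU|neU] := eqVneq (srt (U i)) (srt (U j)).
    have : srt (T i) != srt (T j) by apply: contra nk => /eqP eT; rewrite /key eU eT.
    case/srt_neq => v nv; exists (fun=> 1, fun u => if u == v then 2%:R else 1).
    rewrite /chi /key /= !big1_eq !mul1r.
    rewrite !(perm_big _ (perm_srt _)) /= !prod_pow2.
    by apply: contra nv => /eqP/pow2_inj ->.
  case/srt_neq: neU => v nv; exists (fun u => if u == v then 2%:R else 1, fun=> 1).
  rewrite /chi /key /= !big1_eq !mulr1.
  rewrite !(perm_big _ (perm_srt _)) /= !prod_pow2.
  by apply: contra nv => /eqP/pow2_inj ->.
move=> [a b]; rewrite -[RHS](sum0 a b).
transitivity (\sum_(i <- r | Q i) \sum_(x <- ks | key i == x) c i * chi x (a, b)); last first.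
  rewrite big_seq_cond [RHS]big_seq_cond; apply: eq_bigr => i /andP[ir _].
  rewrite big_mkcond (bigD1_seq (key i)) ?undup_uniq //=; last by rewrite mem_undup map_f.
  rewrite eqxx big1 ?addr0; last by move=> kappa; rewrite eq_sym => /negPf->.
  by rewrite /chi /= !(perm_big _ (perm_srt _)).
rewrite (exchange_big_dep xpredT) //=; apply: eq_bigr => x _.
by rewrite mulr_suml.
Qed.

End Separate.

(** * The matrices of A_k *)

Section MatricesA.
Variables (F : fieldType) (m : nat).
Local Notation k := m.+2.
Implicit Types (x y : 'M[F]_k) (i j l : 'I_k).

(* The rows of index > 0 are those of a strictly upper triangular Toeplitz
   matrix with coefficients b; row 0 is arbitrary. *)
Definition lower_toeplitz (b : nat -> F) x :=
  forall i j, i != 0 -> x i j = if (i < j)%N then b (j - i)%N else 0.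

Lemma ord_neq0 i : (i != 0) = (0 < i)%N.
Proof. by rewrite lt0n -(inj_eq val_inj). Qed.

Lemma Emx_entry i j : Emx F k i j = ((j : nat) == i.+1)%:R.
Proof.
rewrite /Emx summxE; under eq_bigr => r _ do rewrite mxE.
rewrite big_add1 big_mkord /=; case: (ltnP i m.+1) => im.
  rewrite (bigD1 (Ordinal im)) //= eqSS eqxx /= big1 ?addr0 => [|r nr].
    by [].
  by rewrite eqSS; case: eqP => // e; case/eqP: nr; apply: val_inj.
have ei : i = m.+1 :> nat by apply/eqP; rewrite eqn_leq im -ltnS ltn_ord.
rewrite big1 => [|r _]; last by rewrite eqSS ei; case: eqP => // e; have := ltn_ord r; rewrite -e ltnn.
by case: eqP => // e; have := ltn_ord j; rewrite e ei ltnn.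
Qed.

Lemma mxpow_entry d i j : mxpow (Emx F k) d i j = ((j : nat) == (i + d)%N)%:R.
Proof.
elim: d i j => [|d IHd] i j; first by rewrite mxE addn0 eq_sym.
rewrite /mxpow iterS -/(mxpow _ d) mxE.
under eq_bigr => l _ do rewrite Emx_entry IHd.
case: (ltnP i.+1 k) => ik.
  rewrite (bigD1 (Ordinal ik)) //= eqxx mul1r big1 ?addr0 ?addSnnS // => l nl.
  case: eqP => [e|]; last by rewrite mul0r.
  by case/eqP: nl; apply: val_inj.
rewrite big1 => [|l _].
  by case: eqP => // e; have := ltn_ord j; rewrite e addnS -addSn ltnNge (leq_trans ik) ?leq_addr.
by case: eqP => [e|]; rewrite ?mul0r //; have := ltn_ord l; rewrite e ltnNge ik.
Qed.

Lemma Emx_sum_entry (b : nat -> F) i j :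
  (\sum_(1 <= d < k.-1) b d *: mxpow (Emx F k) d) i j =
  if (i < j)%N && (j - i < k.-1)%N then b (j - i)%N else 0.
Proof.
rewrite summxE; under eq_bigr => d _ do rewrite mxE mxpow_entry.
case: (boolP ((i < j)%N && (j - i < k.-1)%N)) => [/andP[ij jk]|nij].
  rewrite (bigD1_seq (j - i)%N) ?iota_uniq ?mem_index_iota ?subn_gt0 ?ij //=.
  rewrite subnKC ?(ltnW ij) // eqxx mulr1 big1 ?addr0 // => d nd.
  by case: eqP => [e|]; rewrite ?mulr0 //; move: nd; rewrite e addKn eqxx.
rewrite big_nat big1 // => d /andP[d0 dk].
case: eqP => [e|]; rewrite ?mulr0 //; move: nij; rewrite e addKn.
by rewrite -{1}(addn0 i) ltn_add2l d0 dk.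
Qed.

Lemma eu1_sum_entry (c : nat -> F) i j :
  (\sum_(2 <= d < k.+1) c d *: eu F k 1 d) i j =
  if (i == 0) && (0 < j)%N then c j.+1 else 0.
Proof.
rewrite summxE; under eq_bigr => d _ do rewrite !mxE eqSS.
have -> : (i == 0) = (i == 0%N :> nat) by rewrite -(inj_eq val_inj).
case: (i == 0%N :> nat); last first.
  by rewrite big1 // => d _; rewrite mulr0.
under eq_bigr => d _ do rewrite andTb.
rewrite andTb; case: (posnP j) => [j0|j0]; last first.
  have jin : j.+1 \in index_iota 2 k.+1 by rewrite mem_index_iota ltnS j0 ltnS ltn_ord.
  rewrite (bigD1_seq j.+1) ?iota_uniq //=.
  rewrite eqxx mulr1 big1 ?addr0 // => d nd.
  by rewrite eq_sym (negPf nd) mulr0.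
rewrite big_nat big1 // => d /andP[d2 _]; case: eqP => [e|]; rewrite ?mulr0 //.
by move: d2; rewrite -e j0.
Qed.

(** The units e_11, ..., e_1k span all matrices supported on the first row; modulo these the powers
    of E give the Toeplitz patterns of the other rows. *)
Lemma AkP x : Ak x <-> exists b, lower_toeplitz b x.
Proof.
split=> [[a [b [c ->]]]|[b xb]].
  exists (fun d => if (d < k.-1)%N then b d else 0) => i j i0.
  rewrite !mxE Emx_sum_entry eu1_sum_entry (negPf i0) /= addr0.
  rewrite eqSS -(inj_eq val_inj) /= in i0 *; rewrite (negPf i0) /= mulr0 add0r.
  by case: ltnP => //= _; case: ifP.
(* The coefficient of e_1d is the entry of x minus what the powers of E already put there; [d.-1]
   because matrix units are numbered from 1. *)
exists (x 0 0), b, (fun d => x 0 (inord d.-1) - if (d.-1 < k.-1)%N then b d.-1 else 0).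
apply/matrixP => i j; rewrite !mxE Emx_sum_entry eu1_sum_entry eqSS.
have [->|i0] := eqVneq i 0.
  rewrite eqxx /= subn0; case: (posnP j) => j0 /=.
    by rewrite j0 eqxx mulr1 !addr0; congr (x _ _); apply: val_inj.
  rewrite inord_val eqSS eqn0Ngt j0 /= mulr0 add0r.
  by case: ifP => _; rewrite ?add0r ?subr0 // addrCA subrr addr0.
have ni : (i == 0%N :> nat) = false by apply/negbTE; rewrite -(inj_eq val_inj) in i0.
rewrite ni mulr0 add0r addr0 xb //; case: ltnP => //= ij.
rewrite ifT // -ltnS; move: i0; rewrite ord_neq0; have := ltn_ord j; clear -ij.
by move=> jk i0; lia.
Qed.

Lemma Ak0 : Ak (0 : 'M[F]_k).
Proof. by apply/AkP; exists (fun=> 0) => i j _; rewrite mxE if_same. Qed.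

Lemma AkZD c x y : Ak x -> Ak y -> Ak (c *: x + y).
Proof.
move=> /AkP[b xb] /AkP[d yd]; apply/AkP; exists (fun n => c * b n + d n) => i j i0.
by rewrite !mxE xb // yd //; case: ifP; rewrite // mulr0 addr0.
Qed.

(** Toeplitz patterns multiply by convolution of their coefficients; since this is commutative,
    commutators in A_k are confined to the first row. *)
Definition conv (b d : nat -> F) n : F := \sum_(0 <= l < n.-1) b l.+1 * d (n - l.+1)%N.

Lemma convC b d n : conv b d n = conv d b n.
Proof.
rewrite /conv big_nat_rev /= add0n; apply: eq_big_nat => l /andP[_ ln].
rewrite mulrC; congr (d _ * b _); clear -ln; lia.
Qed.

Lemma toeplitzM b d x y : lower_toeplitz b x -> lower_toeplitz d y ->
  lower_toeplitz (conv b d) (x *m y).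
Proof.
move=> xb yd i j i0; rewrite /conv mxE.
transitivity (\sum_(0 <= l < k) if (i < l < j)%N then b (l - i)%N * d (j - l)%N else 0).
  rewrite big_mkord; apply: eq_bigr => l _; rewrite xb //.
  case: ltnP => [il|]; last by rewrite mul0r.
  by rewrite yd; [case: ifP; rewrite ?mulr0 | rewrite ord_neq0 (leq_ltn_trans _ il)].
case: ltnP => ij; last first.
  rewrite big1 // => l _; case: ifP => // /andP[il lj].
  by have := leq_trans (ltn_trans il lj) ij; rewrite ltnn.
rewrite (big_cat_nat (n := i.+1)) //= ?(ltn_ord i) //.
rewrite [X in X + _]big_nat big1 ?add0r; last first.
  by move=> l /andP[_]; rewrite ltnS leqNgt => /negPf->.
rewrite (big_cat_nat (n := j)) //= ?(ltnW (ltn_ord j)) //.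
rewrite [X in _ + X](_ : _ = 0) ?addr0; last first.
  rewrite big_nat big1 // => l /andP[jl _].
  by rewrite [(l < j)%N]ltnNge jl andbF.
rewrite -{1}(add0n i.+1) big_addn subnS; apply: eq_big_nat => l /andP[_ lj].
have -> : (i < l + i.+1 < j)%N by rewrite addnS ltnS leq_addl /=; move: lj; clear; lia.
rewrite addnS subSn ?leq_addl // addnK; congr (_ * d _).
by clear; lia.
Qed.

Lemma AkM x y : Ak x -> Ak y -> Ak (x *m y).
Proof.
move=> /AkP[b xb] /AkP[d yd]; apply/AkP; exists (conv b d); exact: toeplitzM.
Qed.

(** Commuting with the units of the first row is enough: e_11 clears the first row off the corner,
    and e_12 clears the corner and the second row, from which the Toeplitz pattern propagates zero
    to all lower rows. *)
Lemma center_Ak x : center (@Ak F k) (@zero_part F k) x -> x = 0.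
Proof.
move=> [[x0 [x1 [/AkP[b xb] -> ->]]] xc]; rewrite addr0 in xc *.
have comm_eu j : x0 *m eu F k 1 j.+1 = eu F k 1 j.+1 *m x0.
  apply: xc; exists (eu F k 1 j.+1), 0; rewrite addr0; split=> //; apply/AkP.
  exists (fun=> 0) => i l i0; rewrite mxE if_same eqSS.
  by rewrite ord_neq0 in i0; rewrite eqn0Ngt i0.
have L (j : 'I_k) i l : (x0 *m eu F k 1 j.+1) i l = x0 i 0 * (l == j)%:R.
  rewrite mxE (bigD1 0) //= mxE !eqSS eqxx /= (inj_eq val_inj) big1 ?addr0 // => r r0.
  by rewrite mxE !eqSS eqn0Ngt -ord_neq0 r0 mulr0.
have Rr (j : 'I_k) i l : (eu F k 1 j.+1 *m x0) i l = (i == 0)%:R * x0 j l.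
  rewrite mxE (bigD1 j) //= mxE !eqSS eqxx andbT big1 ?addr0 // => r rj.
  by rewrite mxE !eqSS (inj_eq val_inj) (negPf rj) andbF mul0r.
have E j i l : x0 i 0 * (l == j)%:R = (i == 0)%:R * x0 j l by rewrite -L -Rr comm_eu.
have row0E l : l != 0 -> x0 0 l = 0.
  by move=> l0; have := E 0 0 l; rewrite eqxx (negPf l0) mulr0 mul1r.
pose o1 : 'I_k := inord 1.
have o1n : o1 != 0 by rewrite ord_neq0 inordK.
have row1E l : x0 o1 l = 0.
  have := E o1 0 l; rewrite eqxx mul1r => <-; have := E o1 0 o1.
  by rewrite !eqxx mulr1 mul1r (xb o1 o1 o1n) ltnn => ->; rewrite mul0r.
have x00 : x0 0 0 = 0 by have := E o1 0 o1; rewrite !eqxx mulr1 mul1r row1E.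
apply/matrixP => i j; rewrite mxE; have [->|i0] := eqVneq i 0.
  by have [->//|/row0E] := eqVneq j 0.
rewrite xb //; case: ltnP => // ij.
rewrite ord_neq0 in i0; have jk := ltn_ord j.
(* Column j - (i - 1) of row 1 carries the same coefficient b (j - i) as the entry (i, j), and row 1
   is zero. *)
have ok : (j - i.-1 < k)%N by clear -jk; lia.
have := xb o1 (Ordinal ok) o1n; rewrite row1E inordK //= ifT; last by clear -ij i0; lia.
by move=> ->; congr b; clear -ij i0; lia.
Qed.

Lemma in_super0 (X : 'M[F]_k -> Prop) x : in_super X (@zero_part F k) x <-> X x.
Proof.
by split=> [[a [b [Xa -> ->]]]|Xx]; [rewrite addr0 | exists x, 0; rewrite addr0].
Qed.

(** Commutators have this shape with p = 0, every right factor from A_k raises p by one, and p = k -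
    1 leaves no room for a nonzero entry: whence the k - 1 letters in the generator. *)
Definition comm_shape p x := forall i j, x i j != 0 -> i = 0 /\ (p < j)%N.

Lemma Ak_lower x i j : Ak x -> i != 0 -> (j <= i)%N -> x i j = 0.
Proof. by move=> /AkP[b xb] i0 ji; rewrite xb // ltnNge ji. Qed.

Lemma commA_shape x y : Ak x -> Ak y -> comm_shape 0 (x *m y - y *m x).
Proof.
move=> /[dup] Ax /AkP[b xb] /[dup] Ay /AkP[d yd] i j.
rewrite !mxE; have [->|i0] := eqVneq i 0; last first.
  have := toeplitzM xb yd j i0; have := toeplitzM yd xb j i0; rewrite !mxE => -> ->.
  by case: ifP => _; rewrite ?subrr ?eqxx // convC subrr eqxx.
case: (posnP j) => // j0; have -> : j = 0 by apply: val_inj.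
have e (z w : 'M[F]_k) : Ak w -> \sum_l z 0 l * w l 0 = z 0 0 * w 0 0 :> F.
  move=> Aw; rewrite (bigD1 0) //= big1 ?addr0 // => l l0.
  by rewrite (Ak_lower Aw l0) ?mulr0.
by rewrite !e // mulrC subrr eqxx.
Qed.

Lemma shape_mul p x y : comm_shape p x -> Ak y -> comm_shape p.+1 (x *m y).
Proof.
move=> xs Ay i j; rewrite mxE => nz.
have [l nl] : exists l, x i l * y l j != 0.
  apply/existsP; apply: contraT; rewrite negb_exists => /forallP H.
  by case/eqP: nz; apply: big1 => l _; apply/eqP; have := H l; rewrite negbK.
move: nl; rewrite mulf_eq0 negb_or => /andP[/xs[-> pl] nl]; split=> //.
have l0 : l != 0 by rewrite ord_neq0 (leq_ltn_trans _ pl).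
rewrite ltnNge; apply/negP => jp; case/eqP: nl; apply: Ak_lower => //.
exact: leq_trans jp pl.
Qed.

Lemma shape_big x : comm_shape m.+1 x -> x = 0.
Proof.
move=> xs; apply/matrixP => i j; rewrite mxE; apply/eqP; apply: contraT => /xs[_].
by rewrite ltnNge -ltnS ltn_ord.
Qed.

Lemma shape_shape x y : comm_shape 0 x -> comm_shape 0 y -> x *m y = 0.
Proof.
move=> xs ys; apply/matrixP => i j; rewrite !mxE; apply: big1 => l _; apply/eqP.
apply: contraT; rewrite mulf_eq0 negb_or => /andP[/xs[_ l0] /ys[e _]].
by move: l0; rewrite e.
Qed.

Definition mxprod (s : seq 'M[F]_k) : 'M[F]_k := foldr (@mulmx F k k k) 1%:M s.

Lemma shape_prod p x s : comm_shape p x -> {in s, forall y, Ak y} ->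
  comm_shape (p + size s)%N (x *m mxprod s).
Proof.
elim: s p x => [|y s IHs] p x xs As /=; first by rewrite mulmx1 addn0.
rewrite mulmxA addnS -addSn; apply: IHs; last by move=> z zs; apply: As; rewrite inE zs orbT.
by apply: shape_mul xs _; apply: As; rewrite mem_head.
Qed.

Lemma commA_prod x y s : Ak x -> Ak y -> {in s, forall z, Ak z} -> size s = m.+1 ->
  (x *m y - y *m x) *m mxprod s = 0.
Proof.
move=> Ax Ay As sz; apply: shape_big.
by have := shape_prod (commA_shape Ax Ay) As; rewrite sz add0n.
Qed.

Lemma commA_comm x y z t : Ak x -> Ak y -> Ak z -> Ak t ->
  (x *m y - y *m x) *m (z *m t - t *m z) = 0.
Proof. by move=> *; apply: shape_shape; apply: commA_shape. Qed.

(* Chosen so that the entry (0, d.+1) of the value of a word is the value of a on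
   a prefix, of h on the next letter and of b on the remaining d letters. *)
Definition genmx (a h b : F) : 'M[F]_k := \matrix_(i, j)
  if i == 0 then (if j == 0 then a else if (j : nat) == 1%N then h else 0)
  else if (j : nat) == i.+1 then b else 0.

Lemma genmx_Ak a h b : Ak (genmx a h b).
Proof.
apply/AkP; exists (fun d => if d == 1%N then b else 0) => i j i0.
rewrite mxE (negPf i0); case: eqP => [->|ne]; first by rewrite ltnSn subSnn eqxx.
by case: ltnP => // ij; rewrite ifF //; apply/negbTE/eqP; clear -ne ij; lia.
Qed.

Section Generic.
Variables a h b : Var -> F.
Definition geneval (v : Var) : 'M[F]_k := if v.1 then 0 else genmx (a v) (h v) (b v).

Lemma geneval_odd s : ~~ evw s -> evalw geneval s = 0.
Proof.
elim: s => //= v s IHs; rewrite negb_and negbK => /orP[ov|/IHs->]; last by rewrite mulmx0.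
by rewrite /geneval ov mul0mx.
Qed.

Lemma geneval_low s i j : evw s -> i != 0 ->
  evalw geneval s i j = ((j : nat) == (i + size s)%N)%:R * \prod_(v <- s) b v.
Proof.
elim: s i => [|v s IHs] i /=; first by rewrite big_nil mulr1 addn0 mxE [in RHS]eq_sym.
move=> /andP[ev es] i0; rewrite mxE /geneval (negPf ev) big_cons.
case: (ltnP i.+1 k) => ik.
  rewrite (bigD1 (Ordinal ik)) //= mxE (negPf i0) eqxx IHs // [X in _ + X]big1 ?addr0 => [|l nl].
    by rewrite /= addSnnS mulrCA.
  rewrite mxE (negPf i0); case: eqP => [e|]; last by rewrite mul0r.
  by case/eqP: nl; apply: val_inj.
rewrite [LHS]big1 => [|l _].
  case: eqP => [e|]; last by rewrite mul0r.
  by have := ltn_ord j; rewrite e addnS -addSn ltnNge (leq_trans ik) ?leq_addr.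
rewrite mxE (negPf i0); case: eqP => [e|]; last by rewrite mul0r.
by have := ltn_ord l; rewrite e ltnNge ik.
Qed.

Lemma geneval_row0 v s j : evw (v :: s) ->
  evalw geneval (v :: s) 0 j = a v * evalw geneval s 0 j + h v * evalw geneval s (inord 1) j.
Proof.
move=> /= /andP[ev es]; rewrite mxE /geneval (negPf ev).
have o1n : inord 1 != 0 :> 'I_k by rewrite ord_neq0 inordK.
rewrite (bigD1 0) //= (bigD1 (inord 1)) //= !mxE !eqxx (negPf o1n) inordK //= addrA.
rewrite big1 ?addr0 // => l /andP[l0 l1]; rewrite mxE eqxx (negPf l0).
case: eqP => [e|]; last by rewrite mul0r.
by case/eqP: l1; apply: val_inj; rewrite /= inordK.
Qed.

Lemma geneval_00 s : evw s -> evalw geneval s 0 0 = \prod_(v <- s) a v.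
Proof.
elim: s => [|v s IHs] es; first by rewrite big_nil mxE eqxx.
have /andP[_ es'] := es; rewrite geneval_row0 // IHs // big_cons geneval_low //; last first.
  by rewrite ord_neq0 inordK.
by rewrite inordK //= mul0r mulr0 addr0.
Qed.

Lemma geneval_0S s d (dk : (d.+1 < k)%N) (x0 : Var) : evw s ->
  evalw geneval s 0 (Ordinal dk) = if (d < size s)%N then
    \prod_(v <- take (size s - d.+1) s) a v * h (nth x0 s (size s - d.+1))
    * \prod_(v <- drop (size s - d) s) b v else 0.
Proof.
elim: s => [|v s IHs] es; first by rewrite mxE.
have /andP[_ es'] := es; rewrite geneval_row0 // IHs // geneval_low //; last first.
  by rewrite ord_neq0 inordK.
rewrite inordK //= add1n eqSS ltnS subSS; case: (ltngtP d (size s)) => ds.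
- by rewrite mul0r mulr0 addr0 -(subnSK ds) /= big_cons !mulrA subSn ?(ltnW ds) //= (subnSK ds).
- by rewrite mul0r !mulr0 addr0.
- by rewrite ds subnn subSnn /= big_nil mulr0 add0r !mul1r drop0.
Qed.

End Generic.

(** The corner entry of a generic value is the product of a over the word, which gives the sums by
    content; the entry (0, d + 1) gives the sums by keys with suffix length d. In both cases the
    monomials are separated by varying a and b. *)
Lemma crit_of_generic (tr : seq Var -> seq Var) (f : FA F) (charF0 : [pchar F] =i pred0) :
  (forall s, evw (tr s) = evw s) -> (forall s, size (tr s) = size s) ->
  (forall a h b, lext (fun s => evalw (geneval a h b) (tr s)) f = 0) ->
  crit tr m.+1 f.
Proof.
move=> trev trsz f0.
have entry a h b i j : \sum_(w <- msupp f) f@_w * evalw (geneval a h b) (tr (fmonom_val w)) i j = 0.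
  have := congr1 (fun M : 'M_k => M i j) (f0 a h b); rewrite mxE summxE => e.
  by rewrite -[RHS]e; apply: eq_bigr => w _; rewrite mxE.
have entry_ev a h b i j : \sum_(w <- msupp f | evw (fmonom_val w))
    f@_w * evalw (geneval a h b) (tr (fmonom_val w)) i j = 0.
  rewrite -[RHS](entry a h b i j) [RHS](bigID (fun w : {fmonom Var} => evw (fmonom_val w))) /=.
  rewrite [X in _ = _ + X]big1 ?addr0 // => w nw.
  by rewrite geneval_odd ?trev // mxE mulr0.
split=> [s|d [[U x] T] dk].
  have := @separate F charF0 _ (msupp f) (fun w => evw (fmonom_val w)) (fun w => f@_w)
    (fun w => tr (fmonom_val w)) (fun=> [::]) _ s (srt [::]) => /= sep.
  rewrite /wsum -[RHS]sep; first by apply: eq_bigl => w; rewrite eqxx andbT.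
  move=> a b; rewrite -[RHS](entry_ev a (fun=> 0) b 0 0); apply: eq_bigr => w ew.
  by rewrite geneval_00 ?trev // big_nil mulr1.
pose Q (w : {fmonom Var}) := [&& evw (fmonom_val w), (d < size (fmonom_val w))%N &
  nth (false, 0%N) (tr (fmonom_val w)) (size (fmonom_val w) - d.+1) == x].
have := @separate F charF0 _ (msupp f) Q (fun w => f@_w)
    (fun w => take (size (fmonom_val w) - d.+1) (tr (fmonom_val w)))
    (fun w => drop (size (fmonom_val w) - d) (tr (fmonom_val w))) _ U T => sep.
rewrite /wsum -[RHS]sep => [|a b].
  apply: eq_bigl => w; rewrite /Q /wkey trsz !xpair_eqE -!andbA; do 2!congr andb.
  by case: (srt _ == U); rewrite ?andbF //=.
have dk' : (d.+1 < k)%N by [].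
(* Taking h to be the indicator of x retains the words whose letter at the marked position is x. *)
rewrite -[RHS](entry_ev a (fun v => (v == x)%:R) b 0 (Ordinal dk')).
rewrite big_mkcond [RHS]big_mkcond; apply: eq_bigr => w _; rewrite /Q.
case: (boolP (evw (fmonom_val w))) => //= ew.
rewrite (geneval_0S _ _ _ dk' (false, 0%N)) ?trev // trsz.
case: (d < size w)%N => /=; last by rewrite mulr0.
by case: (_ == x); rewrite ?mulr1 ?mulr0 ?mul0r ?mulr0.
Qed.

End MatricesA.

(** * Constant terms, evaluations and the T-ideal of identities *)

Section ConstantTerm.
Variable F : fieldType.
Implicit Types (f g : FA F) (s : seq Var).

(** The augmentation: multiplicative on words, with the constant term as linear extension. *)
Definition isnil s : F^o := (s == [::])%:R.

Lemma const_lext f : f@_(mone : {fmonom Var}) = lext isnil f.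
Proof.
elim/FA_ind: f => [|c s f IHf]; first by rewrite mcoeff0 lext0.
rewrite (lext_linear isnil c (w2f F s) f) -IHf (lext_w isnil s).
rewrite mcoeffD mcoeffZ mcoeffU1; congr (_ * _%:R + _).
by rewrite fmP fm1.
Qed.

Lemma const_mul f g : lext isnil (f * g) = lext isnil f * lext isnil g.
Proof.
apply: (@lextM _ F^o isnil (fun x y : F => x * y)).
- by move=> c x y z; rewrite mulrDl -mulrA.
- by move=> c x y z; rewrite mulrDr mulrCA.
- by move=> s t; rewrite /isnil; case: s => [|v s]; rewrite /= ?mul1r ?mul0r.
Qed.

Lemma no_constE f : no_const f <-> lext isnil f = 0.
Proof. by rewrite /no_const const_lext. Qed.

Lemma lext_nil_prod (psi : Var -> FA F) s :
  lext isnil (\prod_(v <- s) psi v) = \prod_(v <- s) lext isnil (psi v).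
Proof.
elim: s => [|v s IHs]; first by rewrite !big_nil -w2f0 (lext_w isnil [::]).
by rewrite !big_cons const_mul IHs.
Qed.

End ConstantTerm.

Section Evaluation.
Variables (F : fieldType) (k : nat).
Implicit Types (f g : FA F) (s : seq Var) (phi : Var -> 'M[F]_k).

Lemma evalpE phi f : evalp phi f = lext (evalw phi) f.
Proof. by []. Qed.

Lemma evalw_cat phi s t : evalw phi (s ++ t) = evalw phi s *m evalw phi t.
Proof. by elim: s => [|v s IHs] /=; rewrite ?mul1mx // IHs mulmxA. Qed.

Lemma evalpM phi f g : evalp phi (f * g) = evalp phi f *m evalp phi g.
Proof.
rewrite !evalpE; apply: (@lextM _ _ _ (fun x y : 'M[F]_k => x *m y)).
- by move=> c x y z; rewrite mulmxDl -scalemxAl.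
- by move=> c x y z; rewrite mulmxDr -scalemxAr.
- exact: evalw_cat.
Qed.

Lemma evalp_mul phi f g x y : evalp phi f = x -> evalp phi g = y -> evalp phi (f * g) = x *m y.
Proof. by move=> <- <-; exact: evalpM. Qed.

Lemma evalp1 phi : evalp phi 1 = 1%:M.
Proof. by rewrite -w2f0 evalpE (lext_w _ [::]). Qed.

Lemma evalp_var phi v : evalp phi (var F v) = phi v.
Proof. by rewrite evalpE (lext_w _ [:: v]) /= mulmx1. Qed.

Lemma evalp_comm phi u v :
  evalp phi (comm (var F u) (var F v)) = phi u *m phi v - phi v *m phi u.
Proof.
apply: etrans (lextB _ _ _) _.
exact: (congr2 (fun x y : 'M[F]_k => x - y) (evalp_mul (evalp_var _ _) (evalp_var _ _))
  (evalp_mul (evalp_var _ _) (evalp_var _ _))).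
Qed.

Lemma evalp_prod phi (J : Type) (r : seq J) (h : J -> Var) :
  evalp phi (\prod_(j <- r) var F (h j)) = foldr mulmx 1%:M [seq phi (h j) | j <- r].
Proof.
elim: r => [|j r IHr]; first by rewrite big_nil evalp1.
by rewrite big_cons (evalp_mul (evalp_var _ _) IHr).
Qed.

Lemma evalp_word phi psi s :
  evalp phi (\prod_(v <- s) psi v) = evalw (fun v => evalp phi (psi v)) s.
Proof.
elim: s => [|v s IHs]; first by rewrite big_nil evalp1.
by rewrite big_cons (evalp_mul (erefl _) IHs).
Qed.

Lemma evalp_subst phi psi f : evalp phi (subst psi f) = evalp (fun v => evalp phi (psi v)) f.
Proof.
rewrite evalpE /subst lext_sum; apply: eq_bigr => m _.
by rewrite lextZ -evalpE evalp_word.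
Qed.

Variable X : 'M[F]_k -> Prop.
Hypotheses (X0 : X 0) (XZD : forall c x y, X x -> X y -> X (c *: x + y)).
Hypothesis XM : forall x y, X x -> X y -> X (x *m y).

Lemma evalw_odd phi s : (forall i, phi (true, i) = 0) -> ~~ evw s -> evalw phi s = 0.
Proof.
move=> p0; elim: s => //= [[[] i] s IHs] /=; first by rewrite p0 mul0mx.
by move/IHs->; rewrite mulmx0.
Qed.

Lemma evalw_in phi s : graded_eval X (@zero_part F k) phi -> s != [::] -> X (evalw phi s).
Proof.
move=> [p0 p1]; have pX v : X (phi v) by case: v => [[] i]; rewrite ?p1 //; apply: p0.
elim: s => [//|v [|u s] IHs] _; first by rewrite /= mulmx1.
by rewrite [evalw _ _]/(phi v *m evalw phi (u :: s)); apply: XM => //; apply: IHs.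
Qed.

Lemma evalp_in phi f : graded_eval X (@zero_part F k) phi -> no_const f -> X (evalp phi f).
Proof.
move=> gp f0; rewrite /evalp.
suff H (r : seq {fmonom Var}) : X (\sum_(m <- r) f@_m *: evalw phi (fmonom_val m)) by exact: H.
elim: r => [|m r IHr]; first by rewrite big_nil.
rewrite big_cons; case: (eqVneq (fmonom_val m) [::]) => [e|ne].
  have -> : m = mone by apply/eqP; rewrite fmP fm1 e.
  by rewrite f0 scale0r add0r.
by apply: XZD => //; apply: evalw_in.
Qed.

(** A graded substitution followed by a graded evaluation is a graded evaluation: even variables
    take values that are polynomials without constant term in elements of X, and odd ones take the
    value 0 because each of their monomials contains an odd letter. *)
Lemma Idgr_T2 : is_T2ideal (Idgr X (@zero_part F k)).
Proof.
have ideal f g : Idgr X (@zero_part F k) f -> Idgr X (@zero_part F k) (g * f) /\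
    Idgr X (@zero_part F k) (f * g).
  move=> [/no_constE n1 e1]; split; split=> [|phi gp].
  - by apply/no_constE; rewrite const_mul n1 mulr0.
  - by rewrite (evalp_mul (erefl _) (e1 _ gp)) mulmx0.
  - by apply/no_constE; rewrite const_mul n1 mul0r.
  - by rewrite (evalp_mul (e1 _ gp) (erefl _)) mul0mx.
split.
- move=> f g [/no_constE n1 e1] [/no_constE n2 e2]; split=> [|phi gp].
    by apply/no_constE; rewrite lextD n1 n2 addr0.
  by rewrite evalpE lextD -!evalpE e1 // e2 // addr0.
- move=> c f [/no_constE n1 e1]; split=> [|phi gp].
    by apply/no_constE; rewrite lextZ n1 scaler0.
  by rewrite evalpE lextZ -evalpE e1 // scaler0.
- exact: ideal.
move=> psi [pe po] f [n1 e1].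
have psi0 v : lext (@isnil F) (psi v) = 0.
  case: v => [[] i]; apply/no_constE; last by case: (pe i).
  rewrite /no_const; apply: mcoeff_outdom; apply/negP => /po.
  by rewrite /odd_count /= fm1.
split=> [|phi gp].
  apply/no_constE; rewrite /subst lext_sum big_seq big1 // => m mf.
  rewrite lextZ lext_nil_prod; case e : (fmonom_val m) => [|v s].
    have mE : m = mone by apply/eqP; rewrite fmP fm1 e.
    by rewrite mE n1 scale0r.
  by rewrite big_cons psi0 mul0r scaler0.
rewrite evalp_subst; apply: e1; case: gp => p0 p1; split=> i.
  by apply: evalp_in => //; case: (pe i).
rewrite /zero_part /evalp big_seq big1 // => m /po om; rewrite evalw_odd ?scaler0 //.
apply: contraL om => em; rewrite /odd_count.
suff -> : count (fun v : Var => v.1) m = 0%N by [].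
apply/eqP; rewrite -leqn0 leqNgt -has_count; apply/hasPn => v vm.
by apply: (allP em).
Qed.

End Evaluation.

Section Generators.
Variable F : fieldType.
Implicit Types (f g : FA F).

Lemma no_const_var v : no_const (var F v).
Proof. by apply/no_constE; rewrite (lext_w _ [:: v]). Qed.

Lemma no_const_comm f g : no_const (comm f g).
Proof.
apply/no_constE; apply: etrans (lextB _ _ _) _.
apply: etrans (congr2 (fun x y : F => x - y) (const_mul f g) (const_mul g f)) _.
by rewrite mulrC subrr.
Qed.

Lemma no_const_mull f g : no_const f -> no_const (f * g).
Proof. by move=> /no_constE f0; apply/no_constE; rewrite const_mul f0 mul0r. Qed.
Lemma no_const_mulr f g : no_const f -> no_const (g * f).
Proof. by move=> /no_constE f0; apply/no_constE; rewrite const_mul f0 mulr0. Qed.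
End Generators.

(** * Identities and central polynomials of A_k *)

Section AlgebraA.
Variables (F : fieldType) (charF0 : [pchar F] =i pred0) (m : nat).
Local Notation k := m.+2.
Implicit Types (f : FA F).

Lemma IdA_crit f : Idgr (@Ak F k) (@zero_part F k) f -> crit id m.+1 f.
Proof.
move=> [_ f0]; apply: crit_of_generic => // a h b; apply: f0.
by split=> i //; apply: genmx_Ak.
Qed.

Lemma gensA_Id f : gensA k f -> Idgr (@Ak F k) (@zero_part F k) f.
Proof.
case=> ->; split=> [|phi [p0 p1]].
- exact: no_const_mull (no_const_comm _ _).
- by rewrite (evalp_mul (evalp_comm _ _ _) (evalp_comm _ _ _)); apply: commA_comm.
- exact: no_const_mull (no_const_comm _ _).
- rewrite (evalp_mul (evalp_comm _ _ _) (evalp_prod _ _ _)).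
  apply: (commA_prod (s := [seq phi (false, j) | j <- index_iota 3 k.+2])) => //.
    by move=> z /mapP[j _ ->].
  by rewrite size_map size_iota.
- exact: no_const_var.
- by rewrite evalp_var; apply: p1.
Qed.

Lemma IdA_T2 : is_T2ideal (Idgr (@Ak F k) (@zero_part F k)).
Proof.
by apply: Idgr_T2; [apply: Ak0 | move=> *; apply: AkZD | move=> *; apply: AkM].
Qed.

Lemma T2gen_IdA f : T2gen (@gensA F k) f -> Idgr (@Ak F k) (@zero_part F k) f.
Proof. by apply; [apply: IdA_T2 | apply: gensA_Id]. Qed.

Lemma critA_T2gen f : crit id m.+1 f -> T2gen (@gensA F k) f.
Proof. exact: (@T2genA F k f isT). Qed.

Lemma CgrA_Id f : Cgr (@Ak F k) (@zero_part F k) f <-> Idgr (@Ak F k) (@zero_part F k) f.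
Proof.
split=> [[n0 fC]|[n0 f0]]; split=> // phi gp; first by apply: center_Ak; apply: fC.
rewrite f0 //; split; first by apply/in_super0; apply: Ak0.
by move=> b _; rewrite mul0mx mulmx0.
Qed.

End AlgebraA.

(** * Transfer to B_k by reflection *)

Section AlgebraB.
Variables (F : fieldType) (charF0 : [pchar F] =i pred0) (m : nat).
Local Notation k := m.+2.
Implicit Types (f : FA F) (x y : 'M[F]_k) (i j : 'I_k).

(* The reflection in the antidiagonal is an anti-automorphism of M_k(F) which
   exchanges A_k and B_k. *)
Definition flip x : 'M[F]_k := \matrix_(i, j) x (rev_ord j) (rev_ord i).

Lemma flipK : involutive flip.
Proof. by move=> x; apply/matrixP => i j; rewrite !mxE !rev_ordK. Qed.

Lemma flipM x y : flip (x *m y) = flip y *m flip x.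
Proof.
apply/matrixP => i j; rewrite !mxE (reindex_inj rev_ord_inj) /=.
by apply: eq_bigr => l _; rewrite !mxE mulrC.
Qed.

Lemma flipZD c x y : flip (c *: x + y) = c *: flip x + flip y.
Proof. by apply/matrixP => i j; rewrite !mxE. Qed.
Lemma flip0 : flip 0 = 0.
Proof. by apply/matrixP => i j; rewrite !mxE. Qed.
Lemma flip1 : flip 1%:M = 1%:M.
Proof. by apply/matrixP => i j; rewrite !mxE (inj_eq rev_ord_inj) eq_sym. Qed.
Lemma flipB x y : flip (x - y) = flip x - flip y.
Proof. by apply/matrixP => i j; rewrite !mxE. Qed.
Lemma flip_eq0 x : flip x = 0 -> x = 0.
Proof. by move=> x0; rewrite -(flipK x) x0 flip0. Qed.

Lemma flipD x y : flip (x + y) = flip x + flip y.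
Proof. by apply/matrixP => i j; rewrite !mxE. Qed.
Lemma flipZ c x : flip (c *: x) = c *: flip x.
Proof. by apply/matrixP => i j; rewrite !mxE. Qed.
Lemma flip_sum (r : seq nat) (h : nat -> 'M[F]_k) :
  flip (\sum_(d <- r) h d) = \sum_(d <- r) flip (h d).
Proof. by apply: (big_morph _ flipD flip0). Qed.

Lemma flip_mxpow d : flip (mxpow (Emx F k) d) = mxpow (Emx F k) d.
Proof.
apply/matrixP => i j; rewrite mxE !mxpow_entry /=; congr (nat_of_bool _)%:R.
by have := ltn_ord i; have := ltn_ord j; clear => hj hi; apply/eqP/eqP; lia.
Qed.

Lemma flip_eu p q : (0 < p <= k)%N -> (0 < q <= k)%N ->
  flip (eu F k p q) = eu F k (k.+1 - q) (k.+1 - p).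
Proof.
move=> hp hq; apply/matrixP => i j; rewrite !mxE /= andbC; congr (nat_of_bool _)%:R.
have := ltn_ord i; have := ltn_ord j; move: hp hq; clear => hp hq hj hi.
by congr andb; apply/eqP/eqP; lia.
Qed.

Lemma flip_Ak x : Ak x -> Bk (flip x).
Proof.
move=> [a [b [c ->]]]; exists a, b, (fun d => c (k.+1 - d)%N).
rewrite !flipD flipZ flip_eu // !flip_sum subSS subn0; congr (_ + _ + _).
  by apply: eq_bigr => d _; rewrite flipZ flip_mxpow.
rewrite big_nat_rev big_add1; apply: eq_big_nat => d /andP[d0 dk].
have e : (2 + k.+1 - d.+2 = k.+1 - d)%N by clear -dk; lia.
have e2 : (k.+1 - (k.+1 - d) = d)%N by clear -dk; lia.
have e3 : (0 < k.+1 - d <= k)%N by clear -d0 dk; lia.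
by rewrite e flipZ flip_eu // e2 subSS subn0.
Qed.

Lemma flip_Bk x : Bk x -> Ak (flip x).
Proof.
move=> [a [b [c ->]]]; exists a, b, (fun d => c (k.+1 - d)%N).
have kk : (0 < k <= k)%N by rewrite leqnn.
rewrite !flipD flipZ flip_eu // !flip_sum subSn // subnn; congr (_ + _ + _).
  by apply: eq_bigr => d _; rewrite flipZ flip_mxpow.
rewrite [RHS]big_nat_rev big_add1; apply: eq_big_nat => d /andP[d0 dk].
have e : (2 + k.+1 - d.+2 = k.+1 - d)%N by clear -dk; lia.
have e2 : (k.+1 - (k.+1 - d) = d)%N by clear -dk; lia.
have e3 : (0 < k.+1 - d <= k)%N by clear -d0 dk; lia.
have e4 : (k.+1 - k = 1)%N by rewrite subSn // subnn.
have e5 : (0 < d <= k)%N by rewrite d0 ltnW.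
by rewrite e e2 flipZ flip_eu // e4.
Qed.

Lemma BkE x : Bk x <-> Ak (flip x).
Proof. by split=> [/flip_Bk //|/flip_Ak]; rewrite flipK. Qed.

Lemma Bk0 : Bk (0 : 'M[F]_k).
Proof. by apply/BkE; rewrite flip0; apply: Ak0. Qed.
Lemma BkZD c x y : Bk x -> Bk y -> Bk (c *: x + y).
Proof. by move=> /BkE Bx /BkE By; apply/BkE; rewrite flipZD; apply: AkZD. Qed.
Lemma BkM x y : Bk x -> Bk y -> Bk (x *m y).
Proof. by move=> /BkE Bx /BkE By; apply/BkE; rewrite flipM; apply: AkM. Qed.

Lemma center_Bk x : center (@Bk F k) (@zero_part F k) x -> x = 0.
Proof.
move=> [/in_super0 Bx xc]; apply: flip_eq0; apply: center_Ak; split.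
  by apply/in_super0; apply/BkE.
move=> b /in_super0 Ab; rewrite -(flipK b) -!flipM xc //.
by apply/in_super0; apply: flip_Ak.
Qed.

Lemma flip_mxprod (s : seq 'M[F]_k) : flip (mxprod s) = mxprod (rev (map flip s)).
Proof.
have cat s1 s2 : mxprod (s1 ++ s2) = mxprod s1 *m mxprod s2 :> 'M[F]_k.
  by elim: s1 => [|y s1 IHs] /=; rewrite ?mul1mx // IHs mulmxA.
elim: s => [|y s IHs]; first exact: flip1.
by rewrite /= flipM IHs rev_cons -cats1 cat /= mulmx1.
Qed.

Lemma flip_evalw (phi : Var -> 'M[F]_k) s :
  flip (evalw phi s) = evalw (fun v => flip (phi v)) (rev s).
Proof.
elim: s => [|v s IHs]; first exact: flip1.
by rewrite /= flipM IHs rev_cons -cats1 evalw_cat /= mulmx1.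
Qed.

Lemma IdB_crit f : Idgr (@Bk F k) (@zero_part F k) f -> crit rev m.+1 f.
Proof.
move=> [_ f0]; apply: crit_of_generic => // [s|s|a h b].
- exact: all_rev.
- exact: size_rev.
have ge : graded_eval (@Bk F k) (@zero_part F k) (fun v => flip (geneval m a h b v)).
  by split=> i; [apply: flip_Ak; apply: genmx_Ak | rewrite /zero_part /geneval /= flip0].
have e := f0 _ ge; apply: flip_eq0; rewrite -[RHS]e.
have flipL (r : seq {fmonom Var}) (h' : {fmonom Var} -> 'M[F]_k) :
    flip (\sum_(w <- r) h' w) = \sum_(w <- r) flip (h' w).
  exact: (big_morph _ flipD flip0).
rewrite /lext flipL; apply: eq_bigr => w _.
by rewrite flipZ flip_evalw revK.
Qed.

Lemma gensB_Id f : gensB k f -> Idgr (@Bk F k) (@zero_part F k) f.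
Proof.
case=> ->; split=> [|phi [p0 p1]].
- exact: no_const_mull (no_const_comm _ _).
- rewrite (evalp_mul (evalp_comm _ _ _) (evalp_comm _ _ _)); apply: flip_eq0.
  by rewrite flipM !flipB !flipM; apply: commA_comm; apply/BkE.
- exact: no_const_mulr (no_const_comm _ _).
- rewrite (evalp_mul (evalp_prod _ _ _) (evalp_comm _ _ _)); apply: flip_eq0.
  set P := foldr _ _ _.
  have : flip P = mxprod (rev (map flip [seq phi (false, l) | l <- index_iota 3 k.+2])).
    exact: (flip_mxprod [seq phi (false, l) | l <- index_iota 3 k.+2]).
  move: P => P eP; rewrite flipM flipB !flipM eP.
  apply: commA_prod; [exact/BkE | exact/BkE | | by rewrite size_rev !size_map size_iota].
  by move=> z; rewrite mem_rev => /mapP[x /mapP[j _ ->] ->]; apply/BkE.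
- exact: no_const_var.
- by rewrite evalp_var; apply: p1.
Qed.

Lemma T2gen_IdB f : T2gen (@gensB F k) f -> Idgr (@Bk F k) (@zero_part F k) f.
Proof.
apply; last exact: gensB_Id.
by apply: Idgr_T2; [apply: Bk0 | move=> *; apply: BkZD | move=> *; apply: BkM].
Qed.

Lemma critB_T2gen f : crit rev m.+1 f -> T2gen (@gensB F k) f.
Proof. exact: (@T2genB F k f isT). Qed.

Lemma CgrB_Id f : Cgr (@Bk F k) (@zero_part F k) f <-> Idgr (@Bk F k) (@zero_part F k) f.
Proof.
split=> [[n0 fC]|[n0 f0]]; split=> // phi gp; first by apply: center_Bk; apply: fC.
rewrite f0 //; split; first by apply/in_super0; apply: Bk0.
by move=> b _; rewrite mul0mx mulmx0.
Qed.

End AlgebraB.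

(** * Codimensions and characters *)

Section Multilinear.
Variables (F : fieldType) (n : nat).
Implicit Types (p : Mon n) (s t : {perm 'I_n}) (c : 'rV[F]_(Nmon n)).

Definition word (s : {perm 'I_n}) (b : {ffun 'I_n -> bool}) : seq Var :=
  [seq (b (s j), (s j : nat).+1) | j <- enum 'I_n].

Lemma mwordE p : fmonom_val (mword p) = word p.1 p.2.
Proof. by []. Qed.

Lemma size_word s b : size (word s b) = n.
Proof. by rewrite size_map size_enum_ord. Qed.

Lemma nth_word s b (j : 'I_n) x0 : nth x0 (word s b) j = (b (s j), (s j : nat).+1).
Proof. by rewrite (nth_map j) ?size_enum_ord // nth_ord_enum. Qed.

Lemma mword_inj : injective (@mword n).
Proof.
move=> [s b] [t d] /(congr1 (@fmonom_val _)); rewrite !mwordE /= => e.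
have ej j : (b (s j), (s j : nat).+1) = (d (t j), (t j : nat).+1).
  by rewrite -!(nth_word _ _ _ (false, 0%N)) e.
have st : s = t by apply/permP => j; case: (ej j) => _ /val_inj.
congr pair => //; apply/ffunP => x; rewrite -(permKV s x).
by case: (ej (s^-1 x)%g) => ->; rewrite st.
Qed.

Lemma evw_word p : evw (word p.1 p.2) = word0 p.
Proof.
rewrite /evw all_map; apply/allP/eqP => [H | -> j _]; last by rewrite /= ffunE.
apply/ffunP => x; rewrite ffunE; apply/negbTE; rewrite -(permKV p.1 x).
by apply: H; rewrite mem_enum.
Qed.

Lemma wsum_lext (Q : pred (seq Var)) (f : FA F) :
  wsum Q f = lext (fun u : seq Var => (Q u)%:R : F^o) f.
Proof.
rewrite /wsum big_mkcond; apply: eq_bigr => m _.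
by case: (Q _); rewrite ?scaler0 // -[RHS]/(_ * _) mulr1.
Qed.

Lemma wsum_embed (Q : pred (seq Var)) c :
  wsum Q (embed c) = \sum_(p : Mon n) vat c p * (Q (word p.1 p.2))%:R.
Proof.
rewrite wsum_lext /embed lext_sum [RHS](reindex (fun k : 'I_(Nmon n) => enum_val k)) /=; last first.
  by exists (@enum_rank _) => k _; rewrite ?enum_valK ?enum_rankK.
apply: eq_bigr => r _; rewrite lextZ -mwordE /vat enum_valK; congr (_ * _).
by rewrite /mono -w2f_val lext_w.
Qed.

Definition eword s := word s [ffun=> false].

Lemma eword_uniq s : uniq (eword s).
Proof. by rewrite map_inj_uniq ?enum_uniq // => i j [_ /val_inj/perm_inj]. Qed.

Lemma nth_eword s (j : 'I_n) x0 : nth x0 (eword s) j = (false, (s j : nat).+1).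
Proof. by rewrite nth_word ffunE. Qed.

Lemma index_eword s (x : 'I_n) : index (false, x.+1) (eword s) = (s^-1 x)%g.
Proof.
rewrite -{1}(permKV s x) -(nth_eword _ _ (false, 0%N)) index_uniq ?eword_uniq //.
by rewrite size_word.
Qed.

Lemma mem_eword s v : v \in eword s -> exists x : 'I_n, v = (false, x.+1).
Proof. by case/mapP => j _ ->; exists (s j); rewrite ffunE. Qed.

Lemma eword_in s (x : 'I_n) : (false, x.+1) \in eword s.
Proof. by rewrite -index_mem index_eword size_word. Qed.

Lemma mem_take_eword i s (x : 'I_n) : ((false, x.+1) \in take i (eword s)) = (s^-1 x < i)%N%g.
Proof. by rewrite in_take ?eword_in // index_eword. Qed.

Lemma mem_drop_eword i s (x : 'I_n) : ((false, x.+1) \in drop i (eword s)) = (i <= s^-1 x)%N%g.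
Proof.
have := eword_uniq s; rewrite -{1}(cat_take_drop i (eword s)) cat_uniq => /and3P[_ /hasPn dis _].
have := eword_in s x; rewrite -{1}(cat_take_drop i (eword s)) mem_cat mem_take_eword.
case: ltnP => ix /=; last by move->.
move=> _; apply/negbTE/negP => /dis; rewrite /= mem_take_eword.
by rewrite ix.
Qed.

Lemma srt_eword s t : srt (eword s) = srt (eword t).
Proof.
apply/srtP; apply: uniq_perm; rewrite ?eword_uniq // => v.
by apply/idP/idP => /mem_eword[x ->]; apply: eword_in.
Qed.

Section Marks.
Variables (R : finType) (r0 r1 r2 : R).
Hypothesis r_uniq : uniq [:: r0; r1; r2].
Local Notation markp := (markp n r0 r1 r2).
Let rE := rows_neqE r_uniq.

(** Both sides record, for each variable, whether it stands before, at or after the position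
    followed by d letters; for the key this uses that the letters of the word are distinct. *)
Lemma mark_key d s t x0 : (d < n)%N ->
  (tact s (markp d) == tact t (markp d)) = (wkey x0 d (eword s) == wkey x0 d (eword t)).
Proof.
move=> dn; have [c cd] := mark_pos dn.
have e1 : (n - d.+1 = c)%N by clear -cd; lia.
have e2 : (n - d = c.+1)%N by clear -cd; lia.
pose P (u : {perm 'I_n}) (x : 'I_n) := ((u^-1 x < c)%N%g, (u^-1 x == c)%g).
have mE (u : {perm 'I_n}) x : tact u (markp d) x =
    if (P u x).1 then r0 else if (P u x).2 then r2 else r1.
  rewrite /P /= ffunE; move: (u^-1 x)%g => y; rewrite (markpE _ _ _ cd) updE ffunE.
  rewrite -(inj_eq val_inj) /=; case: eqP => [->|yc]; first by rewrite ltnn.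
  by case: ltnP => yc'; case: leqP => h //; exfalso; clear -cd yc yc' h; lia.
have Pinj (u v : {perm 'I_n}) x : tact u (markp d) x = tact v (markp d) x -> P u x = P v x.
  rewrite !mE /P /= -!(inj_eq val_inj) /=.
  by case: ltngtP => _; case: ltngtP => _ //= /eqP; rewrite rE.
transitivity [forall x, P s x == P t x].
  apply/eqP/forallP => [e x|Pst]; first by apply/eqP/Pinj; rewrite e.
  by apply/ffunP => x; rewrite !mE (eqP (Pst x)).
rewrite /wkey !size_word e1 e2 !nth_eword.
apply/forallP/eqP => [Pst|[/srtP e3 e4 _] x].
  have Pst1 x : (s^-1 x < c)%N%g = (t^-1 x < c)%N%g by case/eqP: (Pst x).
  have Pst2 x : (s^-1 x == c)%g = (t^-1 x == c)%g by case/eqP: (Pst x).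
  have sc : s c = t c by apply: (canRL (permKV t)); apply/eqP; rewrite -Pst2 permK.
  have -> : srt (take c (eword s)) = srt (take c (eword t)).
    apply/srtP/uniq_perm; rewrite ?take_uniq ?eword_uniq // => v.
    apply/idP/idP => vin; have [x vE] := mem_eword (mem_take vin);
      by move: vin; rewrite vE !mem_take_eword ?Pst1.
  rewrite sc; congr (_, _, _); apply/srtP/uniq_perm; rewrite ?drop_uniq ?eword_uniq // => v.
  have dE (u : {perm 'I_n}) x : (c.+1 <= u^-1 x)%N%g = ~~ (P u x).1 && ~~ (P u x).2.
    by rewrite /P /= -(inj_eq val_inj) /=; case: ltngtP.
  apply/idP/idP => vin; have [x vE] := mem_eword (mem_drop vin);
    by move: vin; rewrite vE !mem_drop_eword !dE (eqP (Pst x)).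
rewrite /P -!(mem_take_eword c) (perm_mem e3) xpair_eqE eqxx /=; apply/eqP.
by rewrite !(canF_eq (permKV _)) (val_inj e4 : s c = t c).
Qed.

Variables (w : {perm 'I_n}) (tr : seq Var -> seq Var).
Hypothesis tr_word : forall s b, tr (word s b) = word (w * s)%g b.
Local Notation x0 := (false, 0%N).

Lemma wsum_content_key (kappa : seq Var) c :
  wsum (fun v => evw v && (srt (tr v) == kappa)) (embed c) =
  \sum_(p : Mon n) vat c p * (word0 p && (srt (eword (w * p.1)%g) == kappa))%:R.
Proof.
rewrite wsum_embed; apply: eq_bigr => p _; rewrite evw_word tr_word.
by case: (boolP (word0 p)) => //= /eqP->.
Qed.

Lemma wsum_mark_key d kappa c : (d < n)%N ->
  wsum (fun v => [&& evw v, (d < size v)%N & wkey x0 d (tr v) == kappa]) (embed c) =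
  \sum_(p : Mon n) vat c p * (word0 p && (wkey x0 d (eword (w * p.1)%g) == kappa))%:R.
Proof.
move=> dn; rewrite wsum_embed; apply: eq_bigr => p _; rewrite evw_word size_word dn tr_word.
by case: (boolP (word0 p)) => //= /eqP->.
Qed.

Lemma tact_tailp0 s : tact s (tailp n r0 r1 0) = tailp n r0 r1 0.
Proof. by apply/ffunP => x; rewrite !ffunE !addn0 [(n <= x)%N]leqNgt [(n <= _)%N]leqNgt !ltn_ord. Qed.

(** The values of c multiplied by [Bsi 0] and [Psi d] are the coefficient sums of [crit], by
    [mark_key]; fillings and keys that no even word realizes give empty sums. *)
Lemma crit_kerPsi K c : (0 < n)%N -> (K <= n)%N ->
  crit tr K (embed c) <-> (c <= kerPsi F r0 r1 r2 w K)%MS.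
Proof.
move=> n0 Kn; rewrite sub_kerPsi; split=> [[cont keys]|[cB cP]].
  split=> [|d dK]; apply: vatP => T; rewrite kerop_mul vat0.
    have := cont (srt (eword 1%g)); rewrite wsum_content_key => c0.
    case: (tailp n r0 r1 0 =P T) => [TT|nT].
      rewrite -[RHS]c0; apply: eq_bigr => p _.
      by rewrite tact_tailp0 TT eqxx (srt_eword _ 1%g) eqxx.
    by apply: big1 => p _; rewrite tact_tailp0 (introF eqP nT) andbF mulr0.
  have dn := leq_trans dK Kn.
  case: (pickP (fun p : Mon n => word0 p && (tact (w * p.1)%g (markp d) == T))) => [q|none].
    case/andP=> _ /eqP <-; have := keys d (wkey x0 d (eword (w * q.1)%g)) dK.
    rewrite wsum_mark_key // => {2}<-; apply: eq_bigr => p _.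
    by rewrite (mark_key _ _ x0).
  by apply: big1 => p _; rewrite none mulr0.
split=> [kappa|d kappa dK].
  rewrite wsum_content_key; case: (srt (eword 1%g) =P kappa) => [ek|nk].
    have := congr1 (fun v => vat v (tailp n r0 r1 0)) cB; rewrite kerop_mul vat0 => {2}<-.
    by apply: eq_bigr => p _; rewrite tact_tailp0 eqxx (srt_eword _ 1%g) ek eqxx.
  by apply: big1 => p _; rewrite (srt_eword _ 1%g) (introF eqP nk) andbF mulr0.
have dn := leq_trans dK Kn; rewrite wsum_mark_key //.
case: (pickP (fun p : Mon n => word0 p && (wkey x0 d (eword (w * p.1)%g) == kappa))) => [q|none].
  case/andP=> _ /eqP <-.
  have := congr1 (fun v => vat v (tact (w * q.1)%g (markp d))) (cP d dK).
  rewrite kerop_mul vat0 => {2}<-; apply: eq_bigr => p _.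
  by rewrite (mark_key _ _ x0).
by apply: big1 => p _; rewrite none mulr0.
Qed.

End Marks.
End Multilinear.

Lemma eqmx_rows (F : fieldType) m1 m2 n (A : 'M[F]_(m1, n)) (B : 'M[F]_(m2, n)) :
  (forall v : 'rV_n, (v <= A)%MS <-> (v <= B)%MS) -> (A :=: B)%MS.
Proof.
move=> AB; apply/eqmxP/andP; split; apply/row_subP => i; apply/AB; exact: row_sub.
Qed.

(** The choice in [mxspan_of] determines a matrix only up to its row space, which is all that ranks
    and, for stable spaces, traces depend on. *)
Lemma mxspan_ofP (F : fieldType) n (P : 'rV[F]_n -> Prop) (U : 'M[F]_n) :
  (forall v, (v <= U)%MS <-> P v) -> (mxspan_of P :=: U)%MS.
Proof.
move=> UP; apply: eqmx_rows => v; rewrite UP.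
exact: (epsilon_spec (inhabits 0) (fun V : 'M[F]_n => forall v, (v <= V)%MS <-> P v)
  (ex_intro _ U UP)).
Qed.

(** * The hyperoctahedral action on multilinear words *)

Section HyperoctahedralAction.
Variables (F : fieldType) (n : nat).
Variables (a : {ffun 'I_n -> bool}) (s : {perm 'I_n}).

Implicit Type p : Mon n.

Definition hyp_mon p : Mon n := ((p.1 * s)%g, [ffun x => p.2 (s^-1 x)%g]).
Definition hyp_sign p (j : 'I_n) : F :=
  if p.2 (p.1 j) then (-1) ^+ a (s (p.1 j)) else 1.

Lemma w2f_prod_scale (J : Type) (r : seq J) (e : J -> F) (v : J -> Var) :
  \prod_(j <- r) (e j *: w2f F [:: v j]) = (\prod_(j <- r) e j) *: w2f F [seq v j | j <- r].
Proof.
elim: r => [|j r IHr]; first by rewrite !big_nil w2f0 scale1r.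
rewrite !big_cons IHr -(scalerAl (e j)) FA_scalerAr scalerA.
exact: (congr1 (fun z : FA F => (e j * \prod_(i <- r) e i) *: z)
  (w2fM F [:: v j] [seq v i | i <- r])).
Qed.

Lemma hyp_var_letter p (j : 'I_n) :
  hyp_var F a s (p.2 (p.1 j), (p.1 j : nat).+1) =
  hyp_sign p j *: w2f F [:: ((hyp_mon p).2 ((hyp_mon p).1 j), ((hyp_mon p).1 j : nat).+1)].
Proof.
rewrite /hyp_var /= valK /hyp_sign permM ffunE permK.
by case: (p.2 _); rewrite ?scale1r.
Qed.

Lemma hyp_act_mono p :
  hyp_act a s (mono F p) = (\prod_(j <- enum 'I_n) hyp_sign p j) *: mono F (hyp_mon p).
Proof.
rewrite /hyp_act substE /mono -w2f_val (lext_w _ (mword p)) -(w2f_val F (mword (hyp_mon p))).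
rewrite !mwordE /word big_map -w2f_prod_scale.
by apply: eq_bigr => j _; rewrite hyp_var_letter.
Qed.

Lemma vdelta_hyp_mx p :
  vdelta F p *m hyp_mx F a s = (\prod_(j <- enum 'I_n) hyp_sign p j) *: vdelta F (hyp_mon p).
Proof.
have -> : hyp_mx F a s = kerop (fun p q : Mon n => (hyp_act a s (mono F p))@_(mword q)).
  by apply/matrixP => i j; rewrite !mxE.
apply: vatP => q; rewrite vdelta_kerop vatE vdeltaE hyp_act_mono mcoeffZ mcoeffU1.
by rewrite (inj_eq (@mword_inj n)) eq_sym.
Qed.

Lemma hyp_sign0 p : word0 p -> \prod_(j <- enum 'I_n) hyp_sign p j = 1.
Proof. by move=> /eqP p0; apply: big1 => j _; rewrite /hyp_sign p0 ffunE. Qed.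

Lemma word0_hyp_mon p : word0 (hyp_mon p) = word0 p.
Proof.
apply/eqP/eqP => [/ffunP e|e]; apply/ffunP => x; rewrite !ffunE; last by rewrite e ffunE.
by have := e (s x); rewrite !ffunE permK.
Qed.

(** The group permutes letters, by multiplication on the right, while w permutes positions, by
    multiplication on the left. The signs affect only words with an odd letter, and those are killed
    by [place]. *)
Lemma place_hyp_mx (R : finType) (w : {perm 'I_n}) (T : {ffun 'I_n -> R}) :
  hyp_mx F a s *m place F w T = place F w T *m tmx F R s.
Proof.
apply: eq_rows_basis => p; rewrite !mulmxA vdelta_hyp_mx -scalemxAl !vdelta_place.
rewrite word0_hyp_mon; case: ifP => p0; last by rewrite scaler0 mul0mx.
by rewrite hyp_sign0 // scale1r vdelta_tmx tactM mulgA.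
Qed.
End HyperoctahedralAction.

(** * Codimensions and characters from the numerical criterion *)

Section Cocharacter.
Variables (F : fieldType) (charF0 : [pchar F] =i pred0) (k : nat) (X X0 : 'M[F]_k -> Prop).
Variables (tr : seq Var -> seq Var) (w : forall n, {perm 'I_n}) (K : nat).
Hypothesis tr_word : forall n s b, tr (@word n s b) = word (w n * s)%g b.
Hypothesis Id_crit : forall f : FA F, Idgr X X0 f <-> crit tr K f.

Lemma IdP_kerPsi n (R : finType) (r0 r1 r2 : R) : uniq [:: r0; r1; r2] -> (0 < n)%N -> (K <= n)%N ->
  (mxspan_of (IdP X X0 (n:=n)) :=: kerPsi F r0 r1 r2 (w n) K)%MS.
Proof.
move=> r_uniq n0 Kn; apply: mxspan_ofP => v; rewrite /IdP Id_crit.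
by split=> /(crit_kerPsi r_uniq (@tr_word n) v n0 Kn).
Qed.

Lemma codim_gr_sum n : (0 < n)%N -> (K <= n)%N ->
  codim_gr X X0 n = (1 + \sum_(0 <= i < K) 'C(n, i) * (n - i - 1))%N.
Proof.
move=> n0 Kn; rewrite /codim_gr.
(* The rank is computed with a fixed type of three labels, so that n = 1 is covered; the characters
   use the row indices of tabloids. *)
have ru : uniq [:: None; Some false; Some true] by [].
by rewrite (IdP_kerPsi ru n0 Kn) (rank_kerPsi charF0).
Qed.

Lemma chi_gr_sum n (a : {ffun 'I_n -> bool}) s : (2 <= n)%N -> (2 * K <= n)%N ->
  chi_gr X X0 a s = chiHO0 F [:: n] a s
    + \sum_(1 <= i < K.+1) (K.+1 - i)%:R * chiHO0 F [:: (n - i)%N; i] a s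
    + \sum_(1 <= i < K) (K - i)%:R * chiHO0 F [:: (n - i - 1)%N; i; 1%N] a s.
Proof.
move=> n2 Kn; have n0 : (0 < n)%N by apply: ltnW.
have Kn' : (K <= n)%N by clear -Kn; lia.
have ru := rows_uniq n2.
have pl := place_hyp_mx F a s (w n) (R := 'I_n.+1).
have st wt := @stable_wsp F n _ wt s.
have gls b c := gl_tmx F s b c.
have stN := stable_kerPsi (trow0 n) (trow1 n) (trow2 n) pl K.
rewrite /chiHO0 -(specht_sum charF0 n2 s Kn) /chi_gr.
rewrite (trace_on_eqmx (IdP_kerPsi ru n0 Kn') stN).
apply: (trace_kerPsi charF0 ru pl (gls _) (st _) n0 Kn').
Qed.

End Cocharacter.

Lemma word_id n (s : {perm 'I_n}) b : id (word s b) = word (1 * s)%g b.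
Proof. by rewrite mul1g. Qed.

Lemma word_rev n (s : {perm 'I_n}) b : rev (word s b) = word (perm (@rev_ord_inj n) * s)%g b.
Proof.
apply: (@eq_from_nth _ (false, 0%N)); rewrite ?size_rev ?size_word // => i ni.
rewrite nth_rev ?size_word //.
have -> : (n - i.+1)%N = rev_ord (Ordinal ni) by [].
by rewrite nth_word (nth_word _ _ (Ordinal ni)) permM permE.
Qed.

Section Codimensions.
Variables (F : fieldType) (k : nat) (X X0 : 'M[F]_k -> Prop).
Hypothesis C_Id : forall f : FA F, Cgr X X0 f <-> Idgr X X0 f.

Lemma CP_IdP n : CP X X0 (n:=n) = IdP X X0 (n:=n).
Proof.
by apply: functional_extensionality => c; apply: propositional_extensionality; apply: C_Id.
Qed.

End Codimensions.

Theorem theorem3p1 (F : fieldType) (charF0 : [pchar F] =i pred0)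
  (k : nat) (hk : (2 <= k)%N) :
  [/\ (* (1) *)
      (forall f : FA F, Cgr (@Ak F k) (@zero_part F k) f <-> Idgr (@Ak F k) (@zero_part F k) f) /\
      (forall f : FA F, Idgr (@Ak F k) (@zero_part F k) f <-> T2gen (@gensA F k) f),
      (* (2) *)
      (forall f : FA F, Cgr (@Bk F k) (@zero_part F k) f <-> Idgr (@Bk F k) (@zero_part F k) f) /\
      (forall f : FA F, Idgr (@Bk F k) (@zero_part F k) f <-> T2gen (@gensB F k) f),
      (* (3) *)
      (forall X : 'M[F]_k -> Prop, X = @Ak F k \/ X = @Bk F k ->
       forall n : nat, (k.-1 <= n)%N ->
         codim_grz X (@zero_part F k) n = codim_gr X (@zero_part F k) n /\
         codim_gr X (@zero_part F k) n
           = (1 + \sum_(0 <= i < k.-1) 'C(n, i) * (n - i - 1))%N),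
      (* (4) *)
      (forall X : 'M[F]_k -> Prop, X = @Ak F k \/ X = @Bk F k ->
       forall n : nat, (2 * k.-1 <= n)%N ->
       forall (a : {ffun 'I_n -> bool}) (s : {perm 'I_n}),
         chi_grz X (@zero_part F k) a s = chi_gr X (@zero_part F k) a s /\
         chi_gr X (@zero_part F k) a s
           = chiHO0 F [:: n] a s
             + \sum_(1 <= i < k) (k - i)%:R * chiHO0 F [:: (n - i)%N; i] a s
             + \sum_(1 <= i < k.-1) (k - i - 1)%:R * chiHO0 F [:: (n - i - 1)%N; i; 1%N] a s) &
      (* (5) *)
      (forall X : 'M[F]_k -> Prop, X = @Ak F k \/ X = @Bk F k ->
       forall n : nat, (1 <= n)%N ->
         delta_gr X (@zero_part F k) n = 0%N /\
         (forall (a : {ffun 'I_n -> bool}) (s : {perm 'I_n}),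
            chi_Delta X (@zero_part F k) a s = 0))].
Proof.
case: k hk => [|[|m]] // _; set k := m.+2.
(* Here the circle closes: an identity satisfies [crit], [crit] puts f into the T-ideal, and the
   generators are identities. *)
have IdA f : Idgr (@Ak F k) (@zero_part F k) f <-> crit id m.+1 f.
  by split=> [/IdA_crit|/critA_T2gen/T2gen_IdA]; first apply.
have IdB f : Idgr (@Bk F k) (@zero_part F k) f <-> crit rev m.+1 f.
  by split=> [/IdB_crit|/critB_T2gen/T2gen_IdB]; first apply.
have sameC (X : 'M[F]_k -> Prop) : X = @Ak F k \/ X = @Bk F k ->
    forall n, CP X (@zero_part F k) (n:=n) = IdP X (@zero_part F k) (n:=n).
  by case=> -> n; apply: CP_IdP; [apply: CgrA_Id | apply: CgrB_Id].
split.
- split=> f; first exact: CgrA_Id.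
  by split=> [/IdA/critA_T2gen|/T2gen_IdA].
- split=> f; first exact: CgrB_Id.
  by split=> [/IdB/critB_T2gen|/T2gen_IdB].
- move=> X XAB n kn; split; first by rewrite /codim_grz sameC.
  have n0 : (0 < n)%N by apply: leq_trans kn.
  case: XAB => ->; first exact: (codim_gr_sum charF0 (fun n => @word_id n) IdA).
  exact: (codim_gr_sum charF0 (fun n => @word_rev n) IdB).
- move=> X XAB n kn a s; split; first by rewrite /chi_grz sameC.
  have n2 : (2 <= n)%N by apply: leq_trans kn; rewrite mulnS.
  transitivity (chiHO0 F [:: n] a s
    + \sum_(1 <= i < m.+2) (m.+2 - i)%:R * chiHO0 F [:: (n - i)%N; i] a s
    + \sum_(1 <= i < m.+1) (m.+1 - i)%:R * chiHO0 F [:: (n - i - 1)%N; i; 1%N] a s).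
    case: XAB => ->; first exact: (chi_gr_sum charF0 (fun n => @word_id n) IdA).
    exact: (chi_gr_sum charF0 (fun n => @word_rev n) IdB).
  congr (_ + _); apply: eq_bigr => i _.
  by have -> : (k - i - 1 = m.+1 - i)%N by rewrite /k; clear; lia.
- move=> X XAB n _; rewrite /delta_gr sameC // subnn; split=> // a s.
  by rewrite /chi_Delta sameC // subrr.
Qed.
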